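(* If a simple Lorentzian foliation $(M,\mathcal F,g_\intercal)$ is transversely stably causal, then it admits a transverse time function.
   Context: $M$ is a connected smooth manifold of dimension $n\ge 3$. $\mathcal F$ is a regular foliation of codimension $q\geq 2$: a partition of $M$ into connected immersed submanifolds (leaves), locally given by the fibers of a submersion. $T\mathcal F\subset TM$ is the (vertical) distribution tangent to the leaves; vectors in $T\mathcal F$, and vector fields with values in it, are called vertical. A transverse Lorentzian metric on $(M,\mathcal F)$ is a smooth symmetric $(0,2)$-tensor field $g_\intercal$ on $M$ with $\mathcal L_Vg_\intercal=0$ for all vertical $V$, such that at each $x$ the bilinear form $g_\intercal(x)$ has index $1$ and its kernel is exactly $T_x\mathcal F$. $\mathcal{TL}(M,\mathcal F)$ is the set of these. The triple $(M,\mathcal F,g_\intercal)$ is then called a Lorentzian foliation. A nonvertical vector $v$ is transversely causal if $g_\intercal(v,v)\le 0$. The set of transversely causal vectors at $x$ has two connected components (causal wedges); a transverse time orientation is a continuous choice of one of them (the future causal wedge) at each point; vectors in it are future-directed. A future-directed transversely causal curve is a piecewise smooth curve whose tangent vectors lie in the future causal wedges. For leaves $L,L'$, write $L<_{M/\mathcal F}L'$ if there is a future-directed transversely causal curve from a point of $L$ to a point of $L'$. $(M,\mathcal F,g_\intercal)$ is transversely causal if $L\nless_{M/\mathcal F}L$ for every leaf $L$. For $g_\intercal,g'_\intercal\in\mathcal{TL}(M,\mathcal F)$, write $g_\intercal<g'_\intercal$ if for every $v\in TM\setminus T\mathcal F$, $g_\intercal(v,v)\le0\Rightarrow g'_\intercal(v,v)<0$;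 in that case $g'_\intercal$ is time-oriented so that its future wedges contain those of $g_\intercal$. $(M,\mathcal F,g_\intercal)$ is transversely stably causal if there is $g'_\intercal\in\mathcal{TL}(M,\mathcal F)$ with $g_\intercal<g'_\intercal$ and $(M,\mathcal F,g'_\intercal)$ transversely causal. A transverse time function is a continuous $f:M\to\mathbb R$ that strictly increases along every future-directed transversely causal curve. Simple: $(M,\mathcal F,g_\intercal)$ is simple if there exist a spacetime (connected time-oriented Lorentzian manifold) $(B,h)$ and an onto submersion $\pi:M\to B$ such that: the leaves of $\mathcal F$ are the connected components of the fibers of $\pi$; $g_\intercal=\pi^*h$ and the transverse time orientation is induced by that of $(B,h)$ (a transversely causal vector is future-directed iff its image under $d\pi$ is); and for all $b\in B$ there is an open neighborhood $\mathcal U\ni b$ such that every fiber of $\pi$ contained in $\pi^{-1}(\mathcal U)\setminus\pi^{-1}(b)$ is connected. *)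

(* Defs.v *)
From HB Require Import structures.
From mathcomp Require Import all_boot all_order all_algebra.
From mathcomp Require Import all_classical all_reals all_analysis.
From Stdlib Require Import Relations.

Set Implicit Arguments.
Unset Strict Implicit.
Unset Printing Implicit Defensive.

Import Order.TTheory GRing.Theory Num.Theory.
Import numFieldNormedType.Exports.

Local Open Scope classical_set_scope.
Local Open Scope ring_scope.

Section smooth_on.
Context {R : realType} {V W : normedModType R}.

(* Used only for finite-dimensional V and open U, where f is C^k as soon as
   its iterated derivatives along fixed vectors exist and are continuous. *)
Fixpoint Ck_on (k : nat) (U : set V) (f : V -> W) : Prop :=
  if k is k'.+1 then
    (forall x, U x -> differentiable f x) /\
    (forall v : V, Ck_on k' U (fun x => 'D_v f x))
  else forall x, U x -> {for x, continuous f}.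

Definition smooth_on (U : set V) (f : V -> W) := forall k, Ck_on k U f.

End smooth_on.

(* A homeomorphism from the open set cdom onto the open set cmap @` cdom of
   R^n; cmap and its inverse cinv are total functions whose values outside
   these sets are irrelevant. *)
Record chart (R : realType) (n : nat) (M : topologicalType) := Chart {
  cdom : set M;
  cmap : M -> 'rV[R]_n;
  cinv : 'rV[R]_n -> M;
  cdom_open : open cdom;
  ccod_open : open (cmap @` cdom);
  cmapK : forall x, cdom x -> cinv (cmap x) = x;
  cmap_continuous : forall x, cdom x -> {for x, continuous cmap};
  cinv_continuous : forall y, (cmap @` cdom) y -> {for y, continuous cinv} }.

(* The smooth structure is given by an atlas indexed by the points, chart_at x
   being a chart around x.  Every smooth atlas contains one of this form,
   which defines the same smooth structure. *)
Record manifold (R : realType) (n : nat) := Manifold {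
  mspace :> topologicalType;
  chart_at : mspace -> chart R n mspace;
  chart_at_dom : forall x, cdom (chart_at x) x;
  chart_compat : forall x y,
    smooth_on (cmap (chart_at x) @` (cdom (chart_at x) `&` cdom (chart_at y)))
              (cmap (chart_at y) \o cinv (chart_at x));
  manifold_hausdorff : hausdorff_space mspace;
  manifold_second_countable : @second_countable mspace }.

Section manifolds.
Context {R : realType} {n : nat} (M : manifold R n).

Local Notation dom x := (cdom (chart_at x)).
Local Notation phi x := (cmap (chart_at x)).
Local Notation phiV x := (cinv (chart_at x)).
Local Notation cod x := (phi x @` dom x).

(* T_xM: a tangent vector at x is given by its components in chart_at x. *)
Definition tangent (x : M) : Type := 'rV[R]_n.

(* If p lies in the domains of chart_at x and chart_at y, this sends the
   components in chart_at x of a tangent vector at p to its components in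
   chart_at y. *)
Definition change_coord (p x y : M) (u : 'rV[R]_n) : 'rV[R]_n :=
  'd (phi y \o phiV x) (phi x p) u.

Definition coord (z p : M) (v : tangent p) : 'rV[R]_n := change_coord p p z v.
Definition vect (z p : M) (u : 'rV[R]_n) : tangent p := change_coord p z p u.

Definition vfield := forall x : M, tangent x.

(* Components in chart_at z of a vector field, as functions on cod z. *)
Definition vfield_in (z : M) (X : vfield) (y : 'rV[R]_n) : 'rV[R]_n :=
  coord z (X (phiV z y)).

Definition smooth_vfield (X : vfield) :=
  forall z : M, smooth_on (cod z) (vfield_in z X).

(* A (0,2)-tensor field: g x is the Gram matrix, in chart_at x, of a bilinear
   form on T_xM. *)
Definition tensor2 := M -> 'M[R]_n.

Definition ev (g : tensor2) (x : M) (v w : tangent x) : R :=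
  ((v : 'rV[R]_n) *m g x *m (w : 'rV[R]_n)^T) ord0 ord0.

Definition tensor_in (z : M) (g : tensor2) (y u w : 'rV[R]_n) : R :=
  ev g (vect z (phiV z y) u) (vect z (phiV z y) w).

Definition smooth_tensor2 (g : tensor2) :=
  forall (z : M) (u w : 'rV[R]_n),
    smooth_on (cod z) (fun y => tensor_in z g y u w : R^o).

Definition symmetric_tensor2 (g : tensor2) := forall x : M, (g x)^T = g x.

(* (L_X g)_x(u, w) by the coordinate formula
   (L_X g)_ij = X^k d_k g_ij + g_kj d_i X^k + g_ik d_j X^k in chart_at x. *)
Definition lie_derivative (X : vfield) (g : tensor2) (x : M)
    (u w : tangent x) : R :=
  let y := phi x x in
  let Xx := vfield_in x X in
  'D_(Xx y) (fun y' => tensor_in x g y' u w : R^o) y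
  + tensor_in x g y ('D_u Xx y) w
  + tensor_in x g y u ('D_w Xx y).

Definition negative_definite_on (g : tensor2) (x : M)
    (E : {vspace 'rV[R]_n}) :=
  forall v : tangent x, v \in E -> v != 0 :> 'rV[R]_n -> ev g v v < 0.

Definition has_index (g : tensor2) (x : M) (k : nat) :=
  (exists2 E : {vspace 'rV[R]_n}, \dim E = k & negative_definite_on g x E) /\
  (forall E : {vspace 'rV[R]_n}, negative_definite_on g x E -> (\dim E <= k)%N).

(* One subset of each tangent space.  This represents both time orientations
   and, as the argument D of the definitions below, T F on a foliated manifold
   and the zero vectors on a Lorentzian manifold. *)
Definition tangent_subsets := forall x : M, set (tangent x).

Definition zero_tangents : tangent_subsets :=
  fun x v => v = 0 :> 'rV[R]_n.

Record lorentzian_mod (D : tangent_subsets) (g : tensor2) : Prop :=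
    LorentzianMod {
  lor_smooth : smooth_tensor2 g;
  lor_symmetric : symmetric_tensor2 g;
  lor_index : forall x : M, has_index g x 1;
  lor_kernel : forall (x : M) (v : tangent x),
    (forall w : tangent x, ev g v w = 0) <-> D x v }.

Definition causal_vectors (D : tangent_subsets) (g : tensor2) (x : M) :
    set 'rV[R]_n :=
  [set v : tangent x | ~ D x v /\ ev g v v <= 0].

Definition is_wedge (D : tangent_subsets) (g : tensor2) (x : M)
    (C : set 'rV[R]_n) :=
  exists2 v, causal_vectors D g x v &
    C = connected_component (causal_vectors D g x) v.

(* T x is the future causal wedge at x; the choice is continuous if around
   every point there is a continuous vector field with values in it. *)
Definition time_orientation (D : tangent_subsets) (g : tensor2)
    (T : tangent_subsets) :=
  (forall x : M, is_wedge D g x (T x)) /\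
  (forall x : M, exists (U : set M) (X : vfield),
    [/\ open U, U x, U `<=` dom x,
        (forall y, (phi x @` U) y -> {for y, continuous (vfield_in x X)})
      & forall p : M, U p -> T p (X p)]).

Definition smooth_curve_on (J : set R) (s : R -> M) :=
  (forall t, J t -> {for t, continuous s}) /\
  (forall z : M,
    smooth_on (V := R^o) (J `&` [set t | dom z (s t)]) (phi z \o s)).

Definition velocity (s : R -> M) (t : R) : tangent (s t) :=
  ('D_(1 : R^o) (phi (s t) \o s : R^o -> 'rV[R]_n) t).

(* The restriction of gam to [a, b] is smooth up to the end points, i.e.
   extends smoothly to an open interval, and has all its (at the end points:
   one-sided) velocities in T. *)
Definition directed_arc (T : tangent_subsets) (gam : R -> M) (a b : R) :=
  exists (s : R -> M) (e : R),
    [/\ 0 < e, smooth_curve_on `]a - e, b + e[ s,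
        (forall t, t \in `[a, b] -> gam t = s t)
      & forall t, t \in `[a, b] -> T (s t) (velocity s t)].

Definition future_directed_causal_curve (T : tangent_subsets) (a b : R)
    (gam : R -> M) :=
  a < b /\
  exists (k : nat) (t : nat -> R),
    [/\ t 0%N = a, t k = b
      & forall i, (i < k)%N ->
          t i < t i.+1 /\ directed_arc T gam (t i) (t i.+1)].

Section maps_to_euclidean.
Context {q : nat}.

Definition euclidean_differential (s : M -> 'rV[R]_q) (x : M) (v : tangent x) :
    'rV[R]_q :=
  'd (s \o phiV x) (phi x x) v.

Definition euclidean_submersion_on (U : set M) (s : M -> 'rV[R]_q) :=
  (forall z : M, smooth_on (phi z @` (dom z `&` U)) (s \o phiV z)) /\
  (forall x, U x -> forall w : 'rV[R]_q,
    exists v : tangent x, euclidean_differential s v = w).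

End maps_to_euclidean.

(* The foliation is given by submersions onto open subsets of R^q, defined on
   an open cover, with the same kernels on overlaps: the leaves are locally
   their fibers. *)
Record foliation (q : nat) := Foliation {
  fidx : Type;
  fdom : fidx -> set M;
  fmap : fidx -> M -> 'rV[R]_q;
  fdom_open : forall i, open (fdom i);
  fdom_cover : forall x, exists i, fdom i x;
  fmap_submersion : forall i, euclidean_submersion_on (fdom i) (fmap i);
  fmap_compat : forall i j x (v : tangent x), fdom i x -> fdom j x ->
    euclidean_differential (fmap i) v = 0 ->
    euclidean_differential (fmap j) v = 0 }.

End manifolds.

Arguments tangent {R n M} x.
Arguments vfield {R n} M.
Arguments tensor2 {R n} M.
Arguments tangent_subsets {R n} M.
Arguments zero_tangents {R n} M.

Section maps.
Context {R : realType} {n m : nat} {M : manifold R n} {B : manifold R m}.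

Definition differential (f : M -> B) (x : M) (v : tangent x) : tangent (f x) :=
  'd (cmap (chart_at (f x)) \o f \o cinv (chart_at x))
     (cmap (chart_at x) x) (v : 'rV[R]_n).

Definition smooth_map (f : M -> B) :=
  continuous f /\
  forall (x : M) (y : B),
    smooth_on
      (cmap (chart_at x) @`
         (cdom (chart_at x) `&` f @^-1` cdom (chart_at y)))
      (cmap (chart_at y) \o f \o cinv (chart_at x)).

Definition submersion (f : M -> B) :=
  smooth_map f /\
  forall (x : M) (w : tangent (f x)), exists v : tangent x, differential f v = w.

End maps.

Section lorentzian_foliations.
Context {R : realType} {n q : nat} {M : manifold R n} (F : foliation M q).

Definition vertical : tangent_subsets M :=
  fun x v => exists2 i : fidx F, fdom i x & euclidean_differential (fmap i) v = 0.

(* Plaques are the connected components of the fibers of the local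
   submersions, and the leaf through x consists of the points that can be
   joined to x by a chain of plaques. *)
Definition same_plaque (x y : M) :=
  exists2 i : fidx F, fdom i x &
    connected_component (fdom i `&` [set z | fmap i z = fmap i x]) x y.

Definition leaf (x : M) : set M := clos_refl_sym_trans M same_plaque x.

Record transverse_lorentzian (g : tensor2 M) : Prop := TransverseLorentzian {
  tl_lorentzian : lorentzian_mod vertical g;
  tl_lie : forall X : vfield M, smooth_vfield X ->
    (forall x, vertical (X x)) ->
    forall (x : M) (u w : tangent x), lie_derivative X g u w = 0 }.

Definition transverse_time_orientation (g : tensor2 M)
    (T : tangent_subsets M) :=
  time_orientation vertical g T.

(* The relation L <_{M/F} L' between the leaves through x and x'. *)
Definition leaf_lt (T : tangent_subsets M) (x x' : M) :=
  exists (a b : R) (gam : R -> M),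
    [/\ future_directed_causal_curve T a b gam, leaf x (gam a)
      & leaf x' (gam b)].

Definition transversely_causal (T : tangent_subsets M) :=
  forall x : M, ~ leaf_lt T x x.

Definition wider (g g' : tensor2 M) :=
  forall (x : M) (v : tangent x),
    ~ vertical v -> ev g v v <= 0 -> ev g' v v < 0.

Definition transversely_stably_causal (g : tensor2 M)
    (T : tangent_subsets M) :=
  exists (g' : tensor2 M) (T' : tangent_subsets M),
    [/\ transverse_lorentzian g', wider g g',
        transverse_time_orientation g' T',
        (forall x : M, T x `<=` T' x)
      & transversely_causal T'].

Definition transverse_time_function (T : tangent_subsets M) (f : M -> R) :=
  continuous f /\
  forall (a b : R) (gam : R -> M), future_directed_causal_curve T a b gam ->
    forall s t, a <= s -> s < t -> t <= b -> f (gam s) < f (gam t).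

Definition simple_foliation (g : tensor2 M) (T : tangent_subsets M) :=
  exists (m : nat) (B : manifold R m) (h : tensor2 B) (TB : tangent_subsets B)
      (pi : M -> B),
    [/\ [/\ connected [set: B],
            lorentzian_mod (zero_tangents B) h
          & time_orientation (zero_tangents B) h TB],
        [/\ submersion pi, (forall b : B, exists x : M, pi x = b)
          & forall x : M,
              leaf x = connected_component (pi @^-1` [set pi x]) x],
        forall (x : M) (v w : tangent x),
          ev g v w = ev h (differential pi v) (differential pi w),
        forall (x : M) (v : tangent x), causal_vectors vertical g x v ->
          (T x v <-> TB (pi x) (differential pi v))
      & forall b : B, exists U : set B,
          [/\ open U, U b
            & forall c : B, U c -> c <> b -> connected (pi @^-1` [set c])]].

End lorentzian_foliations.

(* Main.v *)
Require Import Defs.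
From HB Require Import structures.
From mathcomp Require Import all_boot all_order all_algebra.
From mathcomp Require Import all_classical all_reals all_analysis.
From mathcomp Require Import ring lra.
From Stdlib Require Import Relations.

Set Implicit Arguments.
Unset Strict Implicit.
Unset Printing Implicit Defensive.

Import Order.TTheory GRing.Theory Num.Theory.
Import numFieldNormedType.Exports.

Local Open Scope classical_set_scope.
Local Open Scope ring_scope.

(* Let O be the field of open cones of g'-timelike future vectors on M, for the
   wider causal metric g'.  Off the exceptional fibers the fibers of pi are
   leaves, and O-chains can be slid along leaves; pushing a chain slightly to the
   past moves it off an exceptional fiber.  Hence "some O-chain joins the fiber of
   c to that of c'" is transitive in c, c', and it is irreflexive because g' is
   transversely causal.  The metric g' itself need not descend to B, so one takes
   a proper weight D > 0 on M and, for 0 < l < 1, lets Q l b be the image under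
   d pi of the future vectors that are timelike for both g' and
   (1 - l) g + l g', at those points of the fiber of b where D exceeds 1 - l
   times any value on the fiber.  Such points form relatively compact sets, so
   the cone fields Q l are locally uniformly nested as l grows; they contain the
   h-causal cones and have no closed chains.  An Urysohn-type function built from
   the nested open futures (for Q (l / 2)) of small sets, summed over a countable
   family of such sets, is then a time function on B, and its pullback by pi is
   the transverse time function. *)

(** The obstacle is uniformity. Nonvertical [g]-causal vectors are [g']-timelike, but only
    pointwise, and images of cones over whole fibers, which need not be compact, would leave no
    common margin. Both conditions in [Q l] are therefore built so that their weak form for [l]
    implies the strict form for [l' > l]. For the weight this is the loss factor; the maximum of [D]
    on a fiber is attained because [D] is proper. For the mixture, let a nonvertical [v] have
    nonpositive mixture for [l]. If [v] is [g]-causal, it is [g']-timelike by width. If not, its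
    [g]-value is positive, so its [g']-value is negative and raising [l] lowers the mixture. In both
    cases the mixture for [l'] is negative. Chains consist of chart-straight steps inside boxes of
    directions, so that openness in the end points is built in, and Cousin's argument passes from
    local to global. At a parameter [t] that argument compares two points [s <= t <= u], neither of
    which need be [t]; this is why derivatives are taken in the strict sense. *)

Section cousin.
Context {R : realType}.

(* Cousin's compactness argument for a transitive relation along [a, b]. *)
Lemma cousin_chain (Rel : R -> R -> Prop) (a b : R) : a < b ->
  (forall s t u, a <= s -> s < t -> t < u -> u <= b ->
     Rel s t -> Rel t u -> Rel s u) ->
  (forall t, a <= t -> t <= b -> exists2 d, 0 < d &
     forall s u, a <= s -> s <= t -> t <= u -> u <= b -> s < u ->
       t - d < s -> u < t + d -> Rel s u) ->
  Rel a b.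
Proof.
move=> ab tr loc.
pose E := [set t | a <= t <= b /\ (t = a \/ (a < t /\ Rel a t))].
have Ea : E a by split; [rewrite lexx ltW|left].
have ubE : ubound E b by move=> t [/andP[]].
have supE : has_sup E by split; [exists a|exists b].
set c := sup E.
have ac : a <= c by apply: ub_le_sup => //; exists b.
have cb : c <= b by apply: ge_sup => //; exists a.
have [d d0 dP] := loc c ac cb.
have [s Es ds] := sup_adherent d0 supE.
have sc : s <= c by apply: ub_le_sup => //; exists b.
have [/andP[as_ sb] Hs] := Es.
have Rc : c = a \/ (a < c /\ Rel a c).
  have [->|sc'] := eqVneq c s; first by [].
  have lsc : s < c by rewrite lt_neqAle sc eq_sym sc'.
  right; have Rsc : Rel s c by apply: dP => //; rewrite ltrDl.
  split; first exact: le_lt_trans lsc.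
  by case: Hs => [<-//|[a_s Ras]]; apply: (tr a s c).
have [cb'|bc] := ltP c b; last first.
  have -> : b = c by apply/eqP; rewrite eq_le bc cb.
  by case: Rc => [ca|[]//]; move: ab; rewrite -ca ltNge bc.
pose e := Num.min b (c + d / 2).
have ce : c < e by rewrite lt_min cb' ltrDl divr_gt0.
have eb : e <= b by rewrite ge_min lexx.
have ed : e < c + d by rewrite gt_min; apply/orP; right; lra.
have Rce : Rel c e by apply: dP => //; [exact: ltW|rewrite ltrBlDr ltrDl].
have : E e.
  split; first by rewrite (le_trans ac (ltW ce)).
  right; split; first exact: le_lt_trans ce.
  by case: Rc => [<-//|[a_c Rac]]; apply: (tr a c e).
by move=> /(ub_le_sup (ex_intro _ b ubE)); rewrite leNgt ce.
Qed.

End cousin.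

(** * Strict differentiability *)

Section strict_differentiability.
Context {R : realType}.
Implicit Types V W Z : normedModType R.

Definition bounded_linear V W (L : V -> W) :=
  linear L /\ exists2 C, 0 < C & forall v, `|L v| <= C * `|v|.

(* Strict differentiability, with [L] intended to be bounded and linear. *)
Definition sdiff V W (f : V -> W) (x : V) (L : V -> W) :=
  forall e, 0 < e -> exists2 d, 0 < d & forall y y',
    `|y - x| < d -> `|y' - x| < d ->
    `|f y' - f y - L (y' - y)| <= e * `|y' - y|.

Lemma blinB V W (L : V -> W) u v : bounded_linear L -> L (u - v) = L u - L v.
Proof. by move=> [lin _]; rewrite addrC -scaleN1r lin scaleN1r addrC. Qed.

Lemma blin0 V W (L : V -> W) : bounded_linear L -> L 0 = 0.
Proof. by move=> bL; rewrite -(subrr 0) (blinB _ _ bL) subrr. Qed.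

Lemma blinZ V W (L : V -> W) a v : bounded_linear L -> L (a *: v) = a *: L v.
Proof. by move=> bL; rewrite -[a *: v]addr0 bL.1 (blin0 bL) addr0. Qed.

Lemma blinD V W (L : V -> W) u v : bounded_linear L -> L (u + v) = L u + L v.
Proof. by move=> bL; rewrite -{1}[u]scale1r bL.1 scale1r. Qed.

Lemma blin_comp V W Z (K : W -> Z) (L : V -> W) :
  bounded_linear K -> bounded_linear L -> bounded_linear (K \o L).
Proof.
move=> [lK [C C0 HC]] [lL [D D0 HD]]; split.
  by move=> a u v /=; rewrite lL lK.
exists (C * D); first exact: mulr_gt0.
by move=> v /=; rewrite (le_trans (HC _))// -mulrA ler_wpM2l // ltW.
Qed.

Lemma blin_id V : bounded_linear (@id V).
Proof. by split=> //; exists 1 => // v; rewrite mul1r. Qed.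

Lemma diff_blin V W (f : V -> W) x : differentiable f x -> bounded_linear ('d f x).
Proof.
move=> df; split; first by move=> a u v; rewrite linearP.
have [k k0 kP] := linear_lipschitz (diff_continuous df).
by exists k.
Qed.

Lemma sdiff_lipschitz V W (f : V -> W) x L : bounded_linear L -> sdiff f x L ->
  exists C d, [/\ 0 < C, 0 < d & forall y y', `|y - x| < d -> `|y' - x| < d ->
    `|f y' - f y| <= C * `|y' - y|].
Proof.
move=> [_ [C C0 HC]] /(_ 1 ltr01) [d d0 dP].
exists (C + 1), d; split => //; first lra.
move=> y y' yx y'x; have := dP y y' yx y'x.
have := HC (y' - y); rewrite mulrDl mul1r => h1 h2.
rewrite -[_ - f y](subrK (L (y' - y))).
by apply: le_trans (ler_normD _ _) _; lra.
Qed.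

Lemma sdiff_eq V W (f g : V -> W) x L d : 0 < d ->
  (forall y, `|y - x| < d -> f y = g y) -> sdiff f x L -> sdiff g x L.
Proof.
move=> d0 fg sf e e0; have [d' d'0 dP] := sf e e0.
exists (Num.min d d'); first by rewrite lt_min d0.
move=> y y'; rewrite !lt_min => /andP[yd yd'] /andP[y'd y'd'].
by rewrite -!fg //; exact: dP.
Qed.

Lemma sdiff_comp V W Z (f : V -> W) (g : W -> Z) x L K :
  bounded_linear L -> bounded_linear K ->
  sdiff f x L -> sdiff g (f x) K -> sdiff (g \o f) x (K \o L).
Proof.
move=> bL bK sf sg e e0.
have [C [d1 [C0 d10 lip]]] := sdiff_lipschitz bL sf.
have [lK [D D0 HD]] := bK.
have eC : 0 < e / (2 * C) by rewrite divr_gt0 ?mulr_gt0.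
have eD : 0 < e / (2 * D) by rewrite divr_gt0 ?mulr_gt0.
have [d2 d20 sg2] := sg _ eC.
have [d3 d30 sf3] := sf _ eD.
exists (Num.min d1 (Num.min d3 (d2 / C))).
  by rewrite !lt_min d10 d30 divr_gt0.
move=> y y'; rewrite !lt_min => /and3P[y1 y3 y2] /and3P[y'1 y'3 y'2].
have x1 : `|x - x| < d1 by rewrite subrr normr0.
have fy : `|f y - f x| < d2.
  by rewrite (le_lt_trans (lip _ _ x1 y1))// mulrC -ltr_pdivlMr.
have fy' : `|f y' - f x| < d2.
  by rewrite (le_lt_trans (lip _ _ x1 y'1))// mulrC -ltr_pdivlMr.
have h1 := sg2 _ _ fy fy'.
have h2 := sf3 _ _ y3 y'3.
have h3 := lip _ _ y1 y'1.
rewrite /= -(subrK (K (f y' - f y)) (g (f y') - _)) -addrA -(blinB _ _ bK).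
apply: le_trans (ler_normD _ _) _.
have h4 : e / (2 * C) * `|f y' - f y| <= e / 2 * `|y' - y|.
  apply: le_trans (ler_wpM2l (ltW eC) h3) _.
  by rewrite mulrA ler_wpM2r// invfM mulrA divfK// gt_eqF.
have h5 : D * `|f y' - f y - L (y' - y)| <= e / 2 * `|y' - y|.
  apply: le_trans (ler_wpM2l (ltW D0) h2) _.
  by rewrite mulrA ler_wpM2r// mulrC invfM mulrA divfK// gt_eqF.
have h6 := HD (f y' - f y - L (y' - y)).
by lra.
Qed.

Lemma sdiff_blin V W (L : V -> W) x : bounded_linear L -> sdiff L x L.
Proof.
move=> bL e e0; exists 1 => // y y' _ _.
by rewrite (blinB _ _ bL) subrr normr0 mulr_ge0 // ltW.
Qed.

Lemma sdiff_unique V W (f : V -> W) x L K :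
  bounded_linear L -> bounded_linear K ->
  sdiff f x L -> sdiff f x K -> L =1 K.
Proof.
move=> bL bK sL sK v; apply/eqP; rewrite -subr_eq0 -normr_le0.
have [->|v0] := eqVneq v 0; first by rewrite (blin0 bL) (blin0 bK) subrr normr0.
have nv : 0 < `|v| by rewrite normr_gt0.
apply/ler_addgt0Pl => e e0; rewrite addr0.
have e2 : 0 < e / (2 * `|v|) by rewrite divr_gt0 // mulr_gt0.
have [d1 d10 h1] := sL _ e2; have [d2 d20 h2] := sK _ e2.
pose r := Num.min d1 d2 / (2 * `|v|).
have d12 : 0 < Num.min d1 d2 by rewrite lt_min d10.
have r0 : 0 < r by rewrite divr_gt0 // mulr_gt0.
have xr : `|x + r *: v - x| < Num.min d1 d2.
  rewrite addrC addKr normrZ gtr0_norm // /r invfM mulrA divfK ?gt_eqF//; lra.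
move: (xr); rewrite lt_min => /andP[x1 x2].
have x0 d : 0 < d -> `|x - x| < d by rewrite subrr normr0.
have := h1 _ _ (x0 _ d10) x1; have := h2 _ _ (x0 _ d20) x2.
have -> : x + r *: v - x = r *: v by rewrite addrC addKr.
set F := f _ - f x => k2 k1.
have : `|L (r *: v) - K (r *: v)| <= e * r.
  have -> : L (r *: v) - K (r *: v) = (F - K (r *: v)) - (F - L (r *: v)).
    by rewrite opprB addrCA [F - _]addrC addrK.
  apply: le_trans (ler_normB _ _) _.
  have -> : e * r = e / (2 * `|v|) * `|r *: v| + e / (2 * `|v|) * `|r *: v|.
    by rewrite normrZ gtr0_norm //; field; rewrite gt_eqF.
  exact: lerD.
by rewrite (blinZ _ _ bL) (blinZ _ _ bK) -scalerBr normrZ gtr0_norm // mulrC ler_pM2r.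
Qed.

Lemma lerpE V (a b : V) (t : R) : a + t *: (b - a) = (1 - t) *: a + t *: b.
Proof. by rewrite scalerBr scalerBl scale1r addrA addrAC. Qed.

Lemma lerp_norm V (a b : V) (t r : R) : 0 <= t <= 1 -> `|a| < r -> `|b| < r ->
  `|a + t *: (b - a)| < r.
Proof.
move=> /andP[t0 t1] ar br; rewrite lerpE.
apply: le_lt_trans (ler_normD _ _) _.
rewrite !normrZ (ger0_norm t0) ger0_norm ?subr_ge0//.
pose c := Num.max `|a| `|b|.
have cr : c < r by rewrite gt_max ar.
have ac : `|a| <= c by rewrite le_max lexx.
have bc : `|b| <= c by rewrite le_max lexx orbT.
apply: le_lt_trans cr; nra.
Qed.

Lemma lerp_ball V (x y y' : V) (t r : R) : 0 <= t <= 1 ->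
  `|y - x| < r -> `|y' - x| < r -> `|y + t *: (y' - y) - x| < r.
Proof.
move=> t01 yx y'x; rewrite addrAC.
have -> : y' - y = (y' - x) - (y - x) by rewrite opprB addrA subrK.
exact: lerp_norm.
Qed.

Lemma diff_eps V W (f : V -> W) x : differentiable f x -> forall e, 0 < e ->
  exists2 d, 0 < d & forall y, `|y - x| < d ->
    `|f y - f x - 'd f x (y - x)| <= e * `|y - x|.
Proof.
move=> df e e0.
have /eqaddoP H := diff_locally df.
have /nbhs_normP[d /= d0 dP] := H e e0; exists d => // y yx.
have := dP (y - x); rewrite /ball_/= sub0r normrN => /(_ yx).
by rewrite /= fctE /= subrK /= !fctE opprD addrA.
Qed.

(** The mean value inequality, by Cousin's argument on the segment from [y] to [y']: the error bound
    [Rel] is additive over consecutive pieces, and near each point of the segment differentiability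
    costs [e / 2] and the variation of the derivative the other [e / 2]. *)
Lemma sdiff_of_diff_near V W (f : V -> W) x r : 0 < r ->
  (forall y, `|y - x| < r -> differentiable f y) ->
  (forall e, 0 < e -> exists2 d, 0 < d & forall y v, `|y - x| < d ->
     `|'d f y v - 'd f x v| <= e * `|v|) ->
  sdiff f x ('d f x).
Proof.
move=> r0 df cont e e0.
have e2 : 0 < e / 2 by lra.
have [d d0 dP] := cont _ e2.
have bL : bounded_linear ('d f x) by apply/diff_blin/df; rewrite subrr normr0.
exists (Num.min d r); first by rewrite lt_min d0.
move=> y y' yx y'x.
have [->|yy'] := eqVneq y' y.
  by rewrite !subrr (blin0 bL) subr0 !normr0 mulr0.
set v := y' - y.
have nv : 0 < `|v| by rewrite normr_gt0 subr_eq0.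
pose p t : V := y + t *: v.
have pB s t : p t - p s = (t - s) *: v.
  by rewrite /p opprD addrACA subrr add0r scalerBl.
pose Rel s t := `|f (p t) - f (p s) - 'd f x ((t - s) *: v)| <= e * (t - s) * `|v|.
have p1 : p 1 = y' by rewrite /p scale1r /v addrC subrK.
have p0 : p 0 = y by rewrite /p scale0r addr0.
have : Rel 0 1; last by rewrite /Rel p1 p0 subr0 scale1r mulr1.
apply: (@cousin_chain R Rel 0 1) => //.
  move=> s t u _ st tu _; rewrite /Rel => h1 h2.
  have -> : f (p u) - f (p s) - 'd f x ((u - s) *: v) =
    (f (p u) - f (p t) - 'd f x ((u - t) *: v)) +
    (f (p t) - f (p s) - 'd f x ((t - s) *: v)).
    have -> : u - s = (u - t) + (t - s) by rewrite subrKA.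
    by rewrite scalerDl (blinD _ _ bL) opprD [RHS]addrACA subrKA.
  apply: le_trans (ler_normD _ _) _; lra.
move=> t t0 t1.
have : `|p t - x| < Num.min d r by apply: lerp_ball => //; rewrite t0.
rewrite lt_min => /andP[ptd ptr].
have [d' d'0 d'P] := diff_eps (df _ ptr) e2.
have bt := diff_blin (df _ ptr).
exists (d' / `|v|); first by rewrite divr_gt0.
move=> s u _ st tu _ su sd ud; rewrite /Rel.
have psd : `|p s - p t| < d'.
  by rewrite pB normrZ -ltr_pdivlMr // ler0_norm ?subr_le0//; lra.
have pud : `|p u - p t| < d'.
  by rewrite pB normrZ -ltr_pdivlMr // ger0_norm ?subr_ge0//; lra.
have us0 : 0 <= u - s by lra.
have h1 : `|'d f (p t) ((u - s) *: v) - 'd f x ((u - s) *: v)| <= e / 2 * ((u - s) * `|v|).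
  by have := dP (p t) ((u - s) *: v) ptd; rewrite [in leRHS]normrZ (ger0_norm us0).
have h2 := d'P _ pud; rewrite pB [in leRHS]normrZ (ger0_norm (_ : 0 <= u - t)) ?subr_ge0// in h2.
have h3 := d'P _ psd; rewrite pB [in leRHS]normrZ (ler0_norm (_ : s - t <= 0)) ?subr_le0// in h3.
set X := 'd f (p t) ((u - s) *: v) - 'd f x ((u - s) *: v) in h1 *.
have -> : f (p u) - f (p s) - 'd f x ((u - s) *: v) =
  (f (p u) - f (p t) - 'd f (p t) ((u - t) *: v)) -
  (f (p s) - f (p t) - 'd f (p t) ((s - t) *: v)) + X.
  have us : (u - s) *: v = (u - t) *: v - (s - t) *: v.
    by rewrite -scalerBl; congr (_ *: _); ring.
  rewrite /X us (blinB _ _ bt).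
  set A := 'd f (p t) _; set B := 'd f (p t) _.
  have -> : f (p u) - f (p s) = (f (p u) - f (p t)) - (f (p s) - f (p t)).
    by rewrite opprB subrKA.
  rewrite [RHS]addrA; congr (_ - _).
  set D := f (p u) - _; set E := f (p s) - _; move: D E A B => D E A B.
  by rewrite opprB [X in _ = X + _]addrACA [- A - E]addrC -[X in _ = X + _]addrACA
     -[A - B]opprB addrK.
apply: le_trans (ler_normD _ _) _.
have h4 := ler_normB (f (p u) - f (p t) - 'd f (p t) ((u - t) *: v))
  (f (p s) - f (p t) - 'd f (p t) ((s - t) *: v)).
nra.
Qed.

Lemma norm_nbhs V (A : set V) x d : 0 < d ->
  (forall y, `|y - x| < d -> A y) -> nbhs x A.
Proof.
move=> d0 dP; apply/(nbhs_normP x A); exists d => // y.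
by rewrite /ball_/= distrC => /dP.
Qed.

Lemma nbhs_norm_ex V (A : set V) x : nbhs x A ->
  exists2 d, 0 < d & forall y, `|y - x| < d -> A y.
Proof.
move=> /(nbhs_normP x A)[d d0 dP]; exists d => // y yx.
by apply: dP; rewrite /ball_/= distrC.
Qed.

Lemma near_continuous V W (f : V -> W) x : {for x, continuous f} ->
  forall e, 0 < e -> exists2 d, 0 < d &
    forall y, `|y - x| < d -> `|f y - f x| < e.
Proof.
move=> /cvgrPdist_lt cf e e0; have := cf e e0.
move=> /nbhs_normP[d /= d0 dP]; exists d => // y yx.
by rewrite distrC; apply: dP; rewrite /ball_/= distrC.
Qed.

Lemma continuous_norm V W (f : V -> W) x :
  (forall e, 0 < e -> exists2 d, 0 < d &
    forall y, `|y - x| < d -> `|f y - f x| < e) -> {for x, continuous f}.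
Proof.
move=> H; apply/cvgrPdist_lt => e /H[d d0 dP].
by apply: (norm_nbhs d0) => y /dP; rewrite distrC.
Qed.

Lemma open_norm V (U : set V) x : open U -> U x ->
  exists2 d, 0 < d & forall y, `|y - x| < d -> U y.
Proof.
move=> oU Ux; have /nbhs_normP[d /= d0 dP] := open_nbhs_nbhs (conj oU Ux).
by exists d => // y yx; apply: dP; rewrite /ball_/= distrC.
Qed.

Lemma C1_sdiff_R W (U : set R^o) (f : R^o -> W) (x : R^o) : open U -> U x ->
  Ck_on 1 U f -> sdiff f x ('d f x).
Proof.
move=> oU Ux [df cf].
have [r r0 rP] := open_norm oU Ux.
apply: (sdiff_of_diff_near r0) => [y /rP/df//|e e0].
have [d d0 dP] := near_continuous (cf 1 _ Ux) e0.
exists (Num.min d r); first by rewrite lt_min d0.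
move=> y v; rewrite lt_min => /andP[yd yr].
have dE z : U z -> 'd f z v = v *: 'D_1 f z.
  by move=> Uz; rewrite (deriveE _ (df _ Uz)) -linearZ /= [_ *: _]mulr1.
suff key (a b : W) : a = v *: 'D_1 f y -> b = v *: 'D_1 f x ->
    `|a - b| <= e * `|v| by exact: key (dE _ (rP _ yr)) (dE _ Ux).
move=> -> ->.
by rewrite -scalerBr normrZ mulrC ler_wpM2r// ltW// dP.
Qed.

(** [Ck_on] controls derivatives along fixed vectors only. Expanding [v] in the standard basis turns
    continuity of the partial derivatives into continuity of the differential in operator norm. *)
Lemma C1_sdiff_rV n W (U : set 'rV[R]_n) (f : 'rV[R]_n -> W) x :
  open U -> U x -> Ck_on 1 U f -> sdiff f x ('d f x).
Proof.
move=> oU Ux [df cf].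
have [r r0 rP] := open_norm oU Ux.
apply: (sdiff_of_diff_near r0) => [y /rP/df//|e e0].
(* [n.+1] keeps the denominator positive when [n = 0]; the [n] errors still sum to at most [e]. *)
have en : 0 < e / n.+1%:R by rewrite divr_gt0.
have H (k : nat) : exists2 d, 0 < d & forall (i : 'I_n) y, (i < k)%N ->
    `|y - x| < d -> `|'D_(delta_mx 0 i) f y - 'D_(delta_mx 0 i) f x| < e / n.+1%:R.
  elim: k => [|k [d d0 dP]]; first by exists 1.
  have [kn|nk] := ltnP k n; last first.
    by exists d => // i y _; apply: dP; apply: leq_trans nk.
  have [d' d'0 d'P] := near_continuous (cf (delta_mx 0 (Ordinal kn)) _ Ux) en.
  exists (Num.min d d'); first by rewrite lt_min d0.
  move=> i y; rewrite ltnS leq_eqVlt lt_min => /orP[/eqP ik|ik] /andP[yd yd'].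
    by have -> : i = Ordinal kn by [apply: val_inj]; apply: d'P.
  exact: dP.
have [d d0 dP] := H n.
exists (Num.min d r); first by rewrite lt_min d0.
move=> y v; rewrite lt_min => /andP[yd yr].
have dE z : U z -> 'd f z v = \sum_i v 0 i *: 'D_(delta_mx 0 i) f z.
  move=> Uz; rewrite [in LHS](row_sum_delta v) linear_sum; apply: eq_bigr => i _.
  by rewrite linearZ (deriveE _ (df _ Uz)).
suff key (a b : W) : a = \sum_i v 0 i *: 'D_(delta_mx 0 i) f y ->
    b = \sum_i v 0 i *: 'D_(delta_mx 0 i) f x -> `|a - b| <= e * `|v|.
  exact: key (dE _ (rP _ yr)) (dE _ Ux).
move=> -> ->; rewrite -sumrB; under eq_bigr do rewrite -scalerBr.
apply: le_trans (ler_norm_sum _ _ _) _.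
apply: (@le_trans _ _ (\sum_(i < n) (e / n.+1%:R * `|v|))).
  apply: ler_sum => i _; rewrite normrZ mulrC ler_pM//.
    by apply/ltW/dP.
  by rewrite [leRHS]/Num.norm/= mx_normrE (le_trans _ (le_bigmax _ _ (0, i))).
rewrite sumr_const card_ord.
suff aux (N : R) : 0 <= N -> (e / n.+1%:R * N) *+ n <= e * N by exact: aux.
move=> N0; rewrite -mulr_natr.
have -> : e / n.+1%:R * N * n%:R = e * N * (n%:R / n.+1%:R) by ring.
rewrite ler_piMr ?mulr_ge0 ?(ltW e0)//.
by rewrite ler_pdivrMr// mul1r ler_nat.
Qed.

End strict_differentiability.

(** Lets Banach's fixed-point theorem apply to maps of ['rV[R]_m]. *)
HB.instance Definition _ (R : realType) (m n : nat) :=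
  Uniform_isComplete.Build 'M[R]_(m, n) cauchy_cvg.

(** * Quantitative solvability for strictly differentiable maps with surjective derivative *)

Section graves.
Context {R : realType} {n m : nat}.

Lemma contraction_fixpoint (f : 'rV[R]_m -> 'rV[R]_m) (r : R) : 0 <= r ->
  (forall w, `|w| <= r -> `|f w| <= r) ->
  (forall w w', `|w| <= r -> `|w'| <= r -> `|f w - f w'| <= 2^-1 * `|w - w'|) ->
  exists2 w, `|w| <= r & f w = w.
Proof.
move=> r0 ff fc; pose U := [set w : 'rV[R]_m | `|w| <= r].
have fU : set_fun U U f by [].
have cf : is_contraction [fun of mkfun fU].
  exists (2^-1)%:nng; split => /=.
    by rewrite invf_lt1// ltr1n.
  by move=> [w w'] [/= Uw Uw']; apply: fc.
have cU : closed U.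
  apply: (@closed_comp _ _ (fun w : 'rV[R]_m => `|w|) [set x : R | x <= r]).
    by move=> w _; exact: norm_continuous.
  exact: closed_le.
have [] := banach_fixed_point cf cU.
  by exists 0; rewrite /U /= normr0.
by move=> w Uw ww; exists w.
Qed.

(* The Newton-like map [w |-> w + t - P (u + sigma w)] is a contraction. *)
Lemma strict_submersion_solve (P A : 'rV[R]_n -> 'rV[R]_m)
    (sigma : 'rV[R]_m -> 'rV[R]_n) (C e d : R) (u0 : 'rV[R]_n) :
  0 < C -> 0 <= e -> e * C <= 2^-1 ->
  (forall w w', sigma (w - w') = sigma w - sigma w') ->
  (forall w, `|sigma w| <= C * `|w|) -> (forall w, A (sigma w) = w) ->
  (forall u u', `|u - u0| < d -> `|u' - u0| < d ->
     `|P u' - P u - A (u' - u)| <= e * `|u' - u|) ->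
  forall u t, `|u - u0| + 2 * C * `|t - P u| < d ->
  exists w, [/\ P (u + sigma w) = t, `|w| <= 2 * `|t - P u|
    & `|w - (t - P u)| <= e * C * `|w|].
Proof.
move=> C0 e0 eC sB sC As sP u t ud.
pose r := 2 * `|t - P u|.
have nt : 0 <= `|t - P u| by [].
have nu : 0 <= `|u - u0| by [].
have s0 : sigma 0 = 0 by rewrite -[X in sigma X](subrr 0) sB subrr.
have ball w : `|w| <= r -> `|u + sigma w - u0| < d.
  move=> wr; rewrite addrAC; apply: le_lt_trans (ler_normD _ _) _.
  apply: le_lt_trans ud; rewrite lerD2l (le_trans (sC _))//.
  by rewrite -mulrA mulrCA ler_wpM2l// ltW.
pose f w := w + (t - P (u + sigma w)).
have fc w w' : `|w| <= r -> `|w'| <= r -> `|f w - f w'| <= e * C * `|w - w'|.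
  move=> wr w'r; have := sP _ _ (ball _ w'r) (ball _ wr).
  have -> : u + sigma w - (u + sigma w') = sigma (w - w').
    by rewrite sB opprD addrACA subrr add0r.
  rewrite As; have -> : P (u + sigma w) - P (u + sigma w') - (w - w') = - (f w - f w').
    by rewrite /f; apply/rowP => i; rewrite !mxE; ring.
  rewrite normrN => /le_trans; apply.
  by rewrite -mulrA ler_wpM2l.
have fc' w w' : `|w| <= r -> `|w'| <= r -> `|f w - f w'| <= 2^-1 * `|w - w'|.
  move=> wr w'r; apply: le_trans (fc _ _ wr w'r) _.
  by rewrite ler_wpM2r.
have r0 : `|0 : 'rV[R]_m| <= r by rewrite normr0 mulr_ge0.
have f0 : f 0 = t - P u by rewrite /f s0 add0r addr0.
have [w wr fw] : exists2 w, `|w| <= r & f w = w.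
  apply: contraction_fixpoint => //; first by rewrite mulr_ge0.
  move=> w wr; have := fc' _ _ wr r0; rewrite f0 subr0 => h.
  rewrite -(subrK (t - P u) (f w)); apply: le_trans (ler_normD _ _) _.
  by move: wr; rewrite /r => wr; lra.
have Pw : P (u + sigma w) = t.
  have : f w - w = 0 by rewrite fw subrr.
  by rewrite /f addrAC subrr add0r => /eqP; rewrite subr_eq0 => /eqP.
exists w; split => //.
(* Comparing [f w = w] with [f 0 = t - P u]: the solution is the Newton displacement up to a small
   relative error. *)
by rewrite -f0 -[X in `|X - _|]fw (le_trans (fc _ _ wr r0))// subr0.
Qed.

Lemma linear_right_inverse (A : 'rV[R]_n -> 'rV[R]_m) : bounded_linear A ->
  (forall w, exists v, A v = w) ->
  exists2 sigma, bounded_linear sigma & forall w, A (sigma w) = w.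
Proof.
move=> bA surA.
have [f fP] := choice (fun i : 'I_m => surA (delta_mx 0 i)).
pose sigma (w : 'rV[R]_m) : 'rV[R]_n := \sum_i w 0 i *: f i.
exists sigma; last first.
  move=> w; rewrite /sigma [RHS](row_sum_delta w).
  elim/big_ind2: _ => [|x1 x2 y1 y2 <- <-|i _].
  - exact: blin0.
  - by rewrite (blinD _ _ bA).
  - by rewrite (blinZ _ _ bA) fP.
split.
  move=> a u v; rewrite /sigma scaler_sumr -big_split; apply: eq_bigr => i _ /=.
  by rewrite !mxE scalerDl scalerA.
exists (1 + \sum_i `|f i|).
  by rewrite (lt_le_trans ltr01)// lerDl sumr_ge0.
move=> v; rewrite mulrDl mul1r mulr_suml.
apply: le_trans (ler_norm_sum _ _ _) _.
apply: (@le_trans _ _ (\sum_i `|f i| * `|v|)); last by rewrite lerDr.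
apply: ler_sum => i _; rewrite normrZ mulrC ler_wpM2l//.
by rewrite [leRHS]/Num.norm/= mx_normrE (le_trans _ (le_bigmax _ _ (0, i))).
Qed.

End graves.

(** * Changes of charts, timelike curves and chains of steps *)

Section charts.
Context {R : realType} {n : nat} (N : manifold R n).
Local Notation dom x := (cdom (chart_at x)).
Local Notation phi x := (cmap (chart_at x)).
Local Notation phiV x := (cinv (chart_at x)).
Local Notation cod x := (phi x @` dom x).

Lemma dom_nbhs (z p : N) : dom z p -> nbhs p (dom z).
Proof. by move=> zp; apply: open_nbhs_nbhs; split => //; exact: cdom_open. Qed.

Lemma chart_ball (z p : N) (A : set N) : dom z p -> nbhs p A ->
  exists2 d, 0 < d & forall u, `|u - phi z p| < d ->
    [/\ dom z (phiV z u), phi z (phiV z u) = u & A (phiV z u)].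
Proof.
move=> zp pA.
have codp : cod z (phi z p) by exists p.
have cp : phiV z w @[w --> phi z p] --> p.
  by have := cinv_continuous codp; rewrite /prop_for /continuous_at cmapK.
have /nbhs_normP[d1 /= d10 d1P] := cp _ pA.
have [d2 d20 d2P] := open_norm (@ccod_open _ _ _ (chart_at z)) codp.
exists (Num.min d1 d2); first by rewrite lt_min d10.
move=> u; rewrite lt_min => /andP[u1 u2].
have [q zq qu] := d2P _ u2.
rewrite -qu cmapK //; split => //.
by have := d1P u; rewrite /ball_/= distrC -qu cmapK //; apply; rewrite qu.
Qed.

Lemma chart_nbhs (z p : N) d : dom z p -> 0 < d ->
  nbhs p [set q | dom z q /\ `|phi z q - phi z p| < d].
Proof.
move=> zp d0; apply: filterI; first exact: dom_nbhs.
have /cvgrPdist_lt/(_ _ d0) := cmap_continuous zp.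
by apply: filterS => q /=; rewrite distrC.
Qed.

Lemma chart_image_open (z : N) (A : set N) : open A ->
  open (phi z @` (dom z `&` A)).
Proof.
move=> oA; rewrite openE => _ [p [zp Ap] <-].
have [d d0 dP] := chart_ball zp (open_nbhs_nbhs (conj oA Ap)).
apply: (norm_nbhs d0) => u /dP[zu eu Au].
by exists (phiV z u).
Qed.

Lemma trans_sdiff (z z' p : N) : dom z p -> dom z' p ->
  sdiff (phi z' \o phiV z) (phi z p) (change_coord p z z') /\
  bounded_linear (change_coord p z z').
Proof.
move=> zp z'p.
have oU := @chart_image_open z _ (@cdom_open _ _ _ (chart_at z')).
have Up : (phi z @` (dom z `&` dom z')) (phi z p) by exists p.
split; first exact: (C1_sdiff_rV oU Up (chart_compat z z' 1)).
by apply/diff_blin/(chart_compat z z' 1).1.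
Qed.

Lemma change_coord_id (z p : N) u : dom z p -> change_coord p z z u = u.
Proof.
move=> zp; have [s b] := trans_sdiff zp zp.
apply: (sdiff_unique b (blin_id _) s).
have [d d0 dP] := chart_ball zp (dom_nbhs zp).
by apply: (sdiff_eq d0 _ (sdiff_blin _ (blin_id _))) => y /dP[_ ey _] /=.
Qed.

Lemma change_coord_comp (x y z p : N) u : dom x p -> dom y p -> dom z p ->
  change_coord p y z (change_coord p x y u) = change_coord p x z u.
Proof.
move=> xp yp zp.
have [sxy bxy] := trans_sdiff xp yp; have [sxz bxz] := trans_sdiff xp zp.
have [syz byz] := trans_sdiff yp zp.
apply: (sdiff_unique (blin_comp byz bxy) bxz _ sxz).
have syz' : sdiff (phi z \o phiV y) ((phi y \o phiV x) (phi x p)) (change_coord p y z).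
  by rewrite /= cmapK.
have [d d0 dP] := chart_ball xp (dom_nbhs yp).
apply: (sdiff_eq d0 _ (sdiff_comp bxy byz sxy syz')) => w /dP[_ _ yw] /=.
by rewrite cmapK.
Qed.

Lemma change_coordK (x y p : N) u : dom x p -> dom y p ->
  change_coord p y x (change_coord p x y u) = u.
Proof. by move=> xp yp; rewrite change_coord_comp // change_coord_id. Qed.

(** The velocity is a strict derivative, so that it controls the increments between any two
    parameters near [t], as Cousin's argument requires. *)
Definition timelike_at (O : tangent_subsets N) (gam : R -> N) (t : R) :=
  {for t, continuous gam} /\ exists2 v, O (gam t) v &
    sdiff (phi (gam t) \o gam : R^o -> 'rV[R]_n) t (fun r : R^o => r *: v).

Lemma blin_scale (v : 'rV[R]_n) : bounded_linear (fun r : R^o => r *: v).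
Proof.
split; first by move=> a r s; rewrite scalerDl scalerA.
exists (`|v| + 1) => [|r]; first by rewrite ltr_wpDl.
by rewrite normrZ mulrC ler_wpM2r// lerDl.
Qed.

Lemma curve_near (gam : R -> N) (t : R) (A : set N) : {for t, continuous gam} ->
  nbhs (gam t) A -> exists2 d, 0 < d & forall s, `|s - t| < d -> A (gam s).
Proof.
move=> ct /ct/nbhs_normP[d /= d0 dP]; exists d => // s st.
by apply: dP; rewrite /ball_/= distrC.
Qed.

Lemma curve_chart (gam : R -> N) (t : R) (z z' : N) v :
  {for t, continuous gam} -> dom z (gam t) -> dom z' (gam t) ->
  sdiff (phi z \o gam : R^o -> 'rV[R]_n) t (fun r : R^o => r *: v) ->
  sdiff (phi z' \o gam : R^o -> 'rV[R]_n) t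
    (fun r : R^o => r *: change_coord (gam t) z z' v).
Proof.
move=> ct zt z't st.
have [s b] := trans_sdiff zt z't.
have -> : (fun r : R^o => r *: change_coord (gam t) z z' v) =
   change_coord (gam t) z z' \o (fun r : R^o => r *: v).
  by apply/funext => r /=; rewrite (blinZ _ _ b).
have [d d0 dP] := curve_near ct (dom_nbhs zt).
apply: (sdiff_eq d0 _ (sdiff_comp (blin_scale v) b st s)) => r /dP zr /=.
by rewrite cmapK.
Qed.

Lemma timelike_at_chart (O : tangent_subsets N) gam t z : timelike_at O gam t ->
  dom z (gam t) -> exists2 v, O (gam t) (vect z (gam t) v) &
    sdiff (phi z \o gam : R^o -> 'rV[R]_n) t (fun r : R^o => r *: v).
Proof.
move=> [ct [v Ov sv]] zt.
have tt := chart_at_dom (gam t).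
exists (change_coord (gam t) (gam t) z v); last exact: curve_chart.
by rewrite /vect change_coordK.
Qed.

Lemma timelike_at_of_chart (O : tangent_subsets N) gam t z v :
  {for t, continuous gam} ->
  dom z (gam t) -> O (gam t) (vect z (gam t) v) ->
  sdiff (phi z \o gam : R^o -> 'rV[R]_n) t (fun r : R^o => r *: v) ->
  timelike_at O gam t.
Proof.
move=> ct zt Ov sv; split => //; exists (vect z (gam t) v) => //.
by apply: curve_chart => //; exact: chart_at_dom.
Qed.

(** Openness of a cone field in the form that is used: one ball of directions, in fixed coordinates,
    serves over a whole coordinate ball, so a straight segment with such a direction is directed
    throughout. *)
Definition cone_box (O : tangent_subsets N) (z : N) (c V : 'rV[R]_n) (d e : R) :=
  [/\ 0 < d, 0 < e & forall u, `|u - c| < d ->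
    [/\ dom z (phiV z u), phi z (phiV z u) = u & forall W, `|W - V| < e ->
      O (phiV z u) (vect z (phiV z u) W)]].

(* A chart-straight step with direction in a convex cone around [V] that lies in
   [O] on a whole chart ball; unlike the condition that one segment be directed,
   this is open in both end points. *)
Definition lstep (O : tangent_subsets N) (x y : N) :=
  exists z c V d e s, [/\ cone_box O z c V d e, dom z x /\ dom z y,
    `|phi z x - c| < d, `|phi z y - c| < d &
    0 < s /\ `|phi z y - phi z x - s *: V| < s * e].

Definition reach (O : tangent_subsets N) : N -> N -> Prop :=
  clos_trans N (lstep O).

Lemma lstep_mono (O O' : tangent_subsets N) x y :
  (forall p, O p `<=` O' p) -> lstep O x y -> lstep O' x y.
Proof.
move=> OO' [z [c [V [d [e [s [[d0 e0 H] xy xd yd sP]]]]]]].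
exists z, c, V, d, e, s; split => //; split => // u /H[zu eu Hu]; split => //.
by move=> W WV; apply/OO'/Hu.
Qed.

Lemma reach_mono (O O' : tangent_subsets N) x y :
  (forall p, O p `<=` O' p) -> reach O x y -> reach O' x y.
Proof.
move=> OO'; elim=> [a b|a b c _ h1 _ h2]; last exact: t_trans h1 h2.
by move=> ab; apply: t_step; exact: lstep_mono ab.
Qed.

Lemma lstep_open_r O x y : lstep O x y -> nbhs y [set y' | lstep O x y'].
Proof.
move=> [z [c [V [d [e [s [B [zx zy] xd yd [s0 sP]]]]]]]].
pose r := Num.min (d - `|phi z y - c|) (s * e - `|phi z y - phi z x - s *: V|).
have r0 : 0 < r by rewrite lt_min !subr_gt0 yd.
apply: filterS (chart_nbhs zy r0) => y' /= [zy']; rewrite lt_min => /andP[h1 h2].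
exists z, c, V, d, e, s; split => //.
  by rewrite -(subrKA (phi z y)); apply: le_lt_trans (ler_normD _ _) _; lra.
split=> //; rewrite -(subrKA (phi z y) (phi z y')) -addrA.
by apply: le_lt_trans (ler_normD _ _) _; lra.
Qed.

Lemma lstep_open_l O x y : lstep O x y -> nbhs x [set x' | lstep O x' y].
Proof.
move=> [z [c [V [d [e [s [B [zx zy] xd yd [s0 sP]]]]]]]].
pose r := Num.min (d - `|phi z x - c|) (s * e - `|phi z y - phi z x - s *: V|).
have r0 : 0 < r by rewrite lt_min !subr_gt0 xd.
apply: filterS (chart_nbhs zx r0) => x' /= [zx']; rewrite lt_min => /andP[h1 h2].
exists z, c, V, d, e, s; split => //.
  by rewrite -(subrKA (phi z x)); apply: le_lt_trans (ler_normD _ _) _; lra.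
split=> //.
have -> : phi z y - phi z x' - s *: V =
   (phi z y - phi z x - s *: V) - (phi z x' - phi z x).
  by apply/rowP => i; rewrite !mxE; ring.
by apply: le_lt_trans (ler_normB _ _) _; lra.
Qed.

Lemma reach_open_r O x y : reach O x y -> nbhs y [set y' | reach O x y'].
Proof.
elim=> [a b /lstep_open_r|a b c ab _ _]; first by apply: filterS => ?; exact: t_step.
by apply: filterS => p; exact: t_trans.
Qed.

Lemma reach_open_l O x y : reach O x y -> nbhs x [set x' | reach O x' y].
Proof.
elim=> [a b /lstep_open_l|a b c _ + bc _]; first by apply: filterS => ?; exact: t_step.
by apply: filterS => p h; exact: t_trans h bc.
Qed.

(** The straight segment in the chart. It stays in the ball by convexity, and any two of its points
    are joined by a step with the same box; this yields intermediate points of a step. *)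
Lemma lstep_curve O x y : lstep O x y -> exists gam s, [/\ 0 < s, gam 0 = x,
  gam s = y, (forall a b, 0 <= a -> a < b -> b <= s -> lstep O (gam a) (gam b))
  & forall t, 0 <= t <= s -> timelike_at O gam t].
Proof.
move=> [z [c [V [d [e [s [B [zx zy] xd yd [s0 sP]]]]]]]].
have [d0 e0 H] := B.
(* The mean velocity over time [s]; the last condition of a step, divided by [s], says that it lies
   in the ball of directions. *)
pose W := s^-1 *: (phi z y - phi z x).
have WV : `|W - V| < e.
  rewrite -(ltr_pM2l s0) -[s in s * `|_|]gtr0_norm // -normrZ scalerBr /W.
  by rewrite scalerA mulfV ?gt_eqF// scale1r.
have inb t : 0 <= t <= s -> `|phi z x + t *: W - c| < d.
  move=> /andP[t0 ts]; rewrite /W scalerA; apply: lerp_ball => //.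
  by rewrite divr_ge0 ?(ltW s0)//= ler_pdivrMr // mul1r.
pose gam t := phiV z (phi z x + t *: W).
exists gam, s; split => //.
- by rewrite /gam scale0r addr0 cmapK.
- by rewrite /gam /W scalerA mulfV ?gt_eqF// scale1r addrC subrK cmapK.
- move=> a b a0 ab bs.
  have [za ea _] := H _ (inb a (introT andP (conj a0 (le_trans (ltW ab) bs)))).
  have [zb eb _] := H _ (inb b (introT andP (conj (le_trans a0 (ltW ab)) bs))).
  have ha := inb a (introT andP (conj a0 (le_trans (ltW ab) bs))).
  have hb := inb b (introT andP (conj (le_trans a0 (ltW ab)) bs)).
  exists z, c, V, d, e, (b - a); split => //; rewrite /gam ?ea ?eb //.
  have ba : 0 < b - a by rewrite subr_gt0.
  split => //; have -> : phi z x + b *: W - (phi z x + a *: W) - (b - a) *: V =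
    (b - a) *: (W - V) by apply/rowP => i; rewrite !mxE; ring.
  by rewrite normrZ gtr0_norm // ltr_pM2l.
- move=> t /inb td; have [zt et /(_ W WV) Ot] := H _ td.
  have cW : continuous (fun r : R => phi z x + r *: W).
    move=> r; apply: cvgD; first exact: cvg_cst.
    exact: scalel_continuous.
  have ct : {for t, continuous gam}.
    apply: (@continuous_comp _ _ _ (fun r : R => phi z x + r *: W)).
      exact: cW.
    by apply: cinv_continuous; exists (gam t).
  apply: (timelike_at_of_chart ct zt Ot).
  have dt : 0 < d - `|phi z x + t *: W - c| by rewrite subr_gt0.
  have [r r0 rP] := @near_continuous _ R^o _ _ _ (cW t) _ dt.
  move=> h h0; exists r => // r1 r2 /rP rt /rP r't.
  have near w : `|w - (phi z x + t *: W)| < d - `|phi z x + t *: W - c| ->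
    `|w - c| < d.
    move=> hw; rewrite -(subrKA (phi z x + t *: W)).
    by apply: le_lt_trans (ler_normD _ _) _; lra.
  have [_ er _] := H _ (near _ rt); have [_ er' _] := H _ (near _ r't).
  rewrite /= /gam er er' opprD addrACA subrr add0r -scalerBl subrr normr0.
  by rewrite mulr_ge0 // ltW.
Qed.

Lemma lstep_mid O x y (A : set N) : lstep O x y -> nbhs y A ->
  exists p, [/\ A p, lstep O x p & lstep O p y].
Proof.
move=> /lstep_curve[gam [s [s0 g0 gs st tl]]] yA.
have [cs _] := tl s (introT andP (conj (ltW s0) (lexx s))).
have [d d0 dP] : exists2 d, 0 < d & forall t, `|t - s| < d -> A (gam t).
  by apply: curve_near => //; rewrite gs.
pose t := Num.max (s / 2) (s - d / 2).
have t0 : 0 < t by rewrite lt_max divr_gt0.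
have ts : t < s by rewrite gt_max; apply/andP; split; lra.
exists (gam t); split.
- apply: dP; rewrite ltr0_norm ?subr_lt0//.
  have : s - d / 2 <= t by rewrite le_max lexx orbT.
  lra.
- by rewrite -g0; apply: st => //; apply: ltW.
- by rewrite -gs; apply: st => //; apply: ltW.
Qed.

(** Provides points arbitrarily close to [y] but before it. They serve to push an end point to the
    past and to turn chains between points of one fiber into closed ones. *)
Lemma reach_mid O x y (A : set N) : reach O x y -> nbhs y A ->
  exists p, [/\ A p, reach O x p & reach O p y].
Proof.
elim=> [a b ab bA|a b c ab _ _ IH cA].
  by have [p [Ap ap pb]] := lstep_mid ab bA; exists p; split => //; exact: t_step.
by have [p [Ap bp pc]] := IH cA; exists p; split => //; exact: t_trans bp.
Qed.

(** For [s <= t <= u] near [t] the strict derivative makes the increment of the curve nearly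
    [(u - s) *: v], hence a single step in the box at [gam t]; Cousin's argument concatenates these
    steps. *)
Lemma reach_of_curve (O : tangent_subsets N) (gam : R -> N) (a b : R) : a < b ->
  (forall t, a <= t -> t <= b -> {for t, continuous gam} /\ exists v d e,
    cone_box O (gam t) (phi (gam t) (gam t)) v d e /\
    sdiff (phi (gam t) \o gam : R^o -> 'rV[R]_n) t (fun r : R^o => r *: v)) ->
  reach O (gam a) (gam b).
Proof.
move=> ab H; apply: (@cousin_chain _ (fun s t => reach O (gam s) (gam t))) => //.
  by move=> s t u _ _ _ _; exact: t_trans.
move=> t ta tb; have [ct [v [d [e [B sv]]]]] := H t ta tb.
have tt := chart_at_dom (gam t).
have [d0 e0 _] := B.
have [d1 d10 d1P] := curve_near ct (chart_nbhs tt d0).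
have [d2 d20 d2P] := sv _ (divr_gt0 e0 (ltr0n R 2)).
exists (Num.min d1 d2); first by rewrite lt_min d10.
move=> s u _ st tu _ su; rewrite ltrBlDr -ltrBlDl lt_min => /andP[s1 s2].
rewrite -ltrBlDl lt_min => /andP[u1 u2].
have st' : `|s - t| = t - s by rewrite ler0_norm ?subr_le0// opprB.
have tu' : `|u - t| = u - t by rewrite ger0_norm ?subr_ge0.
have [zs sd] : dom (gam t) (gam s) /\ `|phi (gam t) (gam s) - phi (gam t) (gam t)| < d.
  by apply: d1P; rewrite st'.
have [zu ud] : dom (gam t) (gam u) /\ `|phi (gam t) (gam u) - phi (gam t) (gam t)| < d.
  by apply: d1P; rewrite tu'.
apply: t_step; exists (gam t), (phi (gam t) (gam t)), v, d, e, (u - s); split => //.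
have us : 0 < u - s by rewrite subr_gt0.
split=> //; have := d2P s u; rewrite st' tu' => /(_ s2 u2) /= /le_lt_trans; apply.
by rewrite gtr0_norm // mulrC ltr_pM2l//; lra.
Qed.

End charts.

(** Testing the increment bound on short multiples of [v] bounds the derivative at [y] itself.
    Strict differentiability at one point thus controls the derivatives at the neighbouring
    points. *)
Lemma sdiff_approx {R : realType} {V W : normedModType R} (f : V -> W) y L A e d :
  bounded_linear L -> bounded_linear A -> sdiff f y L -> 0 < d ->
  (forall u, `|u - y| < d -> `|f u - f y - A (u - y)| <= e * `|u - y|) ->
  forall v, `|L v - A v| <= e * `|v|.
Proof.
move=> bL bA sf d0 H v.
have [->|v0] := eqVneq v 0.
  by rewrite (blin0 bL) (blin0 bA) subr0 !normr0 mulr0.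
have nv : 0 < `|v| by rewrite normr_gt0.
apply/ler_addgt0Pl => h h0.
have [d1 d10 sf1] := sf _ (divr_gt0 h0 nv).
have dd : 0 < Num.min d d1 by rewrite lt_min d0.
have [r r0 yr] : exists2 r, 0 < r & `|y + r *: v - y| < Num.min d d1.
  exists (Num.min d d1 / (2 * `|v|)); first by rewrite divr_gt0 // mulr_gt0.
  rewrite addrC addKr normrZ gtr0_norm ?divr_gt0 ?mulr_gt0//.
  by rewrite invfM mulrA divfK ?gt_eqF//; lra.
have e1 : y + r *: v - y = r *: v by rewrite addrC addKr.
move: (yr); rewrite lt_min => /andP[y1 y2].
have := H _ y1; have := sf1 y (y + r *: v); rewrite e1 subrr normr0 => /(_ d10).
rewrite -e1 => /(_ y2); rewrite e1; set F := f _ - f y => h1 h2.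
have : `|L (r *: v) - A (r *: v)| <= (h / `|v| + e) * `|r *: v|.
  have -> : L (r *: v) - A (r *: v) = (F - A (r *: v)) - (F - L (r *: v)).
    by rewrite opprB addrCA [F - _]addrC addrK.
  by apply: le_trans (ler_normB _ _) _; rewrite mulrDl addrC lerD.
rewrite (blinZ _ _ bL) (blinZ _ _ bA) -scalerBr !normrZ gtr0_norm //.
suff aux (a N : R) : 0 < N -> r * a <= (h / N + e) * (r * N) -> a <= h + e * N.
  exact: (aux _ _ nv).
move=> N0; have -> : (h / N + e) * (r * N) = r * (h + e * N).
  by field; rewrite gt_eqF.
by rewrite ler_pM2l.
Qed.

(** * Submersions in charts *)

Section submersions.
Context {R : realType} {n m : nat} {M : manifold R n} {B : manifold R m}.
Variable pi : M -> B.
Hypothesis hpi : submersion pi.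
Local Notation dom x := (cdom (chart_at x)).
Local Notation phi x := (cmap (chart_at x)).
Local Notation phiV x := (cinv (chart_at x)).

Definition local_map (x : M) (b : B) : 'rV[R]_n -> 'rV[R]_m :=
  phi b \o pi \o phiV x.

Definition local_diff (x : M) (b : B) (p : M) (u : 'rV[R]_n) : 'rV[R]_m :=
  'd (local_map x b) (phi x p) u.

Lemma submersion_continuous : continuous pi.
Proof. exact: hpi.1.1. Qed.

Lemma pi_nbhs (p : M) A : nbhs (pi p) A -> nbhs p (pi @^-1` A).
Proof. exact: (hpi.1.1 p). Qed.

Lemma local_sdiff x b p : dom x p -> dom b (pi p) ->
  sdiff (local_map x b) (phi x p) (local_diff x b p) /\
  bounded_linear (local_diff x b p).
Proof.
move=> xp bp.
have oA : open (pi @^-1` dom b).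
  by apply: open_comp => [p1 _|]; [exact: hpi.1.1|exact: cdom_open].
have oU := @chart_image_open _ _ _ x _ oA.
have Up : (phi x @` (dom x `&` pi @^-1` dom b)) (phi x p) by exists p.
split; first exact: (C1_sdiff_rV oU Up (hpi.1.2 x b 1)).
by apply/diff_blin/(hpi.1.2 x b 1).1.
Qed.

Lemma local_diff_l x x' b p u : dom x p -> dom x' p -> dom b (pi p) ->
  local_diff x' b p (change_coord p x x' u) = local_diff x b p u.
Proof.
move=> xp x'p bp.
have [sxx bxx] := trans_sdiff xp x'p.
have [sx bx] := local_sdiff xp bp; have [sx' bx'] := local_sdiff x'p bp.
apply: (sdiff_unique (blin_comp bx' bxx) bx _ sx).
have s' : sdiff (local_map x' b) ((phi x' \o phiV x) (phi x p)) (local_diff x' b p).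
  by rewrite /= cmapK.
have [d d0 dP] := chart_ball xp (dom_nbhs x'p).
apply: (sdiff_eq d0 _ (sdiff_comp bxx bx' sxx s')) => w /dP[_ _ yw] /=.
by rewrite /local_map /= cmapK.
Qed.

Lemma local_diff_r x b b' p u : dom x p -> dom b (pi p) -> dom b' (pi p) ->
  change_coord (pi p) b b' (local_diff x b p u) = local_diff x b' p u.
Proof.
move=> xp bp b'p.
have [sbb bbb] := trans_sdiff bp b'p.
have [sb bb] := local_sdiff xp bp; have [sb' bb'] := local_sdiff xp b'p.
apply: (sdiff_unique (blin_comp bbb bb) bb' _ sb').
have s' : sdiff (phi b' \o phiV b) (local_map x b (phi x p)) (change_coord (pi p) b b').
  by rewrite /local_map /= cmapK.
have [d d0 dP] := chart_ball xp (pi_nbhs (dom_nbhs bp)).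
apply: (sdiff_eq d0 _ (sdiff_comp bb bbb sb s')) => w /dP[_ _ yw] /=.
by rewrite /local_map /= cmapK.
Qed.

Lemma differential_vect x b p u : dom x p -> dom b (pi p) ->
  differential pi (vect x p u) = vect b (pi p) (local_diff x b p u).
Proof.
move=> xp bp; have pp := chart_at_dom p; have bb := chart_at_dom (pi p).
by rewrite /vect (local_diff_r _ xp bp bb) -(local_diff_l u xp pp bb).
Qed.

Lemma differential_blin p : bounded_linear (@differential _ _ _ _ _ pi p).
Proof. exact: (local_sdiff (chart_at_dom p) (chart_at_dom (pi p))).2. Qed.

Lemma local_diff_surj x b p w : dom x p -> dom b (pi p) ->
  exists u, local_diff x b p u = w.
Proof.
move=> xp bp; have [v vP] := hpi.2 p (vect b (pi p) w).
exists (change_coord p p x v); have pp := chart_at_dom p.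
have bb := chart_at_dom (pi p).
rewrite (local_diff_l v pp xp bp) -(local_diff_r v pp bb bp).
rewrite -[LHS](_ : change_coord (pi p) (pi p) b (differential pi v) = _) //.
by rewrite vP /vect change_coordK.
Qed.

(** Estimates uniform on a coordinate ball around [x0], with one right inverse [sigma] of the
    differential at [x0]: they serve to lift points (increments of the map) as well as vectors (the
    last clause, a preimage close to [sigma w] at every point of the ball). *)
Definition local_submersion (x0 : M) (sigma : 'rV[R]_m -> 'rV[R]_n) C e d :=
  let A := local_diff x0 (pi x0) x0 in
  [/\ 0 < d, (forall u, `|u - phi x0 x0| < d -> [/\ dom x0 (phiV x0 u),
      phi x0 (phiV x0 u) = u & dom (pi x0) (pi (phiV x0 u))]),
    (forall u u', `|u - phi x0 x0| < d -> `|u' - phi x0 x0| < d ->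
     `|local_map x0 (pi x0) u' - local_map x0 (pi x0) u - A (u' - u)| <=
       e * `|u' - u|),
    (forall u v, `|u - phi x0 x0| < d ->
      `|local_diff x0 (pi x0) (phiV x0 u) v - A v| <= e * `|v|)
  & forall u w, `|u - phi x0 x0| < d -> exists v,
      local_diff x0 (pi x0) (phiV x0 u) v = w /\
      `|v - sigma w| <= 2 * C * C * e * `|w|].

(** All estimates come from strict differentiability at [x0]. At nearby points the differential
    composed with [sigma] is within [e * C] of the identity of ['rV[R]_m], so a preimage can be
    found in the range of [sigma]. *)
Lemma submersion_local (x0 : M) : exists sigma C,
  [/\ bounded_linear sigma, 0 < C, (forall w, `|sigma w| <= C * `|w|),
    (forall w, local_diff x0 (pi x0) x0 (sigma w) = w) &
    forall e, 0 < e -> e * C <= 2^-1 -> exists d, local_submersion x0 sigma C e d].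
Proof.
have xx := chart_at_dom x0; have bb := chart_at_dom (pi x0).
have [sP bP] := local_sdiff xx bb.
have [sigma bs As] := linear_right_inverse bP (fun w => local_diff_surj w xx bb).
have [_ [C C0 sC]] := bs.
exists sigma, C; split => // e e0 eC.
have [d1 d10 d1P] := chart_ball xx (pi_nbhs (dom_nbhs bb)).
have [d2 d20 d2P] := sP _ e0.
pose d := Num.min d1 d2.
have d0 : 0 < d by rewrite lt_min d10.
have Hdiff u v : `|u - phi x0 x0| < d ->
    `|local_diff x0 (pi x0) (phiV x0 u) v - local_diff x0 (pi x0) x0 v| <= e * `|v|.
  rewrite lt_min => /andP[u1 u2]; have [xu eu bu] := d1P _ u1.
  have [su bu'] := local_sdiff xu bu; rewrite eu in su.
  have r0 : 0 < d2 - `|u - phi x0 x0| by rewrite subr_gt0.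
  apply: (sdiff_approx bu' bP su r0) => w wu; apply: d2P => //.
  by rewrite -(subrKA u); apply: le_lt_trans (ler_normD _ _) _; lra.
exists d; split => //.
- by move=> u; rewrite lt_min => /andP[/d1P].
- by move=> u u'; rewrite !lt_min => /andP[_ ?] /andP[_ ?]; exact: d2P.
- move=> u w ud.
  have [xu eu bu] : [/\ dom x0 (phiV x0 u), phi x0 (phiV x0 u) = u
      & dom (pi x0) (pi (phiV x0 u))].
    by move: ud; rewrite lt_min => /andP[/d1P].
  have [su bu'] := local_sdiff xu bu.
  pose P w := local_diff x0 (pi x0) (phiV x0 u) (sigma w).
  have P0 : P 0 = 0 by rewrite /P (blin0 bs) (blin0 bu').
  have [w' [Pw' w'w w'e]] : exists w', [/\ P (0 + w') = w, `|w'| <= 2 * `|w - P 0|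
      & `|w' - (w - P 0)| <= e * C * 1 * `|w'|].
    (* The solver is used on ['rV[R]_m], with the identity as derivative and as right inverse; the
       radius only has to exceed [2 * |w|]. *)
    apply: (@strict_submersion_solve R m m P id id 1 (e * C) (2 * `|w| + 1) 0) => //.
    + by rewrite mulr_ge0 // ltW.
    + by rewrite mulr1.
    + by move=> w'; rewrite mul1r.
    + move=> w1 w2 _ _; rewrite /P -(blinB _ _ bu') -(blinB _ _ bs).
      have := Hdiff u (sigma (w2 - w1)) ud; rewrite As => /le_trans; apply.
      by rewrite -mulrA ler_wpM2l// ltW.
    + by rewrite P0 !subr0 normr0 add0r mulr1 ltrDl.
  move: Pw' w'w w'e; rewrite add0r P0 subr0 mulr1 => Pw' w'w w'e.
  exists (sigma w'); split => //.
  rewrite -(blinB _ _ bs); apply: le_trans (sC _) _.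
  have -> : 2 * C * C * e * `|w| = C * (e * C * (2 * `|w|)) by ring.
  rewrite ler_pM2l //; apply: le_trans w'e _.
  by rewrite ler_wpM2l// mulr_ge0 // ltW.
Qed.

Lemma submersion_open (x : M) (A : set M) : nbhs x A -> nbhs (pi x) (pi @` A).
Proof.
move=> xA; have [sigma [C [bs C0 sC As H]]] := submersion_local x.
have Ci : 0 < (2 * C)^-1 by rewrite invr_gt0 mulr_gt0.
have CC : (2 * C)^-1 * C = 2^-1 by field; rewrite gt_eqF.
have [|d [d0 d1P dP _ _]] := H _ Ci; first by rewrite CC.
have xx := chart_at_dom x; have bb := chart_at_dom (pi x).
have [d2 d20 d2P] := chart_ball xx xA.
pose d' := Num.min d d2.
have d'0 : 0 < d' by rewrite lt_min d0.
have r0 : 0 < d' / (2 * C) by rewrite divr_gt0 // mulr_gt0.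
apply: filterS (chart_nbhs bb r0) => c /= [bc cr].
have Px : local_map x (pi x) (phi x x) = phi (pi x) (pi x).
  by rewrite /local_map /= cmapK.
have [w [Pw wr _]] : exists w, [/\ local_map x (pi x) (phi x x + sigma w) = phi (pi x) c,
   `|w| <= 2 * `|phi (pi x) c - local_map x (pi x) (phi x x)| &
   `|w - (phi (pi x) c - local_map x (pi x) (phi x x))| <= (2 * C)^-1 * C * `|w|].
  apply: (@strict_submersion_solve _ _ _ _ (local_diff x (pi x) x) _ _ _ d (phi x x)) => //.
  - exact: ltW.
  - by rewrite CC.
  - by move=> w w'; rewrite (blinB _ _ bs).
  rewrite subrr normr0 add0r Px mulrC -ltr_pdivlMr ?mulr_gt0//.
  apply: lt_le_trans cr _; rewrite ler_pM2r ?invr_gt0 ?mulr_gt0//.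
  by rewrite ge_min lexx.
rewrite Px in wr.
have wd : `|phi x x + sigma w - phi x x| < d'.
  rewrite addrC addKr; apply: le_lt_trans (sC _) _.
  apply: (@le_lt_trans _ _ (C * (2 * `|phi (pi x) c - phi (pi x) (pi x)|))).
    by rewrite ler_pM2l.
  by rewrite mulrA mulrC [C * 2]mulrC -ltr_pdivlMr ?mulr_gt0.
move: wd; rewrite lt_min => /andP[wd wd2].
have [_ _ Aw] := d2P _ wd2; have [_ _ bw] := d1P _ wd.
exists (phiV x (phi x x + sigma w)) => //.
rewrite -(cmapK bc) -Pw /local_map /=.
by rewrite cmapK.
Qed.

End submersions.

(** * Bilinear forms in coordinates *)

Section tensors.
Context {R : realType} {n : nat} {N : manifold R n}.
Local Notation dom x := (cdom (chart_at x)).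
Local Notation phi x := (cmap (chart_at x)).
Local Notation phiV x := (cinv (chart_at x)).
Variable g : tensor2 N.
Implicit Type x : N.

Lemma ev_linl x (a : R) (u v w : 'rV[R]_n) :
  ev g (a *: u + v : tangent x) w = a * ev g (u : tangent x) w + ev g (v : tangent x) w.
Proof. by rewrite /ev !mulmxDl -!scalemxAl !mxE. Qed.

Lemma ev_linr x (a : R) (u v w : 'rV[R]_n) :
  ev g (w : tangent x) (a *: u + v) = a * ev g (w : tangent x) u + ev g (w : tangent x) v.
Proof. by rewrite /ev linearP /= mulmxDr -scalemxAr !mxE. Qed.

Lemma ev_0l x (w : 'rV[R]_n) : ev g (0 : tangent x) w = 0.
Proof. by rewrite /ev !mul0mx mxE. Qed.

Lemma ev_0r x (w : 'rV[R]_n) : ev g (w : tangent x) 0 = 0.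
Proof. by rewrite /ev linear0 mulmx0 mxE. Qed.

Lemma ev_Zl x (a : R) (u w : 'rV[R]_n) :
  ev g (a *: u : tangent x) w = a * ev g (u : tangent x) w.
Proof. by rewrite -[a *: u]addr0 ev_linl ev_0l addr0. Qed.

Lemma ev_Zr x (a : R) (u w : 'rV[R]_n) :
  ev g (w : tangent x) (a *: u) = a * ev g (w : tangent x) u.
Proof. by rewrite -[a *: u]addr0 ev_linr ev_0r addr0. Qed.

Lemma ev_Dl x (u v w : 'rV[R]_n) :
  ev g (u + v : tangent x) w = ev g (u : tangent x) w + ev g (v : tangent x) w.
Proof. by rewrite -{1}[u]scale1r ev_linl mul1r. Qed.

Lemma ev_Dr x (u v w : 'rV[R]_n) :
  ev g (w : tangent x) (u + v) = ev g (w : tangent x) u + ev g (w : tangent x) v.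
Proof. by rewrite -{1}[u]scale1r ev_linr mul1r. Qed.

Lemma ev_suml x k (c : 'I_k -> R) (u : 'I_k -> 'rV[R]_n) (w : 'rV[R]_n) :
  ev g (\sum_i c i *: u i : tangent x) w = \sum_i c i * ev g (u i : tangent x) w.
Proof.
pose h (v : 'rV[R]_n) := ev g (v : tangent x) w.
rewrite -[LHS]/(h _); elim/big_ind2: _ => [|x1 x2 y1 y2 <- <-|i _].
- by rewrite /h ev_0l.
- by rewrite /h ev_Dl.
- by rewrite /h ev_Zl.
Qed.

Lemma ev_sumr x k (c : 'I_k -> R) (u : 'I_k -> 'rV[R]_n) (w : 'rV[R]_n) :
  ev g (w : tangent x) (\sum_i c i *: u i) = \sum_i c i * ev g (w : tangent x) (u i).
Proof.
pose h (v : 'rV[R]_n) := ev g (w : tangent x) v.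
rewrite -[LHS]/(h _); elim/big_ind2: _ => [|x1 x2 y1 y2 <- <-|i _].
- by rewrite /h ev_0r.
- by rewrite /h ev_Dr.
- by rewrite /h ev_Zr.
Qed.

Lemma tensor_in_sum (z p : N) (a b : 'rV[R]_n) : dom z p ->
  tensor_in z g (phi z p) a b = \sum_i \sum_j a 0 i * b 0 j *
    tensor_in z g (phi z p) (delta_mx 0 i) (delta_mx 0 j).
Proof.
move=> zp; have [_ bl] := trans_sdiff zp (chart_at_dom p).
have vsum (c : 'rV[R]_n) : vect z p c = \sum_i c 0 i *: vect z p (delta_mx 0 i) :> 'rV[R]_n.
  rewrite {1}(row_sum_delta c) /vect; elim/big_ind2: _ => [|x1 x2 y1 y2 <- <-|i _].
  - exact: blin0.
  - by rewrite (blinD _ _ bl).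
  - by rewrite (blinZ _ _ bl).
rewrite /tensor_in cmapK // [in LHS](vsum a) ev_suml; apply: eq_bigr => i _.
by rewrite (vsum b) ev_sumr mulr_sumr; apply: eq_bigr => j _; rewrite mulrA.
Qed.

Hypothesis gsmooth : smooth_tensor2 g.

(** Smoothness of a tensor is stated for fixed vectors. Expanding both arguments in the standard
    basis gives joint continuity in the point and the vectors. *)
Lemma tensor_in_continuous (z p : N) (a0 b0 : 'rV[R]_n) e : dom z p -> 0 < e ->
  exists2 d, 0 < d & forall u a b, `|u - phi z p| < d -> `|a - a0| < d ->
    `|b - b0| < d -> `|tensor_in z g u a b - tensor_in z g (phi z p) a0 b0| < e.
Proof.
move=> zp e0.
pose t i j (u : 'rV[R]_n) := tensor_in z g u (delta_mx 0 i) (delta_mx 0 j).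
pose G (q : 'rV[R]_n * ('rV[R]_n * 'rV[R]_n)) :=
  \sum_i \sum_j q.2.1 0 i * q.2.2 0 j * t i j q.1.
have GE u a b : dom z (phiV z u) -> phi z (phiV z u) = u ->
    tensor_in z g u a b = G (u, (a, b)).
  by move=> zu eu; have := tensor_in_sum a b zu; rewrite eu.
have [d1 d10 d1P] := chart_ball zp (dom_nbhs zp).
have cG : G q @[q --> (phi z p, (a0, b0))] --> G (phi z p, (a0, b0)).
  apply: cvg_big => [|i _]; first exact: add_continuous.
  apply: cvg_big => [|j _]; first exact: add_continuous.
  apply: cvgM; last first.
    have ct : {for phi z p, continuous (t i j : _ -> R^o)}.
      by apply: (gsmooth z _ _ 0); exists p.
    by apply: cvg_comp; [exact: cvg_fst|exact: ct].
  apply: cvgM.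
    apply: (@cvg_comp _ _ _ (fun q : 'rV[R]_n * ('rV[R]_n * 'rV[R]_n) => q.2.1)
      (fun v : 'rV[R]_n => v 0 i)).
      apply: cvg_comp; [exact: cvg_snd|exact: cvg_fst].
    exact: coord_continuous.
  apply: (@cvg_comp _ _ _ (fun q : 'rV[R]_n * ('rV[R]_n * 'rV[R]_n) => q.2.2)
      (fun v : 'rV[R]_n => v 0 j)).
    apply: cvg_comp; [exact: cvg_snd|exact: cvg_snd].
  exact: coord_continuous.
move/cvgrPdist_lt : cG => /(_ _ e0) /nbhs_norm_ex[d2 d20 d2P].
exists (Num.min d1 d2); first by rewrite lt_min d10.
move=> u a b; rewrite !lt_min => /andP[u1 u2] /andP[_ a2] /andP[_ b2].
have [zu eu _] := d1P _ u1.
have e0' : phi z (phiV z (phi z p)) = phi z p by rewrite cmapK.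
have z0 : dom z (phiV z (phi z p)) by rewrite cmapK.
rewrite (GE _ _ _ zu eu) (GE _ _ _ z0 e0') distrC; apply: d2P.
rewrite /Num.norm /= !gt_max; apply/and3P; split; assumption.
Qed.

Hypothesis gsym : symmetric_tensor2 g.

Lemma ev_sym x (v w : 'rV[R]_n) : ev g (v : tangent x) w = ev g (w : tangent x) v.
Proof.
have -> : ev g (v : tangent x) w = (v *m g x *m w^T)^T ord0 ord0 by rewrite mxE.
by rewrite !trmx_mul trmxK gsym mulmxA.
Qed.

Lemma ev_quadr x (s t : R) (v w : 'rV[R]_n) :
  ev g (s *: v + t *: w : tangent x) (s *: v + t *: w) =
  s ^+ 2 * ev g (v : tangent x) v + 2 * s * t * ev g (v : tangent x) w
  + t ^+ 2 * ev g (w : tangent x) w.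
Proof.
rewrite !ev_Dl !ev_Dr !ev_Zl !ev_Zr (@ev_sym x w v); ring.
Qed.

End tensors.

Lemma lin_rV_continuous {R : realType} {n : nat} (L : 'rV[R]_n -> R) :
  (forall a u v, L (a *: u + v) = a * L u + L v) -> continuous L.
Proof.
move=> lL.
have LD u w : L (u + w) = L u + L w by rewrite -{1}[u]scale1r lL mul1r.
have L0 : L 0 = 0 by apply: (addrI (L 0)); rewrite -LD !addr0.
have LE : L = (fun v : 'rV[R]_n => \sum_i v 0 i * L (delta_mx 0 i)).
  apply/funext => u; rewrite {1}(row_sum_delta u).
  elim/big_ind2: _ => [//|x1 y1 x2 y2 <- <-|i _]; first by rewrite LD.
  by rewrite -[_ *: _]addr0 lL L0 addr0.
pose C := 1 + \sum_i `|L (delta_mx 0 i)|.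
have C0 : 0 < C by rewrite ltr_pwDl // sumr_ge0.
have LC u : `|L u| <= C * `|u|.
  rewrite LE; apply: le_trans (ler_norm_sum _ _ _) _.
  rewrite /C mulrDl mul1r mulr_suml.
  apply: (@le_trans _ _ (\sum_i `|L (delta_mx 0 i)| * `|u|)); last by rewrite lerDr.
  apply: ler_sum => i _; rewrite normrM mulrC ler_wpM2l//.
  by rewrite [leRHS]/Num.norm/= mx_normrE (le_trans _ (le_bigmax _ _ (0, i))).
move=> v; apply: (@continuous_norm _ _ R^o) => e e0.
exists (e / C) => [|u uv]; first exact: divr_gt0.
have -> : L u - L v = L (u - v).
  by rewrite LD; congr (_ + _); apply: (addrI (L v)); rewrite -LD !subrr L0.
by rewrite (le_lt_trans (LC _))// mulrC -ltr_pdivlMr.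
Qed.

(** * Causal wedges of a form of index one with kernel [D] *)

Section wedges.
Context {R : realType} {n : nat} {N : manifold R n}.
Local Notation phi x := (cmap (chart_at x)).
Local Notation phiV x := (cinv (chart_at x)).
Variables (D : tangent_subsets N) (g : tensor2 N).
Hypothesis hg : lorentzian_mod D g.
Implicit Type x : N.
Let gsym := lor_symmetric hg.

Lemma kernel_ev0 x (v w : 'rV[R]_n) : D (v : tangent x) -> ev g (v : tangent x) w = 0.
Proof. by move=> /(lor_kernel hg). Qed.

(** Two such vectors would span a negative definite plane, against index one. *)
Lemma no_negative_plane x (a b : 'rV[R]_n) : ev g (a : tangent x) a < 0 ->
  ev g (b : tangent x) b < 0 -> ev g (a : tangent x) b = 0 -> False.
Proof.
move=> ga gb gab.
have a0 : a != 0 by apply/eqP => a0; move: ga; rewrite a0 ev_0l ltxx.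
have b0 : b != 0 by apply/eqP => b0; move: gb; rewrite b0 ev_0l ltxx.
have fr : free [:: a; b].
  rewrite free_cons seq1_free b0 andbT span_seq1; apply/negP => /vlineP[k ak].
  by move: ga; rewrite {1}ak ev_Zl (ev_sym gsym) gab mulr0 ltxx.
have := (lor_index hg x).2 <<[:: a; b]>>%VS.
have -> : (\dim <<[:: a; b]>> = 2)%N by move: fr; rewrite /free => /eqP.
have nd : negative_definite_on g x <<[:: a; b]>>%VS.
  move=> v; rewrite span_cons span_seq1 => /memv_addP[_ /vlineP[s ->]].
  move=> [_ /vlineP[t ->] ->] st0; rewrite (ev_quadr gsym) gab mulr0 addr0.
  have [s0|s0] := eqVneq s 0.
    have t0 : t != 0 by apply: contra st0 => /eqP ->; rewrite s0 !scale0r addr0.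
    by rewrite s0 expr0n /= mul0r add0r nmulr_llt0 // exprn_even_gt0.
  rewrite -[X in _ < X](addr0 0); apply: ltr_leD.
    by rewrite nmulr_llt0 // exprn_even_gt0.
  by rewrite mulr_ge0_le0 ?sqr_ge0 ?ltW.
by move=> /(_ nd).
Qed.

(** A timelike [v] orthogonal to [w] would give a negative plane. A null [v] is not in the kernel,
    so it can be tilted, within the orthogonal complement of [w], into a timelike vector, and the
    same contradiction arises. *)
Lemma causal_ev_neq0 x (v w : 'rV[R]_n) : causal_vectors D g x v ->
  ev g (w : tangent x) w < 0 -> ev g (v : tangent x) w <> 0.
Proof.
move=> [nDv gv] gw gvw.
have [gv0|gv0|gv0] := ltrgtP (ev g (v : tangent x) v) 0.
- exact: no_negative_plane gv0 gw gvw.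
- by move: gv; rewrite leNgt gv0.
have [u gvu] : exists u : 'rV[R]_n, ev g (v : tangent x) u <> 0.
  apply: contrapT => /forallNP H; apply: nDv; apply/(lor_kernel hg) => u.
  by apply: contrapT; exact: (H u).
(* One Gram-Schmidt step makes [u'] orthogonal to [w]; its product with [v] does not change, [v]
   being orthogonal to [w]. *)
pose k := - (ev g (u : tangent x) w / ev g (w : tangent x) w).
have gw0 : ev g (w : tangent x) w != 0 by rewrite lt_eqF.
pose u' := u + k *: w.
have gu'w : ev g (u' : tangent x) w = 0.
  by rewrite /u' ev_Dl ev_Zl /k mulNr divfK // subrr.
have gvu' : ev g (v : tangent x) u' != 0.
  by rewrite /u' ev_Dr ev_Zr gvw mulr0 addr0; apply/eqP.
set c := ev g (v : tangent x) u' in gvu'.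
set q := ev g (u' : tangent x) u'.
(* The form takes the value [2 * t * c + t ^+ 2 * q] at [v + t *: u']; this [t] is small enough for
   the linear term to dominate whatever the sign of [q]. *)
pose t := - c / (1 + `|q|).
have q1 : 0 < 1 + `|q| by rewrite ltr_pwDl.
have vt : ev g (1 *: v + t *: u' : tangent x) (1 *: v + t *: u') < 0.
  rewrite (ev_quadr gsym) gv0 mulr0 add0r -/c -/q /t.
  have -> : 2 * 1 * (- c / (1 + `|q|)) * c + (- c / (1 + `|q|)) ^+ 2 * q =
     (c / (1 + `|q|)) ^+ 2 * (q - 2 * (1 + `|q|)).
    by field; rewrite gt_eqF.
  rewrite nmulr_llt0.
    by rewrite exprn_even_gt0 //= mulf_neq0 // invr_eq0 gt_eqF.
  have := ler_norm q; have := normr_ge0 q; lra.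
apply: no_negative_plane vt gw _.
by rewrite ev_Dl !ev_Zl gvw gu'w !mulr0 addr0.
Qed.

(** The product with [w] does not vanish on causal vectors, so its negative set is open and closed
    in the component. With the next lemma, the wedge of a timelike [w] is exactly the half of the
    causal cone where this product is negative. *)
Lemma component_ev_lt0 x (v w : 'rV[R]_n) : ev g (w : tangent x) w < 0 ->
  connected_component (causal_vectors D g x) w v -> ev g (v : tangent x) w < 0.
Proof.
move=> gw Cv; pose C := connected_component (causal_vectors D g x) w.
have cw : continuous (fun v : 'rV[R]_n => ev g (v : tangent x) w).
  by apply: lin_rV_continuous => a u u'; rewrite ev_linl.
have Dw : causal_vectors D g x w.
  by split; [move=> /kernel_ev0 H; move: gw; rewrite H ltxx|exact: ltW].
have E : C `&` [set v | ev g (v : tangent x) w < 0] = C.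
  apply: (@component_connected _ (causal_vectors D g x) w).
  - by exists w; split => //; apply: connected_component_refl.
  - exists [set v : 'rV[R]_n | ev g (v : tangent x) w < 0] => //.
    by apply: (open_comp (D := [set r : R | r < 0])) => [u _|]; [exact: cw|exact: open_lt].
  - exists [set v : 'rV[R]_n | ev g (v : tangent x) w <= 0].
      by apply: (closed_comp (D := [set r : R | r <= 0])) => [u _|]; [exact: cw|exact: closed_le].
    apply/seteqP; split => u [Cu /= gu]; split => //=; first exact: ltW.
    have Du := connected_component_sub Cu.
    by rewrite lt_neqAle gu andbT; apply/eqP; exact: causal_ev_neq0.
by have : C v by []; rewrite -E => -[].
Qed.

(** The segment from [v] to [w] consists of causal vectors: every term in the quadratic expansion is
    nonpositive, and the last one is negative except at [v]. *)
Lemma ev_lt0_component x (v w : 'rV[R]_n) : ev g (w : tangent x) w < 0 ->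
  causal_vectors D g x v -> ev g (v : tangent x) w < 0 ->
  connected_component (causal_vectors D g x) w v.
Proof.
move=> gw [nDv gv] gvw.
pose h (s : R) := (1 - s) *: v + s *: w.
have ch : continuous h.
  move=> s; apply: cvgD; apply: cvgZr_tmp; last exact: cvg_id.
  by apply: cvgB; [exact: cvg_cst|exact: cvg_id].
apply: (connected_component_max (B := h @` `[0, 1])).
- by exists 1; rewrite /= ?in_itv/= ?lexx ?ler01// /h subrr scale0r scale1r add0r.
- move=> u [s /= s01 <-]; move: s01; rewrite in_itv /= => /andP[s0 s1].
  have [->|sn0] := eqVneq s 0; first by rewrite /h subr0 scale1r scale0r addr0.
  have sp : 0 < s by rewrite lt_neqAle eq_sym sn0.
  have hneg : ev g (h s : tangent x) (h s) < 0.
    rewrite /h (ev_quadr gsym).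
    have h1 : (1 - s) ^+ 2 * ev g (v : tangent x) v <= 0.
      by rewrite mulr_ge0_le0 ?sqr_ge0.
    have h2 : 2 * (1 - s) * s * ev g (v : tangent x) w <= 0.
      by rewrite mulr_ge0_le0 ?(ltW gvw)// !mulr_ge0// subr_ge0.
    have h3 : s ^+ 2 * ev g (w : tangent x) w < 0.
      by rewrite nmulr_llt0 // exprn_even_gt0.
    lra.
  by split; [move=> /kernel_ev0 H; move: hneg; rewrite H ltxx|exact: ltW].
- apply: connected_continuous_connected; first exact: segment_connected.
  exact: continuous_subspaceT.
- by exists 0; rewrite /= ?in_itv/= ?lexx ?ler01// /h subr0 scale0r scale1r addr0.
Qed.

Variable T : tangent_subsets N.
Hypothesis hT : time_orientation D g T.

Lemma wedge_causal x (v : 'rV[R]_n) : T (v : tangent x) -> causal_vectors D g x v.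
Proof. by have [v0 _ ->] := hT.1 x; exact: connected_component_sub. Qed.

Lemma wedge_component x (v : 'rV[R]_n) : T (v : tangent x) ->
  @T x = connected_component (causal_vectors D g x) v.
Proof.
have [v0 _ ->] := hT.1 x => /same_connected_component ->//.
Qed.

Lemma wedge_nonempty x : exists v : 'rV[R]_n, T (v : tangent x).
Proof.
by have [v0 c0 ->] := hT.1 x; exists v0; exact: connected_component_refl.
Qed.

Lemma wedge_ev_lt0 x (v w : 'rV[R]_n) : T (v : tangent x) -> T (w : tangent x) ->
  ev g (w : tangent x) w < 0 -> ev g (v : tangent x) w < 0.
Proof.
by move=> Tv Tw gw; apply: component_ev_lt0 => //; rewrite -(wedge_component Tw).
Qed.

Lemma ev_lt0_wedge x (v w : 'rV[R]_n) : T (w : tangent x) ->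
  ev g (w : tangent x) w < 0 -> causal_vectors D g x v ->
  ev g (v : tangent x) w < 0 -> T (v : tangent x).
Proof.
by move=> Tw gw cv gvw; rewrite (wedge_component Tw); exact: ev_lt0_component.
Qed.

Lemma ev_lt0_wedge_r x (v w : 'rV[R]_n) : T (v : tangent x) ->
  ev g (w : tangent x) w < 0 -> ev g (v : tangent x) w < 0 -> T (w : tangent x).
Proof.
move=> Tv gw gvw; rewrite (wedge_component Tv).
by apply/connected_component_sym/ev_lt0_component => //; exact: wedge_causal.
Qed.

Definition timelike : tangent_subsets N :=
  fun x v => T v /\ ev g v v < 0.

Lemma timelike_translate x (v k : 'rV[R]_n) : D (k : tangent x) ->
  timelike (v : tangent x) -> timelike (v + k : tangent x).
Proof.
move=> Dk [Tv gv].
have gk w : ev g (k : tangent x) w = 0 by exact: kernel_ev0.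
have gk' w : ev g (w : tangent x) k = 0 by rewrite (ev_sym gsym).
have gvk : ev g (v + k : tangent x) (v + k) = ev g (v : tangent x) v.
  by rewrite ev_Dl !ev_Dr !gk gk' !addr0.
split; last by rewrite gvk.
by apply: ev_lt0_wedge_r Tv _ _; rewrite ?gvk // ev_Dr gk' addr0.
Qed.

(** The time orientation is known near [z] only through a continuous field [X] of future vectors.
    Both [g(W, W) < 0] and [g(X, W) < 0] are open conditions, and together they place [W] in the
    future wedge. *)
Lemma timelike_cone_box (z : N) (V : 'rV[R]_n) : timelike (V : tangent z) ->
  exists d e, cone_box timelike z (phi z z) V d e.
Proof.
move=> [TV gV].
have zz := chart_at_dom z.
have [U [X [oU Uz Udom cX TX]]] := hT.2 z.
have XV : ev g (X z) V < 0 by apply: wedge_ev_lt0 => //; exact: TX.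
have vzz (u : 'rV[R]_n) : vect z z u = u by rewrite /vect change_coord_id.
have tV : tensor_in z g (phi z z) V V = ev g (V : tangent z) V.
  by rewrite /tensor_in (cmapK zz) !vzz.
have Xz : vfield_in z X (phi z z) = X z.
  have XzE p : p = z -> change_coord p p z (X p) = X z.
    by move=> ->; rewrite change_coord_id.
  exact: XzE (cmapK zz).
have tXV : tensor_in z g (phi z z) (X z) V = ev g (X z) V.
  by rewrite /tensor_in (cmapK zz) !vzz.
have e1 : 0 < - ev g (V : tangent z) V by rewrite oppr_gt0.
have e2 : 0 < - ev g (X z) V by rewrite oppr_gt0.
have [d1 d10 d1P] := tensor_in_continuous (lor_smooth hg) V V zz e1.
have [d2 d20 d2P] := tensor_in_continuous (lor_smooth hg) (X z) V zz e2.
have cXz : {for phi z z, continuous (vfield_in z X)} by apply: cX; exists z.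
have [d3 d30 d3P] := near_continuous cXz d20.
have [d4 d40 d4P] := chart_ball zz (open_nbhs_nbhs (conj oU Uz)).
pose d := Num.min (Num.min d1 d2) (Num.min d3 d4).
have d0 : 0 < d by rewrite !lt_min d10 d20 d30.
exists d, d; split => // u; rewrite !lt_min => /andP[/andP[u1 u2] /andP[u3 u4]].
have [zu eu Uu] := d4P _ u4; split => // W; rewrite !lt_min => /andP[/andP[W1 W2] _].
have tW : ev g (vect z (phiV z u) W) (vect z (phiV z u) W) < 0.
  have := d1P u W W u1 W1 W1; rewrite tV ltr_norml => /andP[_].
  by rewrite {1}/tensor_in; lra.
split => //.
have Xu := d3P _ u3; rewrite Xz in Xu.
have := d2P u (vfield_in z X u) W u2 Xu W2; rewrite tXV ltr_norml => /andP[_].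
have -> : tensor_in z g u (vfield_in z X u) W =
    ev g (X (phiV z u)) (vect z (phiV z u) W).
  by rewrite /tensor_in /vfield_in /coord /vect (change_coordK _ (chart_at_dom (phiV z u)) zu).
move=> XW; apply: ev_lt0_wedge_r tW _; first exact: TX.
lra.
Qed.

End wedges.

(** Makes straight segments in one chart smooth curves as seen from all others. The induction closes
    because differentiating along [v] on the line is differentiating [f] along [v *: w]. *)
Lemma Ck_on_affine {R : realType} {V W : normedModType R} (k : nat) (U : set V)
    (f : V -> W) (J : set R^o) (p w : V) :
  (forall t, J t -> U (p + t *: w)) -> Ck_on k U f ->
  Ck_on k J (fun t : R^o => f (p + t *: w)).
Proof.
move=> JU; have aff_diff t : differentiable (fun t : R^o => p + t *: w) t.
  apply: differentiableD; first exact: differentiable_cst.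
  exact: differentiableZl.
elim: k f => [|k IH] f /=.
  move=> cf t Jt; apply: (@continuous_comp _ _ _ (fun t : R^o => p + t *: w)).
    exact/differentiable_continuous/aff_diff.
  exact/cf/JU.
move=> [df cf]; split=> [t Jt|v].
  exact: (@differentiable_comp _ _ _ _ (fun t : R^o => p + t *: w) f t
    (aff_diff t) (df _ (JU _ Jt))).
have -> : 'D_v (fun t : R^o => f (p + t *: w)) =
    (fun t : R^o => 'D_(v *: w) f (p + t *: w)).
  apply/funext => t; rewrite /derive.
  suff -> : (fun h : R => h^-1 *: (((fun t : R^o => f (p + t *: w)) \o shift t) (h *: v)
      - f (p + t *: w))) =
    (fun h => h^-1 *: ((f \o shift (p + t *: w)) (h *: (v *: w)) - f (p + t *: w))).
    by [].
  apply/funext => h /=; congr (_ *: (f _ - _)).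
  by rewrite scalerDl addrCA scalerA.
exact: (IH ('D_(v *: w) f) (cf _)).
Qed.

(** * From chains of steps to piecewise smooth causal curves *)

Section causal_curves.
Context {R : realType} {n : nat} {N : manifold R n}.
Local Notation dom x := (cdom (chart_at x)).
Local Notation phi x := (cmap (chart_at x)).
Local Notation phiV x := (cinv (chart_at x)).
Variables (O T : tangent_subsets N).
Hypothesis OT : forall p, @O p `<=` @T p.

Lemma directed_arc_eq (gam gam' : R -> N) (a b : R) :
  (forall t, t \in `[a, b] -> gam' t = gam t) ->
  directed_arc T gam a b -> directed_arc T gam' a b.
Proof.
move=> E [s [e [e0 sm gs Tv]]]; exists s, e; split => // t tab.
by rewrite E // gs.
Qed.

(** The starting parameter [a] is free so that arcs can be glued at consecutive times. *)
Lemma lstep_arc x y : lstep O x y -> exists2 s, 0 < s & forall a,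
  exists gam, [/\ directed_arc T gam a (a + s), gam a = x & gam (a + s) = y].
Proof.
move=> [z [c [V [d [e [s [B [zx zy] xd yd [s0 sP]]]]]]]].
have [d0 e0 H] := B; exists s => // a.
pose W := s^-1 *: (phi z y - phi z x).
have WV : `|W - V| < e.
  rewrite -(ltr_pM2l s0) -[s in s * `|_|]gtr0_norm // -normrZ scalerBr /W.
  by rewrite scalerA mulfV ?gt_eqF// scale1r.
pose p := phi z x - a *: W.
pose aff (t : R^o) := p + t *: W.
pose gam t := phiV z (aff t).
have affa : aff a = phi z x by rewrite /aff /p subrK.
have affs : aff (a + s) = phi z y.
  rewrite /aff /p scalerDl addrA subrK /W scalerA mulfV ?gt_eqF// scale1r.
  by rewrite addrC subrK.
have affB t u : aff u = aff t + (u - t) *: W.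
  by apply/rowP => i; rewrite !mxE; ring.
have nW : 0 < `|W| + 1 by rewrite ltr_wpDl.
(* An arc has to extend to an open interval: for a time [h] beyond either end point the line stays
   in the ball. The summand [1] covers [W = 0]. *)
pose h := Num.min (d - `|phi z x - c|) (d - `|phi z y - c|) / (`|W| + 1).
have h0 : 0 < h by rewrite divr_gt0 // lt_min !subr_gt0 xd.
have hx : h * `|W| < d - `|phi z x - c|.
  apply: (@lt_le_trans _ _ (h * (`|W| + 1))); first by rewrite ltr_pM2l // ltrDl.
  by rewrite /h divfK ?gt_eqF// ge_min lexx.
have hy : h * `|W| < d - `|phi z y - c|.
  apply: (@lt_le_trans _ _ (h * (`|W| + 1))); first by rewrite ltr_pM2l // ltrDl.
  by rewrite /h divfK ?gt_eqF// ge_min lexx orbT.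
have inb t : t \in `]a - h, a + s + h[ -> `|aff t - c| < d.
  rewrite in_itv /= => /andP[ta ts].
  have [lta|lat] := ltP t a.
    rewrite (affB a) affa addrAC; apply: le_lt_trans (ler_normD _ _) _.
    rewrite normrZ ltr0_norm ?subr_lt0//.
    have : - (t - a) * `|W| <= h * `|W| by rewrite ler_wpM2r//; lra.
    lra.
  have [lts|lst] := leP t (a + s).
    rewrite (affB a) affa /W scalerA; apply: lerp_ball => //.
    rewrite divr_ge0 ?subr_ge0 ?(ltW s0)//= ler_pdivrMr // mul1r; lra.
  rewrite (affB (a + s)) affs addrAC; apply: le_lt_trans (ler_normD _ _) _.
  rewrite normrZ gtr0_norm ?subr_gt0//.
  have : (t - (a + s)) * `|W| <= h * `|W| by rewrite ler_wpM2r//; lra.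
  lra.
have caff : continuous aff.
  by move=> t; apply: cvgD; [exact: cvg_cst|exact: scalel_continuous].
exists gam; split; last 2 first.
- by rewrite /gam affa cmapK.
- by rewrite /gam affs cmapK.
exists gam, h; split => //.
- split=> [t /inb /H[zt et _]|z' k].
    apply: (@continuous_comp _ _ _ aff); first exact: caff.
    by apply: cinv_continuous; exists (gam t).
  apply: (@Ck_on_affine _ _ _ k (phi z @` (dom z `&` dom z')) (phi z' \o phiV z) _ p W);
    last first.
    exact: (chart_compat z z' k).
  by move=> t [/inb /H[zt et _] /= z't]; exists (gam t).
- move=> t; rewrite in_itv /= => /andP[ta ts]; apply: OT.
  have tJ : t \in `]a - h, a + s + h[ by rewrite in_itv /=; apply/andP; split; lra.
  have [zt et /(_ W WV)] := H _ (inb _ tJ).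
  congr (@O _ _).
  rewrite /velocity.
  have -> : 'D_(1 : R^o) (phi (gam t) \o gam : R^o -> 'rV[R]_n) t =
      'D_W (phi (gam t) \o phiV z) (aff t).
    rewrite /derive.
    suff -> : (fun r : R => r^-1 *: (((phi (gam t) \o gam) \o shift t) (r *: (1 : R^o))
        - (phi (gam t) \o gam) t)) =
      (fun r => r^-1 *: (((phi (gam t) \o phiV z) \o shift (aff t)) (r *: W)
        - (phi (gam t) \o phiV z) (aff t))) by [].
    apply/funext => r /=; congr (_ *: (_ - _)); rewrite /gam; congr (phi _ (phiV z _)).
    by rewrite /aff scalerDl addrCA [r *: 1]mulr1.
  rewrite deriveE; last first.
    by apply: (chart_compat z (gam t) 1).1; exists (gam t) => //; split => //; exact: chart_at_dom.
  by rewrite /vect /change_coord et.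
Qed.

Lemma reach_causal_curve x y : reach O x y -> exists b gam,
  [/\ future_directed_causal_curve T 0 b gam, gam 0 = x & gam b = y].
Proof.
(* In this form of the transitive closure one step is appended at the end, so the new arc starts at
   the final time [b] of the curve already built. *)
move=> /clos_trans_tn1_iff; elim=> [y' /lstep_arc[s s0 /(_ 0)]|y' z' /lstep_arc[s s0 sP] _].
  rewrite add0r => -[gam [arc g0 gs]]; exists s, gam; split => //; split => //.
  exists 1%N, (fun i => if i is 0%N then 0 else s); split => //.
  by case.
move=> [b [gam [[b0 [k [t [t0 tk arcs]]]] g0 gb]]].
have [gam' [arc' gb' gs']] := sP b.
pose g t := if t <= b then gam t else gam' t.
have bs : b < b + s by rewrite ltrDl.
have tle : forall i, (i <= k)%N -> t i <= b.
  (* Induction downwards from the last subdivision point, the one known to be [b]. *)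
  suff H : forall j, (j <= k)%N -> t (k - j)%N <= b.
    by move=> i ik; have := H (k - i)%N; rewrite subKn //; apply; exact: leq_subr.
  elim=> [|j IH] jk; first by rewrite subn0 tk.
  have [] := arcs (k - j.+1)%N; first by rewrite ltn_subrL (leq_trans _ jk).
  rewrite -subSn // subSS => h _; apply: le_trans (ltW h) _.
  exact/IH/ltnW.
exists (b + s), g; split.
- split; first exact: lt_trans b0 bs.
  exists k.+1, (fun i => if (i <= k)%N then t i else b + s).
  rewrite leq0n ltnn; split => // i; rewrite ltnS => ik; rewrite ik.
  have [ik'|ki] := ltnP i k.
    have [ti arci] := arcs _ ik'; split => //.
    apply: directed_arc_eq arci => r; rewrite in_itv /= => /andP[_ ri].
    by rewrite /g (le_trans ri (tle _ ik')).
  have -> : i = k by apply/eqP; rewrite eqn_leq ik.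
  rewrite tk; split => //.
  apply: directed_arc_eq arc' => r; rewrite in_itv /= => /andP[br _].
  rewrite /g; case: ifP => // rb.
  have -> : r = b by apply/eqP; rewrite eq_le rb.
  by rewrite gb gb'.
- by rewrite /g (ltW b0).
- by rewrite /g leNgt bs /= gs'.
Qed.

End causal_curves.

Lemma small_factor {R : realType} (K a : R) : 0 <= K -> 0 < a ->
  exists2 e, 0 < e & e * K < a.
Proof.
move=> K0 a0; exists (a / (K + 1)); first by rewrite divr_gt0 // ltr_wpDl.
rewrite -mulrA gtr_pMr // mulrC ltr_pdivrMr ?ltr_wpDl// mul1r ltrDl//.
Qed.

(** * Lifting short steps from the base *)

Section lifting.
Context {R : realType} {n m : nat} {M : manifold R n} {B : manifold R m}.
Variable pi : M -> B.
Hypothesis hpi : submersion pi.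
Local Notation dom x := (cdom (chart_at x)).
Local Notation phi x := (cmap (chart_at x)).
Local Notation phiV x := (cinv (chart_at x)).
Variable O : tangent_subsets M.
Hypothesis Obox : forall z (V : 'rV[R]_n), @O z V ->
  exists d e, cone_box O z (phi z z) V d e.
Hypothesis Overt : forall x (v k : 'rV[R]_n),
  differential pi (k : tangent x) = 0 -> @O x v -> @O x (v + k).

Lemma local_diff_vertical x b p (u : 'rV[R]_n) : dom x p -> dom b (pi p) ->
  local_diff pi x b p u = 0 -> differential pi (vect x p u) = 0.
Proof.
move=> xp bp u0; rewrite (differential_vect hpi _ xp bp) u0 /vect.
have [_ bl] := trans_sdiff bp (chart_at_dom (pi p)); exact: blin0 bl.
Qed.

(** [O] is invariant under vertical translations, so membership depends only on the image under the
    differential of [pi]. *)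
Lemma cone_vertical x b p (u w : 'rV[R]_n) : dom x p -> dom b (pi p) ->
  local_diff pi x b p u = local_diff pi x b p w ->
  @O p (vect x p u) -> @O p (vect x p w).
Proof.
move=> xp bp uw Ou; have [_ bl] := trans_sdiff xp (chart_at_dom p).
have [_ bd] := local_sdiff hpi xp bp.
have -> : vect x p w = vect x p u + vect x p (w - u) :> 'rV[R]_n.
  by rewrite /vect (blinB _ _ bl) addrC subrK.
apply: Overt => //; apply: local_diff_vertical (bp) _ => //.
by rewrite (blinB _ _ bd) uw subrr.
Qed.

(** The solver is applied twice: from [x0] to a point over [c], and from there to a point over [c'].
    The second displacement is nearly [s *: sigma om], so the two lifts are joined by a step in the
    box around [sigma om]. *)
Lemma lift_step (x0 : M) (v0 : 'rV[R]_n) : @O x0 v0 -> exists2 r, 0 < r &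
  forall c c' s, 0 < s -> dom (pi x0) c -> dom (pi x0) c' ->
    `|phi (pi x0) c - phi (pi x0) (pi x0)| < r ->
    `|phi (pi x0) c' - phi (pi x0) (pi x0)| < r ->
    `|phi (pi x0) c' - phi (pi x0) c - s *: local_diff pi x0 (pi x0) x0 v0|
      <= s * r ->
    exists x x', [/\ pi x = c, pi x' = c' & lstep O x x'].
Proof.
move=> Ov0; have xx := chart_at_dom x0; have bb := chart_at_dom (pi x0).
set b := pi x0; set A := local_diff pi x0 b x0; set om := A v0.
have [_ bA] := local_sdiff hpi xx bb.
have [sigma [C [bs C0 sC As Hloc]]] := submersion_local hpi x0.
(* [v0] is replaced by the lift of its image in the range of [sigma], the space in which the solver
   moves points. *)
have Os : @O x0 (sigma om).
  have := @cone_vertical x0 b x0 v0 (sigma om) xx bb.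
  by rewrite As /vect !change_coord_id //; apply.
have [d0 [e0 box]] := Obox Os; have [d00 e00 boxP] := box.
(* The directional tolerance [e0] is shared equally: [e] pays for the nonlinearity of the
   submersion, [r] for the deviation of the base increment from [s *: om]. *)
have [e1 e10 e1P] : exists2 e1, 0 < e1 & e1 * (2 * C * C * (`|om| + 1)) < e0 / 2.
  by apply: small_factor; rewrite ?divr_gt0 // !mulr_ge0 ?addr_ge0 // ltW.
pose e := Num.min e1 (2 * C)^-1.
have e_gt0 : 0 < e by rewrite lt_min e10 invr_gt0 mulr_gt0.
have eC : e * C <= 2^-1.
  apply: (@le_trans _ _ ((2 * C)^-1 * C)).
    by rewrite ler_pM2r // ge_min lexx orbT.
  by rewrite invfM mulfVK ?gt_eqF.
have [d [d_gt0 dP sP _ _]] := Hloc e e_gt0 eC.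
have ee1 : e <= e1 by rewrite ge_min lexx.
(* The two lifts lie within [2 * (r * C)] and [6 * (r * C)] of the centre, so the factor [8] keeps
   both in the ball of the solver and in that of the box. *)
have [r1 r10 r1P] : exists2 r1, 0 < r1 & r1 * (8 * C) < Num.min d d0.
  by apply: small_factor; rewrite ?lt_min ?d_gt0 ?mulr_ge0// ltW.
have [r2 r20 r2P] : exists2 r2, 0 < r2 & r2 * (C + 1) < e0 / 2.
  by apply: small_factor; rewrite ?divr_gt0 // addr_ge0 // ltW.
pose r := Num.min (Num.min r1 1) r2.
have r_gt0 : 0 < r by rewrite !lt_min r10 r20 ltr01.
have rr1 : r <= r1 by rewrite /r !ge_min lexx.
have rr2 : r <= r2 by rewrite /r ge_min lexx orbT.
have rl1 : r <= 1 by rewrite /r !ge_min lexx !orbT.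
exists r => // c c' s s0 bc bc' cr c'r ccs.
have sBs w w' : sigma (w - w') = sigma w - sigma w' by exact: blinB bs.
set P := local_map pi x0 b.
have Px : P (phi x0 x0) = phi b b by rewrite /P /local_map /= cmapK.
have rC : r * (8 * C) < Num.min d d0.
  by apply: le_lt_trans r1P; rewrite ler_pM2r // mulr_gt0.
move: rC; rewrite lt_min => /andP[rCd rCd0].
have rCC : 0 < r * C by rewrite mulr_gt0.
have solve u t : `|u - phi x0 x0| + 2 * C * `|t - P u| < d ->
   exists w, [/\ P (u + sigma w) = t, `|w| <= 2 * `|t - P u| &
    `|w - (t - P u)| <= e * C * `|w|].
  exact: (@strict_submersion_solve _ _ _ P A sigma C e d (phi x0 x0) C0
    (ltW e_gt0) eC sBs sC As sP).
have inB u1 c1 : `|u1 - phi x0 x0| < d -> dom b c1 -> P u1 = phi b c1 ->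
    [/\ dom x0 (phiV x0 u1), phi x0 (phiV x0 u1) = u1 & pi (phiV x0 u1) = c1].
  move=> /dP[xu1 eu1 bu1] bc1 Pu1; split => //.
  by rewrite -(cmapK bu1) -(cmapK bc1) -Pu1.
have [|w [Pw wr _]] := solve (phi x0 x0) (phi b c).
  rewrite subrr normr0 add0r Px.
  have : 2 * C * `|phi b c - phi b b| <= 2 * C * r.
    by rewrite ler_pM2l ?mulr_gt0 // ltW.
  lra.
rewrite Px in wr; set u1 := phi x0 x0 + sigma w in Pw.
have u1r : `|u1 - phi x0 x0| <= 2 * (r * C).
  rewrite /u1 addrC addKr; apply: le_trans (sC _) _.
  have -> : 2 * (r * C) = C * (2 * r) by ring.
  by rewrite ler_pM2l //; lra.
have cc'r : `|phi b c' - phi b c| <= 2 * r.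
  have := ler_distD (phi b b) (phi b c') (phi b c).
  by rewrite (distrC (phi b b)); lra.
have [|w' [Pw' w'r w'e]] := solve u1 (phi b c').
  rewrite Pw.
  have : 2 * C * `|phi b c' - phi b c| <= 2 * C * (2 * r).
    by rewrite ler_pM2l ?mulr_gt0.
  lra.
rewrite Pw in w'r w'e; set u2 := u1 + sigma w' in Pw'.
have u2r : `|u2 - phi x0 x0| <= 6 * (r * C).
  rewrite /u2 addrAC; apply: le_trans (ler_normD _ _) _.
  have : C * `|w'| <= C * (4 * r) by rewrite ler_pM2l //; lra.
  have := sC w'; lra.
have u1d : `|u1 - phi x0 x0| < d by lra.
have u2d : `|u2 - phi x0 x0| < d by lra.
have [x1 e1' p1] := inB _ _ u1d bc Pw.
have [x2 e2' p2] := inB _ _ u2d bc' Pw'.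
exists (phiV x0 u1), (phiV x0 u2); split => //.
exists x0, (phi x0 x0), (sigma om), d0, e0, s; split => //.
- by rewrite e1'; lra.
- by rewrite e2'; lra.
split=> //; rewrite e1' e2' /u2 [u1 + _]addrC addrK.
rewrite -(blinZ _ _ bs) -(blinB _ _ bs).
apply: le_lt_trans (sC _) _.
have h1 : `|w' - s *: om| <= e * C * `|w'| + s * r.
  have -> : w' - s *: om = (w' - (phi b c' - phi b c)) +
      (phi b c' - phi b c - s *: om) by rewrite addrA subrK.
  apply: le_trans (ler_normD _ _) _; exact: lerD.
have h2 : `|phi b c' - phi b c| <= s * (`|om| + 1).
  rewrite -(subrK (s *: om) (phi b c' - phi b c)).
  apply: le_trans (ler_normD _ _) _; rewrite normrZ gtr0_norm //.
  have : s * r <= s * 1 by rewrite ler_pM2l.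
  by lra.
have h3 : e * C * `|w'| <= e * C * (2 * (s * (`|om| + 1))).
  by rewrite ler_wpM2l ?mulr_ge0 ?(ltW e_gt0) ?(ltW C0)//; lra.
apply: (@le_lt_trans _ _ (s * (e * (2 * C * C * (`|om| + 1)) + r * C))).
  have -> : s * (e * (2 * C * C * (`|om| + 1)) + r * C) =
     C * (e * C * (2 * (s * (`|om| + 1))) + s * r) by ring.
  by rewrite ler_pM2l //; lra.
rewrite ltr_pM2l //.
have h4 : e * (2 * C * C * (`|om| + 1)) <= e1 * (2 * C * C * (`|om| + 1)).
  by rewrite ler_wpM2r // !mulr_ge0 ?addr_ge0 // ltW.
have h5 : r * C <= r2 * C by rewrite ler_pM2r.
have h6 : r2 * (C + 1) = r2 * C + r2 by ring.
lra.
Qed.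

End lifting.

(** * Sliding the end of a chain along a fiber *)

(** The straight line [xt], which ends at [Y'], is corrected by [sigma (w t)] so as to lie over the
    line [ct], whose velocity is [tau *: A V0]. This drift makes an otherwise vertical motion
    future-directed; its price is that the path starts near [Y] instead of at [Y]. The correction is
    chosen separately for each [t], and what is retained of its regularity is a Lipschitz bound. *)
Lemma vertical_path {R : realType} {n m : nat} (P A : 'rV[R]_n -> 'rV[R]_m)
    (sigma : 'rV[R]_m -> 'rV[R]_n) (C e D : R) (c0 V0 : 'rV[R]_n) :
  0 < C -> 0 < e -> e * C <= 2^-1 -> 0 < D -> bounded_linear sigma ->
  (forall w, `|sigma w| <= C * `|w|) -> bounded_linear A ->
  (forall w, A (sigma w) = w) ->
  (forall u u', `|u - c0| < D -> `|u' - c0| < D ->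
     `|P u' - P u - A (u' - u)| <= e * `|u' - u|) ->
  exists2 r, 0 < r & forall Y Y', `|Y - c0| < r -> `|Y' - c0| < r -> P Y = P Y' ->
    forall dl, 0 < dl -> exists tau q L,
    [/\ 0 < tau /\ 0 < L, q 1 = Y' /\ `|q 0 - Y| < dl,
      forall t : R, 0 <= t <= 1 -> `|q t - c0| < D,
      forall s t, 0 <= s <= 1 -> 0 <= t <= 1 ->
        P (q t) - P (q s) = (t - s) *: (tau *: A V0)
    & forall s t, 0 <= s <= 1 -> 0 <= t <= 1 -> `|q t - q s| <= L * `|t - s|].
Proof.
move=> C0 e_gt0 eC D0 bs sC bA As sP.
have [_ [CA CA0 AC]] := bA.
have eC2 : 2 * (e * C) <= 1 by rewrite -ler_pdivlMl // mulr1.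
have [om omE] : exists om, A V0 = om by exists (A V0).
rewrite omE.
(* [r * Kb] bounds what the solver must fit into the ball: the distance of [xt t] from [c0] plus
   [2 * C] times the defect [ct t - P (xt t)]. *)
pose Kb := 1 + `|V0| + 2 * C * (`|om| + (CA + e) * (2 + `|V0|)).
have Kb0 : 0 <= Kb.
  by rewrite /Kb !(addr_ge0, mulr_ge0) ?(ltW C0) ?(ltW CA0) ?(ltW e_gt0).
have [r r0 rD] := small_factor Kb0 D0.
exists r => // Y Y' yr y'r PP dl dl0.
have [t0 t00 t0P] : exists2 t0, 0 < t0 & t0 * (2 * `|V0|) < dl.
  by apply: small_factor => //; rewrite mulr_ge0.
have [tau [tau0 taur taut0]] : exists tau, [/\ 0 < tau, tau <= r & tau <= t0].
  exists (Num.min t0 r); rewrite lt_min t00 r0; split => //.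
    by rewrite ge_min lexx orbT.
  by rewrite ge_min lexx.
pose X := Y' - Y + tau *: V0.
pose xt (t : R) := Y - tau *: V0 + t *: X.
pose ct (t : R) := P Y - tau *: om + t *: (tau *: om).
have xtE t : xt t = Y + t *: (Y' - Y) - (1 - t) *: (tau *: V0).
  by apply/rowP => i; rewrite !mxE; ring.
have ctE t : ct t = P Y - (1 - t) *: (tau *: om).
  by apply/rowP => i; rewrite !mxE; ring.
have tV0 : `|tau *: V0| <= r * `|V0|.
  by rewrite normrZ gtr0_norm // ler_wpM2r.
have tom : `|tau *: om| <= r * `|om|.
  by rewrite normrZ gtr0_norm // ler_wpM2r.
have sub1 (t : R) (v : 'rV[R]_n) : 0 <= t <= 1 -> `|(1 - t) *: v| <= `|v|.
  by move=> /andP[t1 t2]; rewrite normrZ ger0_norm ?subr_ge0// ler_piMl//; lra.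
have sub1m (t : R) (v : 'rV[R]_m) : 0 <= t <= 1 -> `|(1 - t) *: v| <= `|v|.
  by move=> /andP[t1 t2]; rewrite normrZ ger0_norm ?subr_ge0// ler_piMl//; lra.
have xtr t : 0 <= t <= 1 -> `|xt t - c0| <= r + r * `|V0|.
  move=> t01; rewrite xtE addrAC; apply: le_trans (ler_normB _ _) _.
  apply: lerD; last exact: le_trans (sub1 _ _ t01) _.
  exact/ltW/lerp_ball.
have hrV : r + r * `|V0| <= r * Kb.
  have : 0 <= 2 * C * (`|om| + (CA + e) * (2 + `|V0|)).
    by rewrite !(addr_ge0, mulr_ge0) ?(ltW C0) ?(ltW CA0) ?(ltW e_gt0).
  by move=> h; rewrite /Kb mulrDr [r * (1 + _)]mulrDr mulr1 lerDl mulr_ge0 // ltW //.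
have YD : `|Y - c0| < D.
  apply: lt_trans yr _; apply: (le_lt_trans _ rD); apply: (le_trans _ hrV).
  by rewrite lerDl mulr_ge0 // ltW.
have lipP u u' : `|u - c0| < D -> `|u' - c0| < D ->
    `|P u' - P u| <= (CA + e) * `|u' - u|.
  move=> uD u'D; rewrite -[_ - P u](subrK (A (u' - u))).
  apply: le_trans (ler_normD _ _) _; rewrite mulrDl addrC; apply: lerD => //.
  exact: sP.
have cPx t : 0 <= t <= 1 ->
    `|xt t - c0| + 2 * C * `|ct t - P (xt t)| < D.
  move=> t01; apply: (le_lt_trans _ rD).
  have xD : `|xt t - c0| < D.
    by apply: le_lt_trans (xtr _ t01) _; apply: (le_lt_trans _ rD).
  have h1 : `|xt t - Y| <= 2 * r + r * `|V0|.
    rewrite xtE addrAC [Y + _]addrC addrK; apply: le_trans (ler_normB _ _) _.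
    apply: lerD; last exact: le_trans (sub1 _ _ t01) _.
    have [t1 t2] := andP t01.
    rewrite normrZ ger0_norm //; apply: (@le_trans _ _ `|Y' - Y|).
      by rewrite ler_piMl.
    by have := ler_distD (c0) Y' Y; rewrite (distrC (c0)); lra.
  have h2 : `|ct t - P (xt t)| <= r * `|om| + (CA + e) * (2 * r + r * `|V0|).
    have -> : ct t - P (xt t) = (P Y - P (xt t)) - (1 - t) *: (tau *: om).
      by rewrite ctE addrAC.
    rewrite addrC; apply: le_trans (ler_normD _ _) _; apply: lerD.
      by rewrite normrN; exact: le_trans (sub1m _ _ t01) _.
    apply: le_trans (lipP _ _ xD YD) _.
    by rewrite distrC ler_wpM2l // addr_ge0 // ltW.
  have h3 := xtr _ t01.
  have h4 : 2 * C * `|ct t - P (xt t)| <=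
     2 * C * (r * `|om| + (CA + e) * (2 * r + r * `|V0|)).
    by rewrite ler_pM2l // mulr_gt0.
  have -> : r * Kb = r + r * `|V0| +
     2 * C * (r * `|om| + (CA + e) * (2 * r + r * `|V0|)) by rewrite /Kb; ring.
  exact: lerD.
have sBs w w' : sigma (w - w') = sigma w - sigma w' by exact: blinB bs.
(* The implication makes the choice total; outside the unit interval the value is arbitrary. *)
have solve t : exists w, 0 <= t <= 1 ->
    P (xt t + sigma w) = ct t /\ `|w| <= 2 * `|ct t - P (xt t)|.
  have [t01|nt] := boolP (0 <= t <= 1); last by exists 0.
  have [w [Pw wr _]] := @strict_submersion_solve _ _ _ P A sigma C e D (c0) C0
    (ltW e_gt0) eC sBs sC As sP _ _ (cPx t t01).
  by exists w.
have [w wP] := choice solve.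
pose q t := xt t + sigma (w t).
have qD t : 0 <= t <= 1 -> `|q t - c0| < D.
  move=> t01; have [_ wr] := wP t t01.
  apply: le_lt_trans (cPx t t01); rewrite /q addrAC.
  apply: le_trans (ler_normD _ _) _; rewrite lerD2l.
  apply: le_trans (sC _) _; rewrite -mulrA mulrCA ler_pM2l //.
have Pq t : 0 <= t <= 1 -> P (q t) = ct t by move=> /wP[].
have q1 : q 1 = Y'.
  have [_] : P (xt 1 + sigma (w 1)) = ct 1 /\ `|w 1| <= 2 * `|ct 1 - P (xt 1)|.
    by apply: wP; rewrite ler01 lexx.
  have x1 : xt 1 = Y' by rewrite xtE subrr scale0r subr0 scale1r addrC subrK.
  have c1 : ct 1 = P Y by rewrite ctE subrr scale0r subr0.
  rewrite c1 x1 PP subrr normr0 mulr0 normr_le0 => /eqP w1.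
  by rewrite /q w1 (blin0 bs) addr0.
have q0 : `|q 0 - Y| < dl.
  have t01 : 0 <= (0 : R) <= 1 by rewrite lexx ler01.
  have [_ wr] := wP 0 t01.
  have x0 : xt 0 = Y - tau *: V0 by rewrite /xt scale0r addr0.
  have xD : `|xt 0 - c0| < D.
    by apply: le_lt_trans (xtr _ t01) _; apply: (le_lt_trans _ rD).
  have h1 : `|ct 0 - P (xt 0)| <= e * (tau * `|V0|).
    have := sP _ _ xD YD.
    have -> : Y - xt 0 = tau *: V0 by rewrite x0 opprB addrC subrK.
    rewrite (blinZ _ _ bA) omE normrZ gtr0_norm //.
    by rewrite ctE subr0 scale1r addrAC.
  have h2 : `|sigma (w 0)| <= tau * `|V0|.
    apply: le_trans (sC _) _.
    apply: (@le_trans _ _ (C * (2 * (e * (tau * `|V0|))))).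
      by rewrite ler_pM2l //; lra.
    have -> : C * (2 * (e * (tau * `|V0|))) = (2 * (e * C)) * (tau * `|V0|) by ring.
    by apply: ler_piMl => //; rewrite mulr_ge0 // ltW.
  rewrite /q x0 addrAC [Y - _]addrC addrK addrC.
  apply: le_lt_trans (ler_normB _ _) _; rewrite [X in _ + X]normrZ (gtr0_norm tau0).
  have : tau * (2 * `|V0|) <= t0 * (2 * `|V0|) by rewrite ler_wpM2r // mulr_ge0.
  lra.
pose L := `|X| + 2 * C * (tau * `|om| + (CA + e) * `|X|) + 1.
have L0 : 0 < L.
  by rewrite ltr_wpDl // !(addr_ge0, mulr_ge0) ?(ltW C0) ?(ltW CA0) ?(ltW e_gt0) ?(ltW tau0).
have cB s t : ct t - ct s = (t - s) *: (tau *: om).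
  by rewrite /ct opprD addrACA subrr add0r -scalerBl.
have xB s t : xt t - xt s = (t - s) *: X.
  by rewrite /xt opprD addrACA subrr add0r -scalerBl.
exists tau, q, L; split => //.
  by move=> s t s01 t01; rewrite !Pq // cB.
move=> s t s01 t01.
have qB : q t - q s = (t - s) *: X + sigma (w t - w s).
  by rewrite sBs -xB /q opprD addrACA.
have nx : `|(t - s) *: X| = `|t - s| * `|X| by rewrite normrZ.
have := sP _ _ (qD s s01) (qD t t01).
rewrite !Pq // cB qB (blinD _ _ bA) As opprD addrA.
set z := w t - w s; set c := _ *: (_ *: om) => h1.
have h2 : `|(t - s) *: X + sigma z| <= `|t - s| * `|X| + C * `|z|.
  by apply: le_trans (ler_normD _ _) _; rewrite nx lerD2l.
have h3 : `|z| <= `|c| + CA * (`|t - s| * `|X|) + e * (`|t - s| * `|X| + C * `|z|).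
  have zE : z = c - A ((t - s) *: X) - (c - A ((t - s) *: X) - z).
    by rewrite opprB addrC subrK.
  rewrite [in leLHS]zE; apply: le_trans (ler_normB _ _) _; apply: lerD.
    apply: le_trans (ler_normB _ _) _; rewrite lerD2l -nx; exact: AC.
  apply: (le_trans h1); apply: ler_wpM2l; first exact: ltW.
  exact: h2.
have h4 : `|c| = `|t - s| * (tau * `|om|).
  by rewrite /c !normrZ (gtr0_norm tau0).
(* As [e * C <= 2^-1], the term of [h3] that contains [z] is absorbed on the left. *)
have h5 : `|z| <= 2 * (`|t - s| * (tau * `|om| + (CA + e) * `|X|)).
  have : e * (C * `|z|) <= 2^-1 * `|z| by rewrite mulrA ler_wpM2r.
  move: h3; rewrite h4; lra.
apply: le_trans h2 _.
have : C * `|z| <= C * (2 * (`|t - s| * (tau * `|om| + (CA + e) * `|X|))).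
  by rewrite ler_pM2l.
have -> : L * `|t - s| = `|t - s| * `|X| +
  C * (2 * (`|t - s| * (tau * `|om| + (CA + e) * `|X|))) + `|t - s| by rewrite /L; ring.
have := normr_ge0 (t - s); lra.
Qed.

Section sliding.
Context {R : realType} {n m : nat} {M : manifold R n} {B : manifold R m}.
Variable pi : M -> B.
Hypothesis hpi : submersion pi.
Local Notation dom x := (cdom (chart_at x)).
Local Notation phi x := (cmap (chart_at x)).
Local Notation phiV x := (cinv (chart_at x)).
Variable O : tangent_subsets M.
Hypothesis Obox : forall z (V : 'rV[R]_n), @O z V ->
  exists d e, cone_box O z (phi z z) V d e.
Hypothesis Overt : forall x (v k : 'rV[R]_n),
  differential pi (k : tangent x) = 0 -> @O x v -> @O x (v + k).

(** Whether a vector lies in [O] is read off from its image, uniformly on a ball. If the image of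
    [V] is close to [A V0], a small [v] makes [V0 + v] have the same image; [V0 + v] lies in the
    box, and [V] differs from it by a vertical vector. *)
Lemma slide_cone (y0 : M) (V0 : 'rV[R]_n) d0 e0 :
  cone_box O y0 (phi y0 y0) V0 d0 e0 ->
  let A := local_diff pi y0 (pi y0) y0 in
  exists sigma C e D eta,
  [/\ [/\ 0 < C, 0 < e, e * C <= 2^-1, 0 < D & 0 < eta],
    [/\ bounded_linear sigma, (forall w, `|sigma w| <= C * `|w|) &
      forall w, A (sigma w) = w],
    forall u, `|u - phi y0 y0| < D -> [/\ dom y0 (phiV y0 u),
      phi y0 (phiV y0 u) = u & dom (pi y0) (pi (phiV y0 u))],
    (forall u u', `|u - phi y0 y0| < D -> `|u' - phi y0 y0| < D ->
     `|local_map pi y0 (pi y0) u' - local_map pi y0 (pi y0) u - A (u' - u)| <=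
       e * `|u' - u|)
  & forall u V, `|u - phi y0 y0| < D ->
     `|local_diff pi y0 (pi y0) (phiV y0 u) V - A V0| <= eta ->
     @O (phiV y0 u) (vect y0 (phiV y0 u) V)].
Proof.
move=> [d00 e00 boxP] A; have [sigma [C [bs C0 sC As Hloc]]] := submersion_local hpi y0.
have [e1 e10 e1P] : exists2 e1, 0 < e1 & e1 * (2 * C * `|V0|) < e0 / 4.
  by apply: small_factor; rewrite ?divr_gt0 // !mulr_ge0 // ltW.
pose e := Num.min e1 (2 * C)^-1.
have e_gt0 : 0 < e by rewrite lt_min e10 invr_gt0 mulr_gt0.
have eC : e * C <= 2^-1.
  apply: (@le_trans _ _ ((2 * C)^-1 * C)).
    by rewrite ler_pM2r // ge_min lexx orbT.
  by rewrite invfM mulfVK ?gt_eqF.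
have eC2 : 2 * (e * C) <= 1 by rewrite -ler_pdivlMl // mulr1.
have ee1 : e <= e1 by rewrite ge_min lexx.
have [d [d_gt0 dP sP Hd Hr]] := Hloc e e_gt0 eC.
(* The correction satisfies [|v| <= 2 * C * |w|]; this tolerance contributes at most [e0 / 4] to it,
   and the choice of [e1] less than another [e0 / 4]. *)
have eta0 : 0 < e0 / (8 * C) by rewrite divr_gt0 // mulr_gt0.
exists sigma, C, e, (Num.min d d0), (e0 / (8 * C)); split => //.
- by split => //; rewrite lt_min d_gt0.
- by move=> u; rewrite lt_min => /andP[/dP].
- by move=> u u'; rewrite !lt_min => /andP[ud _] /andP[u'd _]; exact: sP.
move=> u V; rewrite lt_min => /andP[ud ud0] VV0.
have [zu eu bu] := dP _ ud.
have [_ _ boxu] := boxP _ ud0.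
have [_ bd] := local_sdiff hpi zu bu.
set L := local_diff pi y0 (pi y0) (phiV y0 u) in VV0 bd *.
have [w wE] : exists w, w = L V - L V0 by exists (L V - L V0).
have [v [vw vs]] := Hr u w ud.
have h1 : `|w| <= e0 / (8 * C) + e * `|V0|.
  have -> : w = (L V - A V0) - (L V0 - A V0) by rewrite wE opprB addrA subrK.
  apply: le_trans (ler_normB _ _) _; apply: lerD => //; exact: Hd.
have h2 : `|v| <= 2 * C * `|w|.
  rewrite -(subrK (sigma w) v); apply: le_trans (ler_normD _ _) _.
  have : 2 * C * C * e * `|w| <= C * `|w|.
    rewrite ler_wpM2r //.
    have -> : 2 * C * C * e = C * (2 * (e * C)) by ring.
    by apply: ler_piMr; [exact: ltW|exact: eC2].
  have := sC w; lra.
have h3 : `|v| < e0.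
  have : 2 * C * `|w| <= 2 * C * (e0 / (8 * C) + e * `|V0|).
    by rewrite ler_pM2l // mulr_gt0.
  have -> : 2 * C * (e0 / (8 * C) + e * `|V0|) = e0 / 4 + e * (2 * C * `|V0|).
    by field; rewrite gt_eqF.
  have : e * (2 * C * `|V0|) <= e1 * (2 * C * `|V0|).
    by rewrite ler_wpM2r // !mulr_ge0 // ltW.
  lra.
have LV : L (V0 + v) = L V.
  by move: vw bd wE; rewrite -[local_diff _ _ _ _]/L; move: (L) => L' vw bd wE;
     rewrite (blinD _ _ bd) vw wE addrC subrK.
apply: (@cone_vertical _ _ _ _ _ _ hpi O Overt y0 (pi y0) _ (V0 + v)) => //.
by apply: boxu; rewrite addrC addKr.
Qed.

Hypothesis Onon : forall x, exists v : 'rV[R]_n, @O x v.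

(** By openness [x] still reaches the start [q 0] of the drifting path, and the path leads on to
    [y']. Its chords project to positive multiples of the image of [V0], hence they point into
    [O]. *)
Lemma slide_local (y0 : M) : exists2 U, nbhs y0 U &
  forall x y y', U y -> U y' -> pi y = pi y' -> reach O x y -> reach O x y'.
Proof.
have [V0 OV0] := Onon y0.
have [d0 [e0 box]] := Obox OV0.
have [sigma [C [e [D [eta [[C0 e_gt0 eC D0 eta0] [bs sC As] DP sP cone]]]]]] :=
  slide_cone box.
have zz := chart_at_dom y0; have bb := chart_at_dom (pi y0).
have [_ bA] := local_sdiff hpi zz bb.
have [r r0 path] := vertical_path V0 C0 e_gt0 eC D0 bs sC bA As sP.
exists [set y | dom y0 y /\ `|phi y0 y - phi y0 y0| < r].
  exact: chart_nbhs.
move=> x y y' /= [zy yr] [zy' y'r] pyy' xy.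
have [dl dl0 dlP] := chart_ball zy (reach_open_r xy).
have PP : local_map pi y0 (pi y0) (phi y0 y) = local_map pi y0 (pi y0) (phi y0 y').
  by rewrite /local_map /= !cmapK // pyy'.
have [tau [q [L [[tau0 L0] [q1 q0] qD Pq qL]]]] := path _ _ yr y'r PP _ dl0.
have [_ _ xq0] := dlP _ q0.
suff : reach O (phiV y0 (q 0)) (phiV y0 (q 1)).
  by rewrite q1 cmapK // => /(t_trans _ _ _ _ _ xq0).
apply: (@cousin_chain _ (fun s t => reach O (phiV y0 (q s)) (phiV y0 (q t)))) => //.
  by move=> s t u _ _ _ _; exact: t_trans.
move=> t t0 t1; have t01 : 0 <= t <= 1 by rewrite t0.
have [zt et bt] := DP _ (qD t t01).
have [st bLt] := local_sdiff hpi zt bt; rewrite et in st.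
have [_ [Ct Ct0 LtC]] := bLt.
(* Chords divided by the drift have norm at most [L / tau], which may be large; the tolerances [e1]
   and [eps] are therefore chosen after [tau] and [L]. *)
have LT0 : 0 <= L / tau + 1 by rewrite addr_ge0 // divr_ge0 ?ltW.
have eta4 : 0 < eta / 4 by rewrite divr_gt0.
have [e1 e10 e1P] := small_factor LT0 eta4.
have [ep ep0 epP] := small_factor (ltW Ct0) eta4.
pose eps := Num.min ep 1.
have [eps0 eps1 epsC] : [/\ 0 < eps, eps <= 1 & eps * Ct <= eta / 4].
  split; first by rewrite lt_min ep0 ltr01.
    by rewrite ge_min lexx orbT.
  apply: le_trans (ltW epP); rewrite ler_pM2r // ge_min lexx //.
have [d1 d10 d1P] := st _ e10.
have d20 : 0 < D - `|q t - phi y0 y0| by rewrite subr_gt0 qD.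
have [dd [dd0 ddd1 ddD]] : exists dd, [/\ 0 < dd, dd <= d1 &
    dd <= D - `|q t - phi y0 y0|].
  exists (Num.min d1 (D - `|q t - phi y0 y0|)); rewrite lt_min d10 d20.
  by split => //; rewrite ge_min lexx ?orbT.
have nearD u : `|u - q t| < dd -> `|u - phi y0 y0| < D.
  by move=> uq; have := ler_distD (q t) u (phi y0 y0); lra.
have Ldiff u v : `|u - q t| < dd -> `|local_diff pi y0 (pi y0) (phiV y0 u) v -
    local_diff pi y0 (pi y0) (phiV y0 (q t)) v| <= e1 * `|v|.
  move=> uq; have [zu eu bu] := DP _ (nearD _ uq).
  have [su bLu] := local_sdiff hpi zu bu; rewrite eu in su.
  have r1 : 0 < d1 - `|u - q t| by rewrite subr_gt0 (lt_le_trans uq).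
  apply: (sdiff_approx bLu bLt su r1) => w wu; apply: d1P.
    exact: lt_le_trans uq _.
  by have := ler_distD u w (q t); lra.
exists (dd / L); first exact: divr_gt0.
move=> s u s0 st' tu u1 su; rewrite ltrBlDr -ltrBlDl => s2; rewrite -ltrBlDl => u2.
have s01 : 0 <= s <= 1 by rewrite s0 (le_trans st').
have u01 : 0 <= u <= 1 by rewrite u1 (le_trans t0).
have us : 0 < u - s by rewrite subr_gt0.
have sq : `|q s - q t| < dd.
  apply: le_lt_trans (qL _ _ t01 s01) _; rewrite mulrC -ltr_pdivlMr //.
  by rewrite ler0_norm ?subr_le0 // opprB.
have uq : `|q u - q t| < dd.
  apply: le_lt_trans (qL _ _ t01 u01) _; rewrite mulrC -ltr_pdivlMr //.
  by rewrite ger0_norm ?subr_ge0.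
have ts0 : 0 < tau * (u - s) by rewrite mulr_gt0.
have [V VE] : exists V, q u - q s = (tau * (u - s)) *: V.
  by exists ((tau * (u - s))^-1 *: (q u - q s)); rewrite scalerA mulfV ?gt_eqF// scale1r.
have VL : `|V| <= L / tau.
  rewrite ler_pdivlMr // -(ler_pM2l us).
  have := qL _ _ s01 u01; rewrite VE normrZ gtr0_norm // (gtr0_norm us).
  by rewrite -mulrA mulrC -mulrA [L * _]mulrC.
apply: t_step; exists y0, (q t), V, dd, eps, (tau * (u - s)).
have [zs es _] := DP _ (qD s s01); have [zu eu _] := DP _ (qD u u01).
rewrite es eu; split => //; last first.
  by split=> //; rewrite VE subrr normr0 mulr_gt0.
split=> // u' u'q; have [zu' eu' bu'] := DP _ (nearD _ u'q).
split=> // W WV; apply: cone; first exact: nearD.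
have h0 := Ldiff u' W u'q.
have nW : `|W| <= L / tau + 1.
  by rewrite -(subrK V W); apply: le_trans (ler_normD _ _) _; lra.
have h1 : `|local_diff pi y0 (pi y0) (phiV y0 (q t)) W -
    local_diff pi y0 (pi y0) (phiV y0 (q t)) V| <= eta / 4.
  rewrite -(blinB _ _ bLt); apply: le_trans (LtC _) _.
  apply: le_trans epsC; rewrite mulrC ler_pM2r //; exact: ltW.
have h2 : `|local_diff pi y0 (pi y0) y0 V0 -
    local_diff pi y0 (pi y0) (phiV y0 (q t)) V| <= e1 * (L / tau).
  have := d1P _ _ (lt_le_trans sq ddd1) (lt_le_trans uq ddd1).
  rewrite Pq // VE (blinZ _ _ bLt) scalerA [_ * tau]mulrC -scalerBr normrZ [in leRHS]normrZ.
  rewrite (gtr0_norm ts0) mulrCA ler_pM2l // => /le_trans; apply.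
  by rewrite ler_pM2l.
have h3 : e1 * `|W| <= eta / 4 by apply: le_trans (ltW e1P); rewrite ler_pM2l.
have h4 : e1 * (L / tau) <= eta / 4.
  by apply: le_trans (ltW e1P); rewrite ler_pM2l // lerDl.
move: h0 h1 h2.
move: (local_diff _ _ _ (phiV y0 u') W) (local_diff _ _ _ (phiV y0 (q t)) W)
  (local_diff _ _ _ (phiV y0 (q t)) V) (local_diff _ _ _ y0 V0) => a1 a2 a3 a4 h0 h1 h2.
have := ler_distD a2 a1 a4; have := ler_distD a3 a2 a4; rewrite (distrC a3 a4).
lra.
Qed.

End sliding.

(** Moving [b] along [w] in a chart yields other points of any neighbourhood; this is how the
    exceptional point of the base is avoided. *)
Lemma fiber_punctured {R : realType} {m : nat} {B : manifold R m} (b : B) :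
  (exists w : 'rV[R]_m, w <> 0) -> ~ nbhs b [set b].
Proof.
move=> [w /eqP w0] nb; have bb := chart_at_dom b.
have [d d0 dP] := chart_ball bb nb.
have nw : 0 < `|w| by rewrite normr_gt0.
pose u := cmap (chart_at b) b + (d / (2 * `|w|)) *: w.
have ud : `|u - cmap (chart_at b) b| < d.
  rewrite /u addrC addKr normrZ gtr0_norm ?divr_gt0 ?mulr_gt0//.
  by rewrite invfM mulrA divfK ?gt_eqF//; lra.
have [_ eu ub] := dP _ ud.
move: eu; rewrite ub /u => /eqP; rewrite -subr_eq0 opprD addrA subrr add0r oppr_eq0.
by rewrite scaler_eq0 (negbTE w0) orbF gt_eqF // divr_gt0 // mulr_gt0.
Qed.

(** * Reachability between fibers *)

Section fibers.
Context {R : realType} {n m : nat} {M : manifold R n} {B : manifold R m}.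
Variable pi : M -> B.
Hypothesis hpi : submersion pi.
Local Notation dom x := (cdom (chart_at x)).
Local Notation phi x := (cmap (chart_at x)).
Variable O : tangent_subsets M.
Hypothesis Obox : forall z (V : 'rV[R]_n), @O z V ->
  exists d e, cone_box O z (phi z z) V d e.
Hypothesis Overt : forall x (v k : 'rV[R]_n),
  differential pi (k : tangent x) = 0 -> @O x v -> @O x (v + k).
Hypothesis Onon : forall x, exists v : 'rV[R]_n, @O x v.
Hypothesis hm : exists w : 'rV[R]_m, w <> 0.
Hypothesis fib : forall b : B, exists U : set B, [/\ open U, U b
  & forall c : B, U c -> c <> b -> connected (pi @^-1` [set c])].
Hypothesis Ocausal : forall x y,
  connected_component (pi @^-1` [set pi x]) x y -> ~ reach O x y.

(** Within a component of a fiber the set of points reached from [x] is open, and closed by local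
    sliding; so it is empty or everything. *)
Lemma reach_slide x y y' : connected_component (pi @^-1` [set pi y]) y y' ->
  reach O x y -> reach O x y'.
Proof.
move=> Cy' xy; pose C := connected_component (pi @^-1` [set pi y]) y.
have yC : C y by apply: connected_component_refl.
have E : C `&` [set p | reach O x p] = C.
  apply: (@component_connected _ (pi @^-1` [set pi y]) y).
  - by exists y.
  - exists [set p | reach O x p] => //; rewrite openE => p.
    exact: reach_open_r.
  exists (closure (C `&` [set p | reach O x p])); first exact: closed_closure.
  apply/seteqP; split => p [Cp xp]; split => //.
    by apply: subset_closure.
  have [U Up UP] := slide_local hpi Obox Overt Onon p.
  have [p1 [[Cp1 xp1] Up1]] := xp _ Up.
  apply: UP xp1 => //; first exact: nbhs_singleton.
  by rewrite (connected_component_sub Cp1) (connected_component_sub Cp).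
by have : C y' by []; rewrite -E => -[].
Qed.

(* At an exceptional fiber, push [x'] slightly to the past into a connected
   fiber. *)
Lemma reach_fiber_trans x x' x'' x''' : reach O x x' -> pi x' = pi x'' ->
  reach O x'' x''' -> reach O x x'''.
Proof.
move=> xx' px xx3.
have [U [oU Ub UP]] := fib (pi x').
(* The past of [x'''] is a neighbourhood of [x''], so, [pi] being open, it meets all fibers near the
   common fiber of [x'] and [x'']. *)
have n1 := submersion_open hpi (reach_open_l xx3).
have n2 : nbhs (pi x') (U `&` (pi @` [set p | reach O p x'''])).
  by apply: filterI; [exact: open_nbhs_nbhs|rewrite px].
have n3 := nbhs_interior (pi_nbhs hpi n2).
have [p [Np xp _]] := reach_mid xx' n3.
have n4 : nbhs p ((pi @^-1` (U `&` (pi @` [set p | reach O p x''']))) `&`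
    [set p | reach O x p]) by apply: filterI => //; exact: reach_open_r.
have [p1 [[Up1 [p2 p2x p21]] xp1] p1x] : exists2 p1, ((pi @^-1` (U `&`
    (pi @` [set p | reach O p x''']))) `&` [set p | reach O x p]) p1 & pi p1 <> pi x'.
  apply: contrapT => H; have n5 := submersion_open hpi n4.
  have H1 q : ((pi @^-1` (U `&` (pi @` [set p | reach O p x''']))) `&`
      [set p | reach O x p]) q -> pi q = pi x'.
    by move=> Nq; apply: contrapT => qx; apply: H; exists q.
  apply: (@fiber_punctured _ _ _ (pi p) hm); apply: filterS n5 => _ [q Nq <-] /=.
  by rewrite (H1 q Nq) (H1 p (nbhs_singleton n4)).
(* The fiber of [p1] is connected and contains [p2], so the chain slides from one to the other. *)
have xp2 : reach O x p2.
  apply: reach_slide xp1; rewrite connected_component_id //=.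
  exact: UP.
exact: t_trans xp2 p2x.
Qed.

(** With a point [p] between [x] and [y], the chains from [p] to [y] and from [x] to [p] join across
    the fiber to one from [p] to itself, where causality along a leaf applies. *)
Lemma reach_fiber_irr x y : pi x = pi y -> ~ reach O x y.
Proof.
move=> pxy xy; have [p [_ xp py]] := reach_mid xy (filterT : nbhs y setT).
have pp := reach_fiber_trans py (esym pxy) xp.
by apply: Ocausal pp; apply: connected_component_refl.
Qed.

Definition base_reach (c c' : B) :=
  exists x x', [/\ pi x = c, pi x' = c' & reach O x x'].

Lemma base_reach_trans c c' c'' :
  base_reach c c' -> base_reach c' c'' -> base_reach c c''.
Proof.
move=> [x [x' [px px' xx']]] [y [y' [py py' yy']]]; exists x, y'; split => //.
by apply: reach_fiber_trans xx' _ yy'; rewrite px' py.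
Qed.

Lemma base_reach_irr c : ~ base_reach c c.
Proof. by move=> [x [x' [px px']]]; apply: reach_fiber_irr; rewrite px px'. Qed.

(** Pieces of a curve in the base are lifted separately. Consecutive lifts meet only in the same
    fiber, which is all that transitivity of [base_reach] asks for. *)
Lemma reach_base_reach (Q : tangent_subsets B) c c' :
  (forall b (w : 'rV[R]_m), @Q b w -> exists x (v : 'rV[R]_n),
     [/\ pi x = b, @O x v & differential pi (v : tangent x) = w :> 'rV[R]_m]) ->
  reach Q c c' -> base_reach c c'.
Proof.
move=> QO; elim=> [a b|a b d _ h1 _ h2]; last exact: base_reach_trans h1 h2.
move=> /lstep_curve[gam [s [s0 <- <- _ tl]]].
apply: (@cousin_chain _ (fun a b => base_reach (gam a) (gam b))) => //.
  by move=> u v w _ _ _ _; exact: base_reach_trans.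
move=> t t0 ts; have [ct [w Qw sw]] := tl t (introT andP (conj t0 ts)).
have [x0 [v0 [px0 Ov0 dv0]]] := QO _ _ Qw.
have [r r0 rP] := lift_step hpi Obox Overt Ov0.
rewrite px0 in rP.
have dE : local_diff pi x0 (gam t) x0 v0 = w by rewrite -px0 -dv0.
rewrite dE in rP.
have [d1 d10 d1P] := curve_near ct (chart_nbhs (chart_at_dom (gam t)) r0).
have [d2 d20 d2P] := sw _ r0.
exists (Num.min d1 d2); first by rewrite lt_min d10.
move=> u v _ ut tv _ uv; rewrite ltrBlDr -ltrBlDl lt_min => /andP[u1 u2].
rewrite -ltrBlDl lt_min => /andP[v1 v2].
have ut' : `|u - t| = t - u by rewrite ler0_norm ?subr_le0// opprB.
have tv' : `|v - t| = v - t by rewrite ger0_norm ?subr_ge0.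
have [zu ud] : dom (gam t) (gam u) /\ `|phi (gam t) (gam u) - phi (gam t) (gam t)| < r.
  by apply: d1P; rewrite ut'.
have [zv vd] : dom (gam t) (gam v) /\ `|phi (gam t) (gam v) - phi (gam t) (gam t)| < r.
  by apply: d1P; rewrite tv'.
have uv0 : 0 < v - u by rewrite subr_gt0.
have := d2P u v; rewrite ut' tv' => /(_ u2 v2) /=.
rewrite (gtr0_norm uv0) mulrC => dd.
have [x [x' [px px' xx']]] := rP _ _ _ uv0 zu zv ud vd dd.
by exists x, x'; split => //; exact: t_step.
Qed.

End fibers.

(** * Moving the ends of chains in nested cone fields *)

Section perturbation.
Context {R : realType} {m : nat} {B : manifold R m}.
Local Notation dom x := (cdom (chart_at x)).
Local Notation phi x := (cmap (chart_at x)).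
Local Notation phiV x := (cinv (chart_at x)).

Lemma chart_ball_compact (x : B) d r :
  (forall u, `|u - phi x x| < d -> dom x (phiV x u) /\ phi x (phiV x u) = u) ->
  r < d -> compact [set p | dom x p /\ `|phi x p - phi x x| <= r].
Proof.
move=> H rd.
have -> : [set p | dom x p /\ `|phi x p - phi x x| <= r] =
    phiV x @` [set u | `|u - phi x x| <= r].
  apply/seteqP; split=> [p [xp pr]|_ [u /= ur <-]].
    by exists (phi x p) => //; rewrite cmapK.
  by have [zu eu] := H _ (le_lt_trans ur rd); rewrite /= eu.
apply: continuous_compact.
  apply: continuous_in_subspaceT => u; rewrite inE /= => ur.
  have [zu eu] := H _ (le_lt_trans ur rd).
  by apply: cinv_continuous; exists (phiV x u).
apply: bounded_closed_compact.
  exists (r + `|phi x x|); split; first exact: num_real.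
  move=> c cr u /= ur; apply: le_trans (ltW cr).
  by rewrite -(subrK (phi x x) u); apply: le_trans (ler_normD _ _) _; lra.
apply: (@closed_comp _ _ (fun u : 'rV[R]_m => `|u - phi x x|) [set y : R | y <= r]).
  move=> u _; apply: (@continuous_norm _ _ R^o) => e e0; exists e => // y yu.
  apply: le_lt_trans (ler_dist_dist _ _) _.
  by rewrite opprB addrA subrK.
exact: closed_le.
Qed.

Lemma chart_ball_closed (x : B) d r :
  (forall u, `|u - phi x x| < d -> dom x (phiV x u) /\ phi x (phiV x u) = u) ->
  r < d -> closed [set p | dom x p /\ `|phi x p - phi x x| <= r].
Proof.
move=> H rd; apply: compact_closed; first exact: manifold_hausdorff.
exact: chart_ball_compact H rd.
Qed.

Variable Q : R -> tangent_subsets B.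
(** Locally uniform nesting. The error is relative to the length of [w], as befits cones. *)
Hypothesis Qnest : forall b l l', 0 < l -> l < l' -> l' < 1 ->
  exists d e, [/\ 0 < d, 0 < e & forall u u' w w', `|u - phi b b| < d ->
    `|u' - phi b b| < d -> Q l (vect b (phiV b u) w) -> `|w' - w| <= e * `|w| ->
    Q l' (vect b (phiV b u') w')].
Hypothesis Q0 : forall l b (w : 'rV[R]_m), Q l (w : tangent b) -> w != 0.

Lemma cone_nested (x : B) l l' : 0 < l -> l < l' -> l' < 1 ->
  exists d e, [/\ 0 < d, 0 < e, e <= 1,
    forall u, `|u - phi x x| < d -> dom x (phiV x u) /\ phi x (phiV x u) = u &
    forall u u' w w', `|u - phi x x| < d ->
    `|u' - phi x x| < d -> Q l (vect x (phiV x u) w) -> `|w' - w| <= e * `|w| ->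
    Q l' (vect x (phiV x u') w')].
Proof.
move=> l0 ll' l'1; have [d [e [d0 e0 H]]] := Qnest x l0 ll' l'1.
have [d1 d10 d1P] := chart_ball (chart_at_dom x) (dom_nbhs (chart_at_dom x)).
exists (Num.min d d1), (Num.min e 1); split.
- by rewrite lt_min d0.
- by rewrite lt_min e0 ltr01.
- by rewrite ge_min lexx orbT.
- by move=> u; rewrite lt_min => /andP[_ /d1P[]].
move=> u u' w w'; rewrite !lt_min => /andP[ud _] /andP[u'd _] Qu ww'.
apply: H Qu _ => //; apply: le_trans ww' _.
by rewrite ler_wpM2r // ge_min lexx.
Qed.

Lemma cone_mono l l' b : 0 < l -> l < l' -> l' < 1 -> @Q l b `<=` @Q l' b.
Proof.
move=> l0 ll' l'1 w Qw; have [d [e [d0 e0 _ dP H]]] := cone_nested b l0 ll' l'1.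
have bb := chart_at_dom b.
have b0 : `|phi b b - phi b b| < d by rewrite subrr normr0.
have := H _ _ w w b0 b0; rewrite cmapK // /vect change_coord_id //; apply => //.
by rewrite subrr normr0 mulr_ge0 // ltW.
Qed.

Lemma reach_cone_mono l l' a b : 0 < l -> l <= l' -> l' < 1 ->
  reach (Q l) a b -> reach (Q l') a b.
Proof.
move=> l0; rewrite le_eqVlt => /orP[/eqP ->//|ll'] l'1; apply: reach_mono => p.
exact: cone_mono.
Qed.

(** Interior comes from the nesting: a vector of [Q l] has a whole box around it in the next field
    [Q l']. *)
Lemma cone_box_of_nested l l' (x : B) (w : 'rV[R]_m) : 0 < l -> l < l' -> l' < 1 ->
  Q l (w : tangent x) -> exists d e, cone_box (Q l') x (phi x x) w d e.
Proof.
move=> l0 ll' l'1 Qw; have [d [e [d0 e0 _ dP H]]] := cone_nested x l0 ll' l'1.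
have xx := chart_at_dom x.
have b0 : `|phi x x - phi x x| < d by rewrite subrr normr0.
exists d, (e * `|w|); split => //; first by rewrite mulr_gt0 // normr_gt0 (Q0 Qw).
move=> u ud; have [zu eu] := dP _ ud; split => // W Ww.
apply: (H (phi x x) u w W) => //; last exact: ltW.
by rewrite cmapK // /vect change_coord_id.
Qed.

Lemma past_point l l' (x : B) (w : 'rV[R]_m) (A : set B) :
  0 < l -> l < l' -> l' < 1 -> Q l (w : tangent x) -> nbhs x A ->
  exists2 a, A a & reach (Q l') a x.
Proof.
move=> l0 ll' l'1 Qw xA; have [d [e box]] := cone_box_of_nested l0 ll' l'1 Qw.
have [d0 e0 boxP] := box; have xx := chart_at_dom x.
have [d1 d10 d1P] := chart_ball xx xA.
have nw : 0 < `|w| by rewrite normr_gt0 (Q0 Qw).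
have dd : 0 < Num.min d d1 by rewrite lt_min d0.
have [t t0] := small_factor (ltW nw) dd; rewrite lt_min => /andP[td td1].
pose u := phi x x - t *: w.
have ux : `|u - phi x x| = t * `|w|.
  by rewrite /u addrC addKr normrN normrZ gtr0_norm.
have ud : `|u - phi x x| < d by rewrite ux.
have [zu eu _] := boxP _ ud.
have ud1 : `|u - phi x x| < d1 by rewrite ux.
have [_ _ Au] := d1P u ud1.
exists (phiV x u) => //; apply: t_step.
exists x, (phi x x), w, d, e, t; split => //; rewrite ?eu //.
  by rewrite subrr normr0.
by split=> //; rewrite /u opprB [phi x x + _]addrC subrK subrr normr0 mulr_gt0.
Qed.

Section fixed.
Variables (x : B) (l l' d e : R).
Hypothesis e0 : 0 < e.
Hypothesis e1 : e <= 1.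
Hypothesis dP : forall u, `|u - phi x x| < d ->
  dom x (phiV x u) /\ phi x (phiV x u) = u.
Hypothesis HQ : forall u u' w w', `|u - phi x x| < d ->
    `|u' - phi x x| < d -> Q l (vect x (phiV x u) w) -> `|w' - w| <= e * `|w| ->
    Q l' (vect x (phiV x u') w').

(* Both ends of the connection can be moved, with relative displacement
   proportional to its length [S]. *)
Definition robust (h : R) (c c' : B) :=
  exists S, [/\ 0 < S, `|phi x c' - phi x c| <= S & forall a a' : 'rV[R]_m,
    `|a| <= h -> `|a'| <= h -> `|a' - a| <= e / 2 * S ->
    reach (Q l') (phiV x (phi x c + a)) (phiV x (phi x c' + a'))].

(** The junction is displaced by the interpolated vector [am], which divides the relative
    displacement of the ends in the ratio of the lengths [S] and [S']. *)
Lemma robust_trans h c c' c'' : robust h c c' -> robust h c' c'' -> robust h c c''.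
Proof.
move=> [S [S0 cS H]] [S' [S'0 cS' H']]; exists (S + S'); split.
- exact: addr_gt0.
- by apply: le_trans (ler_distD (phi x c') _ _) _; lra.
move=> a a' ah a'h aa'.
have SS : 0 < S + S' by exact: addr_gt0.
have [t [t01 tS tS']] : exists t, [/\ 0 <= t <= 1, S = t * (S + S') &
    S' = (1 - t) * (S + S')].
  exists (S / (S + S')); split; [|by field; rewrite gt_eqF..].
  by rewrite divr_ge0 ?(ltW S0) ?(ltW SS)//= ler_pdivrMr // mul1r lerDl ltW.
pose am := a + t *: (a' - a).
have [t0 t1] := andP t01.
have amh : `|am| <= h.
  rewrite /am lerpE; apply: le_trans (ler_normD _ _) _.
  rewrite !normrZ (ger0_norm t0) ger0_norm ?subr_ge0//.
  have : (1 - t) * `|a| <= (1 - t) * h by rewrite ler_wpM2l // subr_ge0.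
  have : t * `|a'| <= t * h by rewrite ler_wpM2l.
  lra.
have ta : t * `|a' - a| <= e / 2 * S.
  have -> : e / 2 * S = t * (e / 2 * (S + S')) by rewrite {1}tS; ring.
  by rewrite ler_wpM2l.
have ta' : (1 - t) * `|a' - a| <= e / 2 * S'.
  have -> : e / 2 * S' = (1 - t) * (e / 2 * (S + S')) by rewrite {1}tS'; ring.
  by rewrite ler_wpM2l // subr_ge0.
apply: t_trans (H a am ah amh _) (H' am a' amh a'h _).
  by rewrite /am addrC addKr normrZ ger0_norm.
have -> : a' - am = (1 - t) *: (a' - a).
  by apply/rowP => i; rewrite !mxE; ring.
by rewrite normrZ ger0_norm // subr_ge0.
Qed.

(** Near [t] a chord is, up to a small relative error, a multiple of a vector of [Q l]. Displacing
    its ends by at most [e / 2] of its length, relative to each other, keeps its direction within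
    the tolerance [e] of the nesting, hence in [Q l']. *)
Lemma robust_local (gam : R -> B) t r h : r + h < d -> 0 < r ->
  timelike_at (Q l) gam t -> dom x (gam t) -> `|phi x (gam t) - phi x x| < r ->
  exists2 dt, 0 < dt & forall s u, s <= t -> t <= u -> s < u -> t - dt < s ->
    u < t + dt -> [/\ dom x (gam s), `|phi x (gam s) - phi x x| < r &
     robust h (gam s) (gam u)].
Proof.
move=> rh r0 tl xt tr; have ct := tl.1.
have [w Qw sw] := timelike_at_chart tl xt.
have w0 : w != 0.
  apply/eqP => w0; have [_ bl] := trans_sdiff xt (chart_at_dom (gam t)).
  by have := Q0 Qw; rewrite w0 /vect (blin0 bl) eqxx.
have nw : 0 < `|w| by rewrite normr_gt0.
have e8 : 0 < e / 8 * `|w| by rewrite mulr_gt0 // divr_gt0.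
have r1 : 0 < r - `|phi x (gam t) - phi x x| by rewrite subr_gt0.
have [d1 d10 d1P] := curve_near ct (chart_nbhs xt r1).
have [d2 d20 d2P] := sw _ e8.
exists (Num.min d1 d2); first by rewrite lt_min d10.
move=> s u st tu su; rewrite ltrBlDr -ltrBlDl lt_min => /andP[s1 s2].
rewrite -ltrBlDl lt_min => /andP[u1 u2].
have st' : `|s - t| = t - s by rewrite ler0_norm ?subr_le0// opprB.
have tu' : `|u - t| = u - t by rewrite ger0_norm ?subr_ge0.
have [zs sd] : dom x (gam s) /\ `|phi x (gam s) - phi x (gam t)| <
    r - `|phi x (gam t) - phi x x| by apply: d1P; rewrite st'.
have [zu ud] : dom x (gam u) /\ `|phi x (gam u) - phi x (gam t)| <
    r - `|phi x (gam t) - phi x x| by apply: d1P; rewrite tu'.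
have sr : `|phi x (gam s) - phi x x| < r.
  by have := ler_distD (phi x (gam t)) (phi x (gam s)) (phi x x); lra.
have ur : `|phi x (gam u) - phi x x| < r.
  by have := ler_distD (phi x (gam t)) (phi x (gam u)) (phi x x); lra.
have us : 0 < u - s by rewrite subr_gt0.
have := d2P s u; rewrite st' tu' => /(_ s2 u2) /=; rewrite (gtr0_norm us).
have [D DE] : exists D, phi x (gam u) - phi x (gam s) = D by eexists.
rewrite DE => Dw.
have usw : 0 < (u - s) * `|w| by rewrite mulr_gt0.
have nD : `|(u - s) *: w| = (u - s) * `|w| by rewrite normrZ gtr0_norm.
have eusw : e * ((u - s) * `|w|) <= (u - s) * `|w| by rewrite ler_piMl // ltW.
have D1 : `|D| <= 2 * ((u - s) * `|w|).
  by have := ler_distD ((u - s) *: w) D 0; rewrite !subr0 nD; lra.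
have D2 : 0 < `|D|.
  by have := ler_distD D ((u - s) *: w) 0; rewrite !subr0 nD distrC; lra.
split => //; exists `|D|; split; rewrite ?DE // => a a' ah a'h aa'.
pose W := (u - s)^-1 *: (D + (a' - a)).
have WE : (u - s) *: W = D + (a' - a).
  by rewrite /W scalerA mulfV ?gt_eqF// scale1r.
(* [1 / 8] comes from the strict derivative, [1 / 2] from the displacement, [1 / 16] from the excess
   of the length of the chord over [(u - s) * |w|]. The box used below adds [1 / 8]; the total stays
   below [1]. *)
have Ww : `|W - w| <= e * (1 / 8 + 1 / 2 + 1 / 16) * `|w|.
  rewrite -(ler_pM2l us) -[X in X * `|W - w|](gtr0_norm us) -normrZ scalerBr WE.
  have -> : D + (a' - a) - (u - s) *: w = (D - (u - s) *: w) + (a' - a).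
    by rewrite addrAC.
  apply: le_trans (ler_normD _ _) _.
  have D3 : `|D| <= (u - s) * `|w| + e / 8 * `|w| * (u - s).
    by have := ler_distD ((u - s) *: w) D 0; rewrite !subr0 nD; lra.
  have : e / 2 * `|D| <= e / 2 * ((u - s) * `|w| + e / 8 * `|w| * (u - s)).
    by rewrite ler_pM2l // divr_gt0.
  have : e * (e * ((u - s) * `|w|)) <= e * ((u - s) * `|w|) by rewrite ler_pM2l.
  lra.
have dW : forall a1, `|a1| <= h -> forall c, `|phi x c - phi x x| < r ->
    `|phi x c + a1 - phi x x| < d.
  move=> a1 a1h c cr; rewrite addrAC.
  by apply: le_lt_trans (ler_normD _ _) _; lra.
have [xs es] := dP (dW _ ah _ sr); have [xu eu] := dP (dW _ a'h _ ur).
apply: t_step; exists x, (phi x x), W, d, (e / 8 * `|w|), (u - s).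
have d0 : 0 < d by have := normr_ge0 a; lra.
split; rewrite ?es ?eu //; try exact: dW; last first.
  split=> //; rewrite WE.
  have -> : phi x (gam u) + a' - (phi x (gam s) + a) - (D + (a' - a)) = 0.
    by rewrite -DE; apply/rowP => i; rewrite !mxE; ring.
  by rewrite normr0 mulr_gt0.
split => // u' u'd; have [xu' eu'] := dP u'd; split => // W' W'W.
have td : `|phi x (gam t) - phi x x| < d by have := normr_ge0 a; lra.
apply: (HQ td u'd (w := w)); first by rewrite (cmapK xt).
have := ler_distD W W' w.
lra.
Qed.

End fixed.

End perturbation.

(** * Limits of end points of chains *)

Section closure.
Context {R : realType} {m : nat} {B : manifold R m}.
Local Notation dom x := (cdom (chart_at x)).
Local Notation phi x := (cmap (chart_at x)).
Local Notation phiV x := (cinv (chart_at x)).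
Variable Q : R -> tangent_subsets B.
Hypothesis Qnest : forall b l l', 0 < l -> l < l' -> l' < 1 ->
  exists d e, [/\ 0 < d, 0 < e & forall u u' w w', `|u - phi b b| < d ->
    `|u' - phi b b| < d -> Q l (vect b (phiV b u) w) -> `|w' - w| <= e * `|w| ->
    Q l' (vect b (phiV b u') w')].
Hypothesis Q0 : forall l b (w : 'rV[R]_m), Q l (w : tangent b) -> w != 0.

(** A chain ending at [y] is followed backwards. While it stays in a small ball around [x] it is in
    [A]; once it leaves, it is long enough that its end may be moved from [y] to [x], at the cost of
    passing from [Q l] to [Q l']. *)
Lemma reach_closure (x : B) l l' (A : set B) : 0 < l -> l < l' -> l' < 1 ->
  nbhs x A -> nbhs x [set y | forall a, reach (Q l) a y -> A a \/ reach (Q l') a x].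
Proof.
move=> l0 ll' l'1 xA; have xx := chart_at_dom x.
have [d [e [d0 e0 e1 dP HQ]]] := cone_nested Qnest x l0 ll' l'1.
have [dA dA0 dAP] := chart_ball xx xA.
have [r [r0 rd rA]] : exists r, [/\ 0 < r, r <= d / 2 & r <= dA].
  exists (Num.min (d / 2) dA); rewrite lt_min dA0 divr_gt0 //.
  by split => //; rewrite ge_min lexx ?orbT.
pose h := d / 4.
have rh : r + h < d by rewrite /h; lra.
(* The last bound is the displacement allowed at the end of a robust connection of length
   [r / 4]. *)
have [eta [eta0 etar etah etae]] : exists eta, [/\ 0 < eta, eta <= r / 4, eta <= h &
    eta <= e / 2 * (r / 4)].
  exists (Num.min (r / 4) (Num.min h (e / 2 * (r / 4)))).
  rewrite !lt_min /h; split; rewrite ?ge_min ?lexx ?orbT //.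
  by rewrite !(divr_gt0, mulr_gt0).
apply: filterS (chart_nbhs xx eta0) => y /= [xy yx] a ay.
have h0 : 0 <= h by rewrite /h; lra.
(* The invariant carried backwards: still in the ball and robustly connected to [y], or already
   connected to [x]. *)
pose G c := (dom x c /\ `|phi x c - phi x x| < r /\
   (c = y \/ robust Q x l' e h c y)) \/ reach (Q l') c x.
suff : G a.
  case=> [[xa [ar _]]|]; last by right.
  by left; have [_ _] := dAP _ (lt_le_trans ar rA); rewrite cmapK.
have Gy : G y by left; split => //; split; [lra|left].
have step c c' : lstep (Q l) c c' -> G c' -> G c.
  move=> /lstep_curve[gam [s [s0 <- <- st tl]]].
  apply: (@cousin_chain _ (fun u v => G (gam v) -> G (gam u))) => //.
    by move=> u v w _ _ _ _ h1 h2 /h2/h1.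
  move=> t t0 ts; have tlt := tl t (introT andP (conj t0 ts)).
  have later u v : 0 <= u -> u < v -> v <= s -> reach (Q l') (gam v) x ->
      reach (Q l') (gam u) x.
    move=> u0 uv vs; apply: t_trans; apply: t_step.
    by apply: lstep_mono (st u v u0 uv vs) => p; exact: (cone_mono Qnest).
  have [[xt tr]|nt] := pselect (dom x (gam t) /\ `|phi x (gam t) - phi x x| < r).
    have [dt dt0 dtP] := robust_local Q0 e0 e1 dP HQ rh r0 tlt xt tr.
    exists dt => // u v u0 ut tv vs uv dtu dtv.
    have [xu ur Ruv] := dtP u v ut tv uv dtu dtv.
    case=> [[xv [vr [vy|Rvy]]]|]; last by move=> ?; right; exact: later uv vs _.
      by left; split => //; split => //; right; rewrite -vy.
    left; split => //; split => //; right.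
    by move: Ruv Rvy; apply: robust_trans.
  (* If [gam t] is outside the ball, later points nearby may still be inside it, but not within
     [r / 2]: that smaller ball is closed in [B]. They are thus at distance at least [r / 4] from
     [y]. *)
  have r2d : r / 2 < d by lra.
  have cK := chart_ball_closed dP r2d.
  have nK : nbhs (gam t) (~` [set p | dom x p /\ `|phi x p - phi x x| <= r / 2]).
    apply: open_nbhs_nbhs; split; first exact: closed_openC.
    by move=> [xt tr]; apply: nt; split => //; lra.
  have [dt dt0 dtP] := curve_near tlt.1 nK.
  exists dt => // u v u0 ut tv vs uv dtu dtv.
  have vK : ~ (dom x (gam v) /\ `|phi x (gam v) - phi x x| <= r / 2).
    by apply: dtP; rewrite ger0_norm ?subr_ge0 //; lra.
  suff : G (gam v) -> reach (Q l') (gam v) x.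
    by move=> H /H ?; right; exact: later uv vs _.
  case=> [[xv [vr Hv]]|//].
  have v2 : r / 2 < `|phi x (gam v) - phi x x|.
    by rewrite ltNge; apply/negP => hv; apply: vK.
  case: Hv => [vy|[S [S0 vS HS]]].
    by exfalso; move: v2; rewrite vy; lra.
  have vy : r / 4 <= `|phi x y - phi x (gam v)|.
    have := ler_distD (phi x y) (phi x (gam v)) (phi x x).
    by rewrite (distrC (phi x (gam v)) (phi x y)); lra.
  (* The start stays fixed and the end moves from [y] to [x]. *)
  have := HS 0 (phi x x - phi x y); rewrite addr0 subr0 normr0.
  rewrite (cmapK xv) [phi x y + _]addrC subrK (cmapK xx); apply => //.
    by rewrite distrC; lra.
  rewrite distrC; apply: (le_trans (ltW yx)); apply: (le_trans etae).
  by rewrite ler_pM2l ?divr_gt0 //; lra.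
suff key c c' : reach (Q l) c c' -> G c' -> G c by exact: key ay Gy.
by elim=> [p p' /step//|p p' p'' _ h1 _ h2 /h2/h1].
Qed.

End closure.

(** * Weighted sums and Urysohn-type functions *)

Section real_valued.
Context {R : realType} {T : topologicalType}.

Lemma continuous_dist (f : T -> R) (x : T) :
  (forall e, 0 < e -> nbhs x [set y | `|f y - f x| < e]) ->
  {for x, continuous f}.
Proof.
move=> H; apply/cvgrPdist_lt => e /H; apply: filterS => y /=.
by rewrite distrC.
Qed.

Lemma dist_continuous (f : T -> R) (x : T) : {for x, continuous f} ->
  forall e, 0 < e -> nbhs x [set y | `|f y - f x| < e].
Proof.
move=> /cvgrPdist_lt H e /H; apply: filterS => y /=.
by rewrite distrC.
Qed.

Lemma exp_half_small (e : R) : 0 < e -> exists n, 2^-1 ^+ n < e.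
Proof.
move=> e0; have [n _ /(_ n (leqnn n))] := near_infty_natSinv_expn_lt (PosNum e0).
by rewrite /= div1r -exprVn; exists n.
Qed.

Section weighted_sum.
Variable u : nat -> T -> R.
Hypothesis u01 : forall k x, 0 <= u k x <= 1.

Definition partial_sum n x := \sum_(k < n) 2^-1 ^+ k.+1 * u k x.

Lemma partial_sumS n x :
  partial_sum n.+1 x = partial_sum n x + 2^-1 ^+ n.+1 * u n x.
Proof. by rewrite /partial_sum big_ord_recr. Qed.

Lemma partial_sum_le n x : partial_sum n x <= partial_sum n.+1 x.
Proof.
rewrite partial_sumS lerDl mulr_ge0 // ?exprn_ge0 //.
by have /andP[] := u01 n x.
Qed.

Lemma partial_sum_bound n k x :
  partial_sum (n + k) x <= partial_sum n x + 2^-1 ^+ n - 2^-1 ^+ (n + k).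
Proof.
elim: k => [|k IH]; first by rewrite addn0 addrK.
rewrite addnS partial_sumS.
have /andP[h0 h1] := u01 (n + k) x.
have p0 : 0 < (2^-1 : R) ^+ (n + k).+1 by rewrite exprn_gt0.
have : 2^-1 ^+ (n + k).+1 * u (n + k)%N x <= 2^-1 ^+ (n + k).+1 by rewrite ler_piMr // ltW.
have : (2^-1 : R) ^+ (n + k) = 2 * 2^-1 ^+ (n + k).+1 by rewrite exprS mulrA divff ?mul1r.
lra.
Qed.

Lemma partial_sum_mono n k x : partial_sum n x <= partial_sum (n + k) x.
Proof.
elim: k => [|k IH]; first by rewrite addn0.
by rewrite addnS; apply: le_trans IH (partial_sum_le _ _).
Qed.

Lemma partial_sum_any n k x : partial_sum k x <= partial_sum n x + 2^-1 ^+ n.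
Proof.
have p0 j : 0 < (2^-1 : R) ^+ j by rewrite exprn_gt0.
have [nk|kn] := leqP n k.
  by have := partial_sum_bound n (k - n) x; rewrite subnKC //; have := p0 k; lra.
have := partial_sum_mono k (n - k) x; rewrite subnKC ?(ltnW kn)//.
by have := p0 n; lra.
Qed.

(** The series is encoded as the supremum of its increasing partial sums, with tail at most
    [2^-1 ^+ n] after [n] terms. *)
Definition weighted_sum x := sup (range (partial_sum ^~ x)).

Lemma weighted_sum_bounds n x :
  partial_sum n x <= weighted_sum x <= partial_sum n x + 2^-1 ^+ n.
Proof.
have ub k : ubound (range (partial_sum ^~ x)) (partial_sum k x + 2^-1 ^+ k).
  by move=> _ [j _ <-]; exact: partial_sum_any.
apply/andP; split.
  by apply: ub_le_sup; [exists (partial_sum 0 x + 2^-1 ^+ 0); exact: ub|exists n].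
by apply: ge_sup; [exists (partial_sum 0 x), 0%N|exact: ub].
Qed.

Lemma weighted_sum_continuous : (forall k, continuous (u k)) -> continuous weighted_sum.
Proof.
move=> cu.
have cs n : continuous (partial_sum n).
  elim: n => [|n IH] x.
    have -> : partial_sum 0 = cst 0 by apply/funext => y; rewrite /partial_sum big_ord0.
    exact: cvg_cst.
  have -> : partial_sum n.+1 = (fun x => partial_sum n x + 2^-1 ^+ n.+1 * u n x).
    by apply/funext => y; exact: partial_sumS.
  apply: cvgD; first exact: IH.
  by apply: cvgM; [exact: cvg_cst|exact: cu].
move=> x; apply: continuous_dist => e e0.
have e4 : 0 < e / 4 by rewrite divr_gt0.
have [n nP] := exp_half_small e4.
have := dist_continuous (cs n x) e4; apply: filterS => y /=.
rewrite !ltr_norml => /andP[h1 h2].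
have /andP[] := weighted_sum_bounds n x; have /andP[] := weighted_sum_bounds n y.
by move=> h3 h4 h5 h6; apply/andP; split; lra.
Qed.

Lemma weighted_sum_ge k x : 2^-1 ^+ k.+1 * u k x <= weighted_sum x.
Proof.
have /andP[+ _] := weighted_sum_bounds k.+1 x; apply: le_trans.
rewrite partial_sumS lerDr; apply: sumr_ge0 => i _.
by rewrite mulr_ge0 // ?exprn_ge0 //; have /andP[] := u01 i x.
Qed.

Lemma weighted_sum_lt k x y : (forall k, u k x <= u k y) -> u k x < u k y ->
  weighted_sum x < weighted_sum y.
Proof.
move=> uxy uk.
have d0 : 0 < 2^-1 ^+ k.+1 * (u k y - u k x) by rewrite mulr_gt0 ?exprn_gt0 ?subr_gt0.
(* A cut-off at which the tail at [x] is smaller than the gain in the term [k]. *)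
have [n nP] := exp_half_small d0.
have p0 j : 0 < (2^-1 : R) ^+ j by rewrite exprn_gt0.
have H j : partial_sum (k.+1 + j) x + 2^-1 ^+ k.+1 * (u k y - u k x) <=
    partial_sum (k.+1 + j) y.
  elim: j => [|j IH].
    rewrite addn0 !partial_sumS mulrBr.
    have : partial_sum k x <= partial_sum k y.
      by apply: ler_sum => i _; rewrite ler_pM2l.
    lra.
  have jS : (k.+1 + j.+1 = (k.+1 + j).+1)%N by rewrite addnS.
  by rewrite jS (partial_sumS _ x) (partial_sumS _ y) addrAC; apply: (lerD IH); rewrite ler_pM2l.
have /andP[_ h1] := weighted_sum_bounds (k.+1 + n) x.
have /andP[h2 _] := weighted_sum_bounds (k.+1 + n) y.
have h3 := H n.
have : (2^-1 : R) ^+ (k.+1 + n) <= 2^-1 ^+ n.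
  by apply: ler_wiXn2l; [lra|lra|exact: leq_addl].
lra.
Qed.

End weighted_sum.

Section urysohn.
Variable F : R -> set T.
Hypothesis Fopen : forall l, 0 < l < 1 -> open (F l).
Hypothesis Fnest : forall l l', 0 < l -> l < l' -> l' < 1 ->
  closure (F l) `<=` F l'.

(** Small sets of the family get high levels; the element [0] is the default for a point in none of
    them. *)
Let E y := [set 0] `|` [set 1 - l | l in [set l : R | 0 < l < 1 /\ F l y]].

Definition urysohn_level y : R := sup (E y).

Lemma urysohn_level_ub y : ubound (E y) 1.
Proof. by move=> _ [->|[l [/andP[l0 l1] _] <-]]; lra. Qed.

Lemma urysohn_level01 y : 0 <= urysohn_level y <= 1.
Proof.
apply/andP; split.
  by apply: ub_le_sup; [exists 1; exact: urysohn_level_ub|left].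
by apply: ge_sup; [exists 0; left|exact: urysohn_level_ub].
Qed.

Lemma urysohn_level_ge l y : 0 < l < 1 -> F l y -> 1 - l <= urysohn_level y.
Proof.
move=> l01 Fy; apply: ub_le_sup; first by exists 1; exact: urysohn_level_ub.
by right; exists l.
Qed.

Lemma urysohn_level_le l y : l <= 1 -> (forall l', 0 < l' < 1 -> F l' y -> l <= l') ->
  urysohn_level y <= 1 - l.
Proof.
move=> l1 H; apply: ge_sup; first by exists 0; left.
by move=> _ [->|[l' [l'01 /(H _ l'01) ll'] <-]]; lra.
Qed.

Lemma urysohn_level_mono y y' : (forall l, 0 < l < 1 -> F l y -> F l y') ->
  urysohn_level y <= urysohn_level y'.
Proof.
move=> H; apply: ge_sup; first by exists 0; left.
move=> _ [->|[l [l01 Fy] <-]]; first by have /andP[] := urysohn_level01 y'.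
by apply: urysohn_level_ge => //; exact: H.
Qed.

Lemma urysohn_level_continuous : continuous urysohn_level.
Proof.
move=> y; apply: continuous_dist => e e0.
have /andP[fy0 fy1] := urysohn_level01 y.
have lower : nbhs y [set y' | urysohn_level y - e < urysohn_level y'].
  have [lt0|ge0] := ltP (urysohn_level y - e) 0.
    apply: filterS (filterT : nbhs y setT) => y' _ /=.
    by have /andP[] := urysohn_level01 y'; lra.
  have hs : has_sup (E y) by split; [exists 0; left|exists 1; exact: urysohn_level_ub].
  have [_ [->|[l [l01 Fy] <-]] hl] := sup_adherent e0 hs.
    by move: hl ge0; rewrite -/(urysohn_level y) => h1 h2; exfalso; lra.
  have := open_nbhs_nbhs (conj (Fopen l01) Fy); apply: filterS => y' Fy' /=.
  exact: lt_le_trans hl (urysohn_level_ge l01 Fy').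
have upper : nbhs y [set y' | urysohn_level y' < urysohn_level y + e].
  have [ge1|lt1] := leP 1 (urysohn_level y + e / 2).
    apply: filterS (filterT : nbhs y setT) => y' _ /=.
    by have /andP[] := urysohn_level01 y'; lra.
  (* Since [1 - l2] exceeds the level of [y], the point is not in [F l2], hence by nesting not in
     the closure of [F l1]. A whole neighbourhood then avoids [F l1], which bounds its levels by
     [1 - l1]. *)
  pose l2 := 1 - urysohn_level y - e / 4; pose l1 := 1 - urysohn_level y - e / 2.
  have l10 : 0 < l1 by rewrite /l1; lra.
  have l12 : l1 < l2 by rewrite /l1 /l2; lra.
  have l21 : l2 < 1 by rewrite /l2; lra.
  have nF2 : ~ F l2 y.
    move=> /urysohn_level_ge; rewrite l21 (lt_trans l10 l12) => /(_ isT).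
    by rewrite /l2; lra.
  have nF1 : ~ closure (F l1) y by move=> /(Fnest l10 l12 l21).
  have := open_nbhs_nbhs (conj (closed_openC (@closed_closure _ (F l1))) nF1).
  apply: filterS => y' nFy' /=.
  have := @urysohn_level_le l1 y'; rewrite {1}/l1.
  have -> : 1 - l1 = urysohn_level y + e / 2 by rewrite /l1; lra.
  move=> H; apply: le_lt_trans (H _ _) _; last 2 first.
  - move=> l' /andP[l'0 l'1] Fl'; rewrite leNgt; apply/negP => l'l1.
    by apply: nFy'; apply: subset_closure; apply: (Fnest l'0 l'l1 (lt_trans l12 l21));
       exact: subset_closure.
  - by lra.
  by lra.
apply: filterS (filterI lower upper) => y' /= [h1 h2].
by rewrite ltr_norml; apply/andP; split; lra.
Qed.

End urysohn.

End real_valued.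

(** * A countable family of bump functions *)

Section bumps.
Context {R : realType} {n : nat} (N : manifold R n).
Local Notation dom x := (cdom (chart_at x)).
Local Notation phi x := (cmap (chart_at x)).
Local Notation phiV x := (cinv (chart_at x)).

Lemma clamp_lip (a b : R) :
  `|Num.min 1 (Num.max 0 a) - Num.min 1 (Num.max 0 b)| <= `|a - b|.
Proof.
have h1 := ler_norm (a - b); have h2 := lerNnormlW (lexx `|a - b|).
case: (leP 0 a) => ha; case: (leP 0 b) => hb;
  [case: (leP 1 a) => ha1; case: (leP 1 b) => hb1|case: (leP 1 a) => ha1; case: (leP 1 0) => hb1
  |case: (leP 1 0) => ha1; case: (leP 1 b) => hb1|case: (leP 1 0) => hb1];
  rewrite ler_norml; lra.
Qed.

Definition bump_on (U V : set N) (r : N -> R) := [/\ continuous r,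
  forall x, 0 <= r x <= 1, forall x, U x -> r x = 1 &
  exists2 K, compact K & forall x, r x <> 0 -> K x /\ V x].

Lemma bump_exists (p : N) (V : set N) : nbhs p V ->
  exists r, exists2 U, nbhs p U & bump_on U V r.
Proof.
move=> pV; have pp := chart_at_dom p.
have [d d0 dP] := chart_ball pp pV.
have dP' u : `|u - phi p p| < d -> dom p (phiV p u) /\ phi p (phiV p u) = u.
  by move=> /dP[].
(* The default [d] outside the chart makes [r] vanish there: [r] is [1] for [t <= d / 2] and [0] for
   [t >= 3 / 4 * d]. *)
pose t q : R := if `[< dom p q >] then `|phi p q - phi p p| else d.
pose r q := Num.min 1 (Num.max 0 (3 - 4 / d * t q)).
have tdom q : dom p q -> t q = `|phi p q - phi p p|.
  by move=> pq; rewrite /t; case: asboolP.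
pose K := [set q | dom p q /\ `|phi p q - phi p p| <= 3 / 4 * d].
have d34 : 3 / 4 * d < d by lra.
have cK : closed K := chart_ball_closed dP' d34.
have kK : compact K := chart_ball_compact dP' d34.
have r0 q : ~ K q -> r q = 0.
  move=> nK; have tq : 3 / 4 * d <= t q.
    rewrite /t; case: asboolP => [pq|_]; last exact: ltW.
    by rewrite leNgt; apply/negP => h; apply: nK; split => //; exact: ltW.
  have : 3 - 4 / d * t q <= 0.
    have : 4 / d * (3 / 4 * d) <= 4 / d * t q by rewrite ler_pM2l // divr_gt0.
    have -> : 4 / d * (3 / 4 * d) = 3 by field; rewrite gt_eqF.
    lra.
  by move=> h; rewrite /r (max_idPl h) min_r.
have rK q : r q <> 0 -> K q by move=> rq; apply: contrapT => /r0.
exists r, [set q | dom p q /\ `|phi p q - phi p p| < d / 2].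
  by apply: chart_nbhs => //; rewrite divr_gt0.
split.
- move=> q; apply: continuous_dist => e e0.
  have [pq|npq] := pselect (dom p q).
    have e' : 0 < e * d / 4 by rewrite !(divr_gt0, mulr_gt0).
    apply: filterS (chart_nbhs pq e') => q' /= [pq' qq'].
    apply: le_lt_trans (clamp_lip _ _) _.
    rewrite (tdom _ pq) (tdom _ pq').
    set a := `|phi p q - _|; set b := `|phi p q' - _|.
    have -> : 3 - 4 / d * b - (3 - 4 / d * a) = 4 / d * (a - b) by ring.
    rewrite normrM gtr0_norm ?divr_gt0 //.
    have ab : `|a - b| < e * d / 4.
      apply: le_lt_trans (ler_dist_dist _ _) _.
      by rewrite opprB addrA subrK distrC.
    have : 4 / d * `|a - b| < 4 / d * (e * d / 4) by rewrite ltr_pM2l // divr_gt0.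
    by have -> : 4 / d * (e * d / 4) = e by field; rewrite gt_eqF.
  (* Outside the chart continuity comes from [K] being closed in the whole space, so that [r]
     vanishes near [q]. *)
  have nK : ~ K q by move=> [].
  have := open_nbhs_nbhs (conj (closed_openC cK) nK); apply: filterS => q' nK' /=.
  by rewrite (r0 _ nK) (r0 _ nK') subrr normr0.
- move=> x; rewrite /r le_min ge_min ler01 lexx /= andbT.
  by rewrite le_max lexx.
- move=> x [px xd]; rewrite /r tdom //.
  have h : 1 <= 3 - 4 / d * `|phi p x - phi p p|.
    have : 4 / d * `|phi p x - phi p p| <= 4 / d * (d / 2).
      by rewrite ler_pM2l ?divr_gt0 // ltW.
    have -> : 4 / d * (d / 2) = 2 by field; rewrite gt_eqF.
    lra.
  rewrite (max_idPr _); last by lra.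
  by rewrite min_l.
- exists K => // x /rK Kx; split => //; case: Kx => px xd.
  by have [_ _] := dP _ (le_lt_trans xd d34); rewrite cmapK.
Qed.

Lemma countable_basis : exists U : nat -> set N, forall (p : N) V, nbhs p V ->
  exists k, nbhs p (U k) /\ U k `<=` V.
Proof.
have [C cC [Copen Cb]] := @manifold_second_countable _ _ N.
have [C0|[f]] := pfcard_geP cC.
  exists (fun=> set0) => p V pV; have [U [CU _] _] := Cb p V pV.
  by move: CU; rewrite C0.
exists f => p V pV; have [U [CU Up] UV] := Cb p V pV.
have [k _ kU] := 'surj_f CU.
exists k; rewrite kU; split => //; apply: open_nbhs_nbhs; split => //.
exact: Copen.
Qed.

(** Pairs of basic open sets are enumerated by [pickle]. A pair admitting a bump gets one, every
    other index gets the zero function. *)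
Lemma bump_family : exists rho : nat -> N -> R,
  (forall k, exists2 K, compact K & forall x, rho k x <> 0 -> K x) /\
  (forall k, continuous (rho k)) /\ (forall k x, 0 <= rho k x <= 1) /\
  forall (p : N) V, nbhs p V -> exists k, nbhs p [set x | rho k x = 1] /\
    forall x, rho k x <> 0 -> V x.
Proof.
have [U UP] := countable_basis.
have H (k : nat) : exists r, bump_on set0 setT r /\
   forall i j, unpickle k = Some (i, j) -> (exists r', bump_on (U i) (U j) r') ->
     bump_on (U i) (U j) r.
  have bump0 : bump_on set0 setT (fun _ : N => 0 : R).
    split => //; first by move=> x; exact: cvg_cst.
      by move=> x; rewrite lexx ler01.
    by exists set0 => //; exact: compact0.
  case E : (unpickle k) => [[i j]|]; last by exists (fun=> 0).
  have [[r [cr r01 rU [K cK rK]]]|nr] := pselect (exists r', bump_on (U i) (U j) r').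
    exists r; split; first by split => //; exists K => // x /rK[].
    by move=> i' j' [<- <-] _; split => //; exists K.
  by exists (fun=> 0); split => // i' j' [<- <-].
have [rho rhoP] := choice H.
exists rho; split.
  by move=> k; have [[_ _ _ [K cK KP]] _] := rhoP k; exists K => // x /KP[].
split; first by move=> k; have [[]] := rhoP k.
split; first by move=> k; have [[]] := rhoP k.
move=> p V pV; have [j [pj jV]] := UP p V pV.
have [r [W pW [cr r01 rW [K cK rK]]]] := bump_exists pj.
have [i [pi iW]] := UP p W pW.
have B : bump_on (U i) (U j) r.
  by split => //; [move=> x /iW; exact: rW|exists K].
have [_ rk] := rhoP (pickle (i, j)).
have [_ _ rU [K' _ K'P]] := rk i j (pickleK _) (ex_intro _ r B).
exists (pickle (i, j)); split; last by move=> x /K'P[_ /jV].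
by apply: filterS pi => x /rU.
Qed.

End bumps.

(** * The time function on the base *)

Section base_time_function.
Context {R : realType} {m : nat} {B : manifold R m}.
Local Notation phi x := (cmap (chart_at x)).
Local Notation phiV x := (cinv (chart_at x)).
Variable Q : R -> tangent_subsets B.
Hypothesis Qnest : forall b l l', 0 < l -> l < l' -> l' < 1 ->
  exists d e, [/\ 0 < d, 0 < e & forall u u' w w', `|u - phi b b| < d ->
    `|u' - phi b b| < d -> Q l (vect b (phiV b u) w) -> `|w' - w| <= e * `|w| ->
    Q l' (vect b (phiV b u') w')].
Hypothesis Q0 : forall l b (w : 'rV[R]_m), Q l (w : tangent b) -> w != 0.
Hypothesis Qnon : forall l b, 0 < l < 1 -> exists w : 'rV[R]_m, Q l (w : tangent b).
Hypothesis Qirr : forall l b, 0 < l < 1 -> ~ reach (Q l) b b.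

(* The pair (set of departure, cone field) grows with [l], which makes the closure
   of one set lie in the next. *)
Definition future_of (rho : B -> R) (l : R) : set B :=
  [set y | exists2 a, 1 - l / 2 < rho a & reach (Q (l / 2)) a y].

Lemma future_of_open rho l : open (future_of rho l).
Proof.
rewrite openE => y [a ra ay]; have := reach_open_r ay.
by apply: filterS => y' ay'; exists a.
Qed.

(** If [rho y] reaches the threshold for [l], points just before [y] exceed the lower one for [l']
    and reach [y]. Otherwise no admissible departure lies near [y], and [reach_closure] turns chains
    ending near [y] into chains ending at [y]. *)
Lemma future_of_nest rho l l' : continuous rho -> 0 < l -> l < l' -> l' < 1 ->
  closure (future_of rho l) `<=` future_of rho l'.
Proof.
move=> cr l0 ll' l'1 y Fy.
have h0 : 0 < l / 2 by rewrite divr_gt0.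
have hl : l / 2 < l' / 2 by lra.
have h1 : l' / 2 < 1 by lra.
have [ry|ry] := leP (1 - l / 2) (rho y).
  have nA : nbhs y [set a | 1 - l' / 2 < rho a].
    have e0 : 0 < l' / 2 - l / 2 by lra.
    apply: filterS (dist_continuous (cr y) e0) => a /=.
    by rewrite ltr_norml => /andP[]; lra.
  have [w Qw] := Qnon y (introT andP (conj h0 (lt_trans hl h1))).
  have [a Aa ay] := past_point Qnest Q0 h0 hl h1 Qw nA.
  by exists a.
have nA : nbhs y [set a | rho a < 1 - l / 2].
  have e0 : 0 < 1 - l / 2 - rho y by lra.
  apply: filterS (dist_continuous (cr y) e0) => a /=.
  by rewrite ltr_norml => /andP[]; lra.
have [y1 [[a ra ay1] W1]] := Fy _ (reach_closure Qnest Q0 h0 hl h1 nA).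
case: (W1 a ay1) => /= [h|ay]; first by exfalso; lra.
by exists a => //; lra.
Qed.

(** Every level is monotone along chains. For strictness a bump is taken that equals [1] near [c']
    and is supported in the [Q 2^-1]-future of [c]: its level is [0] at [c] and at least [1 / 2] at
    [c']. *)
Lemma base_time_function : exists f : B -> R, continuous f /\
  forall c c', (forall l, 0 < l < 1 -> reach (Q l) c c') -> f c < f c'.
Proof.
have [rho [_ [crho [rho01 rhoP]]]] := bump_family B.
pose u k := urysohn_level (future_of (rho k)).
have Fopen k l : 0 < l < 1 -> open (future_of (rho k) l) by move=> _; exact: future_of_open.
have Fnest k l l' : 0 < l -> l < l' -> l' < 1 ->
  closure (future_of (rho k) l) `<=` future_of (rho k) l'.
  exact: future_of_nest.
have u01 k x : 0 <= u k x <= 1 by exact: urysohn_level01.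
exists (weighted_sum u); split.
  apply: weighted_sum_continuous => // k.
  exact: urysohn_level_continuous (Fopen k) (Fnest k).
move=> c c' cc'.
have h12 : 0 < (2^-1 : R) < 1 by rewrite invr_gt0 invf_lt1 // ltr0n ltr1n.
have [k [r1 rV]] := rhoP _ _ (reach_open_r (cc' _ h12)).
apply: (weighted_sum_lt u01 (k := k)).
  move=> j; apply: urysohn_level_mono => l /andP[l0 l1] [a ra ac].
  exists a => //; apply: t_trans ac _; apply: cc'; apply/andP; split; lra.
apply: (@le_lt_trans _ _ 0).
  have := @urysohn_level_le _ _ (future_of (rho k)) 1 c (lexx 1); rewrite subrr; apply.
  (* Halving the index pays here: [1 - l / 2] is positive, so [a] lies in the support of the bump
     and hence in the future of [c], and the chain back to [c] lies in [Q 2^-1]. A closed chain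
     results. *)
  move=> l /andP[l0 l1] [a ra ac]; exfalso; apply: (Qirr (b := c) h12).
  have ca : reach (Q 2^-1) c a by apply: rV => ra0; move: ra; rewrite ra0; lra.
  apply: t_trans ca _; apply: (reach_cone_mono Qnest _ _ _ ac); lra.
(* Any index below [1 / 4] will do, since [future_of] at [1 / 2] uses chains of [Q (1 / 4)]. *)
have h8 : 0 < (1 / 8 : R) < 1 by apply/andP; split; lra.
have [w Qw] := Qnon c' h8.
have [h80 _] := andP h8.
have h84 : (1 / 8 : R) < 2^-1 / 2 by lra.
have h41 : (2^-1 / 2 : R) < 1 by lra.
have [a ra ac'] := past_point Qnest Q0 h80 h84 h41 Qw r1.
have Fc' : future_of (rho k) 2^-1 c' by exists a => //; rewrite /= in ra; rewrite ra; lra.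
apply: lt_le_trans (urysohn_level_ge h12 Fc'); lra.
Qed.

End base_time_function.

(** * Proper weights and the heavy points of a fiber *)

Lemma compact_uniform {R : realType} {X : topologicalType} (K : set X)
    (P : R -> X -> Prop) : compact K ->
  (forall d d' x, d' <= d -> P d x -> P d' x) ->
  (forall x, K x -> exists2 d, 0 < d & nbhs x (P d)) ->
  exists2 d, 0 < d & forall x, K x -> P d x.
Proof.
move=> cK Pmono loc.
have := iffLR (compact_near_coveringP K) cK R (0^'+) P _ _.
case.
  move=> x /loc[d d0 xd]; exists (P d, [set d' | 0 < d' < d]) => /=.
    split => //; near=> d'; apply/andP; split; near: d'.
      exact: nbhs_right_gt.
    exact: nbhs_right_lt.
  by move=> [x' d'] [/= Px' /andP[_ d'd]]; apply: Pmono (ltW d'd) Px'.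
move=> d /= d0 dP.
exists (d / 2); first by rewrite divr_gt0.
apply: dP => /=; last by rewrite divr_gt0.
by rewrite /ball_ /= sub0r normrN gtr0_norm ?divr_gt0 //; lra.
Unshelve. all: by end_near. Qed.

(** In a weighted sum of bumps with compact supports, a value at least [k] forces one of finitely
    many of them to be nonzero, because the tail is smaller than [k]. *)
Lemma proper_weight {R : realType} {n : nat} (N : manifold R n) :
  exists D : N -> R, [/\ continuous D, forall x, 0 < D x &
    forall k, 0 < k -> exists2 K, compact K & forall x, k <= D x -> K x].
Proof.
have [rho [cK [crho [rho01 rhoP]]]] := bump_family N.
exists (weighted_sum rho); split.
- exact: weighted_sum_continuous.
- move=> x; have [k [r1 _]] := rhoP x setT (filterT : nbhs x setT).
  apply: lt_le_trans (weighted_sum_ge rho01 k x).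
  by rewrite (nbhs_singleton r1) mulr1 exprn_gt0.
move=> k k0; have [j jk] := exp_half_small k0.
have [K KP] := choice (fun i => let: ex_intro2 K a b := cK i in
  ex_intro (fun K => compact K /\ forall x, rho i x <> 0 -> K x) K (conj a b)).
exists (\big[setU/set0]_(i < j) K i).
  by apply: bigsetU_compact => i _; exact: (KP i).1.
move=> x kD; apply: contrapT => nK.
have r0 i : (i < j)%N -> rho i x = 0.
  move=> ij; apply: contrapT => ri; apply: nK.
  rewrite -bigcup_mkord; exists i => //; exact: (KP i).2.
have /andP[_] := weighted_sum_bounds rho01 j x.
have -> : partial_sum rho j x = 0.
  by rewrite /partial_sum big1 // => i _; rewrite r0 // mulr0.
lra.
Qed.

Section fiber_weight.
Context {R : realType} {n m : nat} {M : manifold R n} {B : manifold R m}.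
Variable pi : M -> B.
Hypothesis hpi : submersion pi.
Variable D : M -> R.
Hypothesis cD : continuous D.
Hypothesis D0 : forall x, 0 < D x.
Hypothesis Dproper : forall k, 0 < k -> exists2 K, compact K & forall x, k <= D x -> K x.

Lemma weight_near x e : 0 < e -> nbhs x [set y | `|D y - D x| < e].
Proof. by move=> e0; apply: dist_continuous e0; exact: cD. Qed.

(** Comparing with every point of the fiber avoids forming a maximum and relaxes as [l] grows. *)
Definition heavy (l : R) (x : M) := forall y, pi y = pi x -> (1 - l) * D y < D x.

(** A maximum point of [D] on the fiber is heavy for all [l] at once; it exists because [D] is
    proper. *)
Lemma heavy_exists x0 : exists2 x, pi x = pi x0 & forall l, 0 < l < 1 -> heavy l x.
Proof.
have [K cK KP] := Dproper (D0 x0).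
pose S := [set x | pi x = pi x0 /\ D x0 <= D x].
have SK : S `<=` K by move=> x [_ /KP].
have cS : closed S.
  apply: closedI.
    apply: (@closed_comp _ _ pi [set pi x0]).
      by move=> x _; exact: submersion_continuous.
    by apply: accessible_closed_set1; apply: hausdorff_accessible; exact: manifold_hausdorff.
  apply: (@closed_comp _ _ D [set y : R | D x0 <= y]).
    by move=> x _; exact: cD.
  exact: closed_ge.
have kS : compact S by apply: subclosed_compact cS cK SK.
have S0 : S !=set0 by exists x0.
have [x Sx xmax] := compact_EVT_max S0 kS (continuous_subspaceT cD).
rewrite inE in Sx; exists x; first by case: Sx.
move=> l /andP[l0 l1] y pyx.
have Dyx : D y <= D x.
  have [yx0|x0y] := leP (D x0) (D y).
    by apply: xmax; rewrite inE; split => //; rewrite pyx; case: Sx.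
  by apply: le_trans (ltW x0y) _; case: Sx.
have := D0 y; nra.
Qed.

Lemma fiber_separated (x y : M) : pi x <> pi y ->
  exists U V, [/\ nbhs x U, nbhs y V & forall x' y', U x' -> V y' -> pi x' <> pi y'].
Proof.
move=> xy.
have hB := @manifold_hausdorff _ _ B.
rewrite open_hausdorff in hB.
have /hB[[U V] /= [Ux Vy] [oU oV UV]] : pi x != pi y by apply/eqP.
rewrite !inE in Ux Vy.
exists (pi @^-1` U), (pi @^-1` V); split.
- by apply: pi_nbhs => //; exact: open_nbhs_nbhs.
- by apply: pi_nbhs => //; exact: open_nbhs_nbhs.
move=> x' y' /= Ux' Vy' e.
have : (U `&` V) (pi x') by split => //; rewrite e.
by move/eqP: UV => ->.
Qed.

(** Competitors of weight at least [D x0 / 2] lie in a compact set, over which the condition is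
    stable: points of other fibers are separated from [x0], those of its own fiber satisfy a strict
    inequality. Lighter competitors do no harm near [x0]. *)
Lemma heavy_open l x0 : 0 < l < 1 -> heavy l x0 -> nbhs x0 (heavy l).
Proof.
move=> /andP[l0 l1] hx0; have k0 : 0 < D x0 / 2 by rewrite divr_gt0.
have [K cK KP] := Dproper k0.
have := iffLR (compact_near_coveringP K) cK M (nbhs x0)
  (fun x y => pi y = pi x -> (1 - l) * D y < D x) _ _.
move=> H.
have {}H : \forall x \near x0, K `<=` (fun y => pi y = pi x -> (1 - l) * D y < D x).
  apply: H => y1 Ky1.
  have [py|py] := pselect (pi y1 = pi x0); last first.
    have [U [V [Uy Vx UV]]] := fiber_separated py.
    exists (U, V) => //= -[y x] [/= Uy' Vx'] e.
    by exfalso; exact: UV Uy' Vx' e.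
  pose e := (D x0 - (1 - l) * D y1) / 2.
  have e0 : 0 < e by rewrite divr_gt0 // subr_gt0; exact: hx0.
  exists ([set y | `|D y - D y1| < e], [set x | `|D x - D x0| < e]) => /=.
    by split; [exact: weight_near|exact: weight_near].
  move=> [y x] [/=]; rewrite !ltr_norml => /andP[h1 h2] /andP[h3 h4] _.
  have : (1 - l) * (D y - D y1) <= e.
    have : (1 - l) * (D y - D y1) <= (1 - l) * e by rewrite ler_pM2l ?subr_gt0 // ltW.
    have : l * e >= 0 by rewrite mulr_ge0 // ltW.
    lra.
  rewrite /e in h3 *; lra.
have n2 := @weight_near x0 _ k0.
apply: filterS (filterI H n2) => x [/= H1]; rewrite ltr_norml => /andP[h1 h2] y pyx.
have [Ky|nKy] := pselect (K y); first exact: H1.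
have Dy : D y < D x0 / 2 by rewrite ltNge; apply/negP => /KP.
have := D0 y; nra.
Qed.

(** A strictly too heavy competitor persists: [pi] is open, so all nearby fibers pass near [y0]. *)
Lemma not_heavy_near l x0 : 0 < l < 1 -> (exists2 y, pi y = pi x0 & D x0 < (1 - l) * D y) ->
  exists U V, [/\ nbhs x0 U, nbhs (pi x0) V & forall x, U x -> V (pi x) -> ~ heavy l x].
Proof.
move=> /andP[l0 l1] [y0 py0 hy0].
pose e := ((1 - l) * D y0 - D x0) / 2.
have e0 : 0 < e by rewrite divr_gt0 // subr_gt0.
exists [set x | `|D x - D x0| < e], (pi @` [set y | `|D y - D y0| < e]); split.
- exact: weight_near.
- by rewrite -py0; apply: submersion_open => //; exact: weight_near.
move=> x /= Ux [y Vy pyx] /(_ y pyx); move: Ux Vy.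
rewrite !ltr_norml => /andP[h1 h2] /andP[h3 h4].
have : - e <= (1 - l) * (D y - D y0).
  have : (1 - l) * (- e) <= (1 - l) * (D y - D y0) by rewrite ler_pM2l ?subr_gt0 // ltW.
  have : l * e >= 0 by rewrite mulr_ge0 // ltW.
  lra.
rewrite /e in h2 *; lra.
Qed.

End fiber_weight.

(** * The nested cone fields on the base *)

Section family.
Context {R : realType} {n m : nat} {M : manifold R n} {B : manifold R m}.
Local Notation dom x := (cdom (chart_at x)).
Local Notation phi x := (cmap (chart_at x)).
Local Notation phiV x := (cinv (chart_at x)).
Variable pi : M -> B.
Hypothesis hpi : submersion pi.
Variables (ver : tangent_subsets M) (g g' : tensor2 M).
Hypothesis hg : lorentzian_mod ver g.
Hypothesis hg' : lorentzian_mod ver g'.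
Variable T' : tangent_subsets M.
Hypothesis hT' : time_orientation ver g' T'.
Hypothesis wide : forall x (v : 'rV[R]_n), ~ @ver x v ->
  ev g (v : tangent x) v <= 0 -> ev g' (v : tangent x) v < 0.
Hypothesis kerpi : forall x (k : 'rV[R]_n),
  @ver x k <-> differential pi (k : tangent x) = 0.
Hypothesis Onon : forall x, exists v : 'rV[R]_n, timelike g' T' (v : tangent x).
Variable D : M -> R.
Hypothesis cD : continuous D.
Hypothesis D0 : forall x, 0 < D x.
Hypothesis Dproper : forall k, 0 < k -> exists2 K, compact K & forall x, k <= D x -> K x.
Hypothesis surpi : forall b, exists x, pi x = b.

Let dpi x (v : 'rV[R]_n) : 'rV[R]_m := differential pi (v : tangent x).

Lemma equal_image_ver x (v v' : 'rV[R]_n) : dpi x v = dpi x v' -> @ver x (v' - v).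
Proof.
move=> vv'; apply/kerpi; rewrite -/(dpi x (v' - v)).
by rewrite /dpi (blinB _ _ (differential_blin hpi x)) -/(dpi x v') -vv' subrr.
Qed.

Lemma ev_equal_image (t : tensor2 M) x (v v' w : 'rV[R]_n) :
  lorentzian_mod ver t -> dpi x v = dpi x v' ->
  ev t (v' : tangent x) w = ev t (v : tangent x) w.
Proof.
move=> ht /equal_image_ver vv'; rewrite -[v'](subrK v) ev_Dl (kernel_ev0 ht _ vv').
by rewrite add0r.
Qed.

Lemma ev_equal_image2 (t : tensor2 M) x (v v' : 'rV[R]_n) :
  lorentzian_mod ver t -> dpi x v = dpi x v' ->
  ev t (v' : tangent x) v' = ev t (v : tangent x) v.
Proof.
move=> ht vv'; rewrite (ev_equal_image _ ht vv') (ev_sym (lor_symmetric ht)).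
exact: ev_equal_image ht vv'.
Qed.

Definition mixed l x (v : 'rV[R]_n) : R :=
  (1 - l) * ev g (v : tangent x) v + l * ev g' (v : tangent x) v.

Definition family_cone (l : R) : tangent_subsets B := fun b w =>
  exists x, pi x = b /\ heavy pi D l x /\ exists v : 'rV[R]_n,
    [/\ timelike g' T' (v : tangent x), mixed l x v < 0 & dpi x v = w].

Lemma timelike_scale x (s : R) (v : 'rV[R]_n) : 0 < s ->
  timelike g' T' (v : tangent x) -> timelike g' T' (s *: v : tangent x).
Proof.
move=> s0 [Tv gv]; have gsv : ev g' (s *: v : tangent x) (s *: v) < 0.
  by rewrite ev_Zl ev_Zr !pmulr_rlt0.
split => //; apply: (ev_lt0_wedge_r hg' hT' Tv) => //.
by rewrite ev_Zr pmulr_rlt0.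
Qed.

Lemma mixed_scale l x (s : R) (v : 'rV[R]_n) : mixed l x (s *: v) = s ^+ 2 * mixed l x v.
Proof. by rewrite /mixed !ev_Zl !ev_Zr; ring. Qed.

Lemma family_cone_scale l b (s : R) (w : 'rV[R]_m) : 0 < s ->
  family_cone l (w : tangent b) -> family_cone l (s *: w : tangent b).
Proof.
move=> s0 [x [px [hx [v [Tv mv vw]]]]]; exists x; split => //; split => //.
exists (s *: v); split; first exact: timelike_scale.
  by rewrite mixed_scale pmulr_rlt0 // exprn_gt0.
by rewrite /dpi (blinZ _ _ (differential_blin hpi x)) -/(dpi x v) vw.
Qed.

Lemma timelike_dpi_neq0 x (v : 'rV[R]_n) : timelike g' T' (v : tangent x) ->
  dpi x v != 0.
Proof.
move=> [_ gv]; apply/eqP => v0; have /(kernel_ev0 hg') : @ver x v by apply/kerpi.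
by move=> h; move: gv; rewrite h ltxx.
Qed.

Lemma family_cone_neq0 l b (w : 'rV[R]_m) : family_cone l (w : tangent b) -> w != 0.
Proof. by move=> [x [_ [_ [v [Tv _ <-]]]]]; exact: timelike_dpi_neq0. Qed.

Lemma form_near (t : tensor2 M) x0 (v0 y0 : 'rV[R]_n) e : smooth_tensor2 t -> 0 < e ->
  exists2 d, 0 < d & forall u v, `|u - phi x0 x0| < d -> `|v - v0| < d ->
   `|ev t (vect x0 (phiV x0 u) v) (vect x0 (phiV x0 u) v) - ev t (v0 : tangent x0) v0| < e /\
   `|ev t (vect x0 (phiV x0 u) v) (vect x0 (phiV x0 u) y0) - ev t (v0 : tangent x0) y0| < e.
Proof.
move=> st e0; have xx := chart_at_dom x0.
have E (a b : 'rV[R]_n) : tensor_in x0 t (phi x0 x0) a b = ev t (a : tangent x0) b.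
  by rewrite /tensor_in (cmapK xx) /vect !(change_coord_id _ xx).
have [d1 d10 d1P] := tensor_in_continuous st v0 v0 xx e0.
have [d2 d20 d2P] := tensor_in_continuous st v0 y0 xx e0.
exists (Num.min d1 d2); first by rewrite lt_min d10.
move=> u v; rewrite !lt_min => /andP[u1 u2] /andP[v1 v2]; split.
  by have := d1P u v v u1 v1 v1; rewrite E.
have y2 : `|y0 - y0| < d2 by rewrite subrr normr0.
by have := d2P u v y0 u2 v2 y2; rewrite E.
Qed.

(** Vectors near [w0] are lifted at points near [x0] with values of both forms close to those of one
    fixed lift [v0]. The vector [y], constant in a chart, is timelike at all these points and serves
    to test the time orientation. *)
Lemma near_forms x0 (w0 : 'rV[R]_m) (y0 : 'rV[R]_n) : timelike g' T' (y0 : tangent x0) ->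
  exists2 v0, dpi x0 v0 = w0 & forall e, 0 < e -> exists U d,
    [/\ nbhs x0 U, 0 < d & forall x w, U x -> `|w - w0| < d ->
      exists v y : 'rV[R]_n, [/\ dpi x v = vect (pi x0) (pi x) w,
        timelike g' T' (y : tangent x) &
        [/\ `|ev g (v : tangent x) v - ev g (v0 : tangent x0) v0| < e,
        `|ev g' (v : tangent x) v - ev g' (v0 : tangent x0) v0| < e &
        `|ev g' (v : tangent x) y - ev g' (v0 : tangent x0) y0| < e]]].
Proof.
move=> Ty0; have xx := chart_at_dom x0.
have [sigma [C [bs C0 sC As Hloc]]] := submersion_local hpi x0.
exists (sigma w0); first exact: As.
move=> e e0.
have [d1 d10 d1P] := @form_near _ x0 (sigma w0) y0 _ (lor_smooth hg) e0.
have [d2 d20 d2P] := @form_near _ x0 (sigma w0) y0 _ (lor_smooth hg') e0.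
have [d3 [e3 box]] := timelike_cone_box hg' hT' Ty0.
have [d30 e30 boxP] := box.
pose eta := Num.min d1 d2.
have eta0 : 0 < eta by rewrite lt_min d10.
have eta2 : 0 < eta / 2 by rewrite divr_gt0.
have [e1 e10 e1P] : exists2 e1, 0 < e1 & e1 * (2 * C * C * (`|w0| + 1)) < eta / 2.
  by apply: small_factor; rewrite // !mulr_ge0 ?addr_ge0 // ltW.
pose e4 := Num.min e1 (2 * C)^-1.
have e40 : 0 < e4 by rewrite lt_min e10 invr_gt0 mulr_gt0.
have eC : e4 * C <= 2^-1.
  apply: (@le_trans _ _ ((2 * C)^-1 * C)).
    by rewrite ler_pM2r // ge_min lexx orbT.
  by rewrite invfM mulfVK ?gt_eqF.
have ee1 : e4 <= e1 by rewrite ge_min lexx.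
have [d [d_gt0 dP _ _ Hr]] := Hloc e4 e40 eC.
have [d5 d50 d5P] := small_factor (ltW C0) eta2.
pose r := Num.min (Num.min d d3) (Num.min d1 d2).
have r0 : 0 < r by rewrite !lt_min d_gt0 d30 d10.
exists [set x | dom x0 x /\ `|phi x0 x - phi x0 x0| < r], (Num.min d5 1).
split; [exact: chart_nbhs|by rewrite lt_min d50 ltr01|].
move=> x w /= [zx]; rewrite !lt_min => /andP[/andP[xd xd3] /andP[xd1 xd2]] /andP[w5 w1].
have [_ _] := dP _ xd; rewrite (cmapK zx) => bx.
have [v [vw vs]] := Hr _ w xd; rewrite (cmapK zx) in vw.
have vv0 : `|v - sigma w0| < eta.
  have -> : v - sigma w0 = (v - sigma w) + sigma (w - w0).
    by rewrite (blinB _ _ bs) addrA subrK.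
  apply: le_lt_trans (ler_normD _ _) _.
  have nw : `|w| <= `|w0| + 1.
    by have := ler_distD w0 w 0; rewrite !subr0; lra.
  have h1 : 2 * C * C * e4 * `|w| <= e1 * (2 * C * C * (`|w0| + 1)).
    have -> : 2 * C * C * e4 * `|w| = e4 * (2 * C * C * `|w|) by ring.
    by apply: ler_pM => //; rewrite ?(ltW e40) ?mulr_ge0 ?(ltW C0) // ler_pM2l ?mulr_gt0.
  have h2 : C * `|w - w0| <= d5 * C by rewrite mulrC ler_pM2r // ltW.
  have := sC (w - w0); lra.
move: (vv0); rewrite /eta lt_min => /andP[v1 v2].
exists (vect x0 x v), (vect x0 x y0).
have [f1 _] := d1P _ _ xd1 v1; have [f2 f3] := d2P _ _ xd2 v2.
rewrite (cmapK zx) in f1 f2 f3.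
split; last by split; [exact: f1|exact: f2|exact: f3].
  by rewrite /dpi (differential_vect hpi _ zx bx) vw.
have [_ _] := boxP _ xd3; rewrite (cmapK zx); apply.
by rewrite subrr normr0.
Qed.

(** Either [(x0, w0)] violates a weak inequality for [l], and then no pair near it enters [Q l]; or
    it satisfies all of them, hence the strict ones for [l'], which are stable. *)
Lemma family_cone_local b l l' (x0 : M) (w0 : 'rV[R]_m) : 0 < l -> l < l' -> l' < 1 ->
  `|w0| = 1 -> exists2 d, 0 < d & exists U V, [/\ nbhs x0 U, nbhs w0 V &
   forall x w u u' w', U x -> V w -> `|u - phi b b| < d -> `|u' - phi b b| < d ->
     pi x = phiV b u -> `|w' - w| <= d -> heavy pi D l x ->
     (exists v : 'rV[R]_n, [/\ timelike g' T' (v : tangent x), mixed l x v < 0 &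
        dpi x v = vect b (phiV b u) w]) ->
     family_cone l' (vect b (phiV b u') w')].
Proof.
move=> l0 ll' l'1 nw0; have bb := chart_at_dom b.
have [px0|px0] := pselect (pi x0 = b); last first.
  have hB := @manifold_hausdorff _ _ B; rewrite open_hausdorff in hB.
  have /hB[[U V] /= [Ux Vb] [oU oV UV]] : pi x0 != b by apply/eqP.
  rewrite !inE in Ux Vb.
  have [d d0 dP] := chart_ball bb (open_nbhs_nbhs (conj oV Vb)).
  exists d => //; exists (pi @^-1` U), setT; split.
  - by apply: pi_nbhs => //; exact: open_nbhs_nbhs.
  - exact: filterT.
  move=> x w u u' w' Ux' _ /dP[_ _ Vu] _ pxu; exfalso.
  have : (U `&` V) (pi x) by split => //; rewrite pxu.
  by move/eqP: UV => ->.
subst b.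
have l01 : 0 < l < 1 by rewrite l0 (lt_trans ll').
have l'01 : 0 < l' < 1 by rewrite l'1 (lt_trans l0).
have [[y py hy]|nh] := pselect (exists2 y, pi y = pi x0 & D x0 < (1 - l) * D y).
  have [U [V [Ux Vx UV]]] := not_heavy_near hpi cD l01 (ex_intro2 _ _ y py hy).
  have [d d0 dP] := chart_ball bb Vx.
  exists d => //; exists U, setT; split => //; first exact: filterT.
  move=> x w u u' w' Ux' _ /dP[_ _ Vu] _ pxu _ hx; exfalso.
  by apply: (UV x) => //; rewrite pxu.
(* No competitor is strictly too heavy for [l], and [1 - l' < 1 - l] makes the inequality strict. *)
have hx0 : heavy pi D l' x0.
  move=> y py; have := D0 y; have : ~ D x0 < (1 - l) * D y by move=> h; apply: nh; exists y.
  move/negP; rewrite -leNgt => h1 h2; apply: lt_le_trans h1.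
  by rewrite ltr_pM2r //; lra.
have [y0 Ty0] := Onon x0.
have [v0 v0w near] := @near_forms x0 w0 y0 Ty0.
(* The vacuous cases: if forms [e]-close to those at [v0] exclude vectors of the cone, the
   hypothesis fails near [(x0, w0)] and any [d] serves, here [1]. *)
have bad (e : R) : 0 < e ->
   (forall x (v y a : 'rV[R]_n), timelike g' T' (y : tangent x) ->
     `|ev g (v : tangent x) v - ev g (v0 : tangent x0) v0| < e ->
     `|ev g' (v : tangent x) v - ev g' (v0 : tangent x0) v0| < e ->
     `|ev g' (v : tangent x) y - ev g' (v0 : tangent x0) y0| < e ->
     dpi x v = dpi x a -> timelike g' T' (a : tangent x) -> mixed l x a < 0 -> False) ->
   exists2 d, 0 < d & exists U V, [/\ nbhs x0 U, nbhs w0 V &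
   forall x w u u' w', U x -> V w -> `|u - phi (pi x0) (pi x0)| < d ->
     `|u' - phi (pi x0) (pi x0)| < d ->
     pi x = phiV (pi x0) u -> `|w' - w| <= d -> heavy pi D l x ->
     (exists v : 'rV[R]_n, [/\ timelike g' T' (v : tangent x), mixed l x v < 0 &
        dpi x v = vect (pi x0) (phiV (pi x0) u) w]) ->
     family_cone l' (vect (pi x0) (phiV (pi x0) u') w')].
  move=> e0 H; have [U [d [Ux d0 UP]]] := near e e0.
  exists 1; first exact: ltr01.
  exists U, [set w | `|w - w0| < d]; split; [exact: Ux|exact: norm_nbhs d0 _|].
  move=> x w u u' w' Ux' Vw _ _ pxu _ _ [a [Ta ma aw]]; exfalso.
  have [v [y [vw Ty [f1 f2 f3]]]] := UP x w Ux' Vw.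
  apply: (H x v y a Ty f1 f2 f3 _ Ta ma).
  apply: (etrans vw); rewrite pxu; exact: esym aw.
have l1 : 0 < 1 - l by lra.
have l1' : 0 < 1 - l' by lra.
have l'0 : 0 < l' by lra.
have [m0|m0] := ltP 0 (mixed l x0 v0).
  apply: (bad _ m0) => x v y a Ty f1 f2 f3 va Ta.
  rewrite /mixed (ev_equal_image2 hg va) (ev_equal_image2 hg' va).
  move: f1 f2; rewrite /mixed !ltr_norml => /andP[f1 _] /andP[f2 _].
  rewrite -(ltr_pM2l l1) in f1; rewrite -(ltr_pM2l l0) in f2.
  by move=> h; lra.
have [g0|g0] := ltP 0 (ev g' (v0 : tangent x0) v0).
  apply: (bad _ g0) => x v y a Ty f1 f2 f3 va [_ ga] _.
  by move: f2 ga; rewrite (ev_equal_image2 hg' va) ltr_norml => /andP[f2 _]; lra.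
have [y1|y1] := ltP 0 (ev g' (v0 : tangent x0) y0).
  apply: (bad _ y1) => x v y a Ty f1 f2 f3 va Ta _.
  have := wedge_ev_lt0 hg' hT' Ta.1 Ty.1 Ty.2.
  by move: f3; rewrite (ev_equal_image y hg' va) ltr_norml => /andP[f3 _]; lra.
have nver : ~ @ver x0 v0.
  by move=> /kerpi; rewrite -/(dpi x0 v0) v0w => w00; move: nw0; rewrite w00 normr0; lra.
have y1' : ev g' (v0 : tangent x0) y0 < 0.
  rewrite lt_neqAle y1 andbT; apply/eqP.
  by apply: (causal_ev_neq0 hg'); [split|exact: Ty0.2].
(* By width when [v0] is [g]-causal; otherwise the mixture is nonpositive with a positive [g]-part,
   so the [g']-part is negative and the mixture decreases in [l]. *)
have [g'neg mneg] : ev g' (v0 : tangent x0) v0 < 0 /\ mixed l' x0 v0 < 0.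
  move: m0; rewrite /mixed; have [gneg|gpos] := leP (ev g (v0 : tangent x0) v0) 0.
    have g'neg := wide nver gneg; split => //.
    have : (1 - l') * ev g (v0 : tangent x0) v0 <= 0 by rewrite mulr_ge0_le0 // ltW.
    have : l' * ev g' (v0 : tangent x0) v0 < 0 by rewrite pmulr_rlt0.
    lra.
  move=> m0; have h1 : 0 < (1 - l) * ev g (v0 : tangent x0) v0 by rewrite mulr_gt0.
  have h2 : ev g' (v0 : tangent x0) v0 < 0.
    have : l * ev g' (v0 : tangent x0) v0 < 0 by lra.
    by rewrite pmulr_rlt0.
  split => //.
  have h3 : 0 < (l' - l) * ev g (v0 : tangent x0) v0 by rewrite mulr_gt0 // subr_gt0.
  have h4 : (l' - l) * ev g' (v0 : tangent x0) v0 < 0 by rewrite pmulr_rlt0 // subr_gt0.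
  lra.
clear bad.
pose e := Num.min (- mixed l' x0 v0)
  (Num.min (- ev g' (v0 : tangent x0) v0) (- ev g' (v0 : tangent x0) y0)).
have e0 : 0 < e by rewrite !lt_min !oppr_gt0 mneg g'neg.
have [U [d [Ux d0 UP]]] := near e e0.
have nI : nbhs x0 (U `&` heavy pi D l').
  by apply: filterI; [exact: Ux|exact: (heavy_open hpi cD D0 Dproper l'01 hx0)].
have nb := submersion_open hpi nI.
have [d2 d20 d2P] := chart_ball bb nb.
have d1d : 0 < Num.min d2 (d / 2) by rewrite lt_min d20 divr_gt0.
have d2' : 0 < d / 2 by rewrite divr_gt0.
exists (Num.min d2 (d / 2)); first exact: d1d.
exists setT, [set w | `|w - w0| < d / 2]; split.
- exact: filterT.
- exact: norm_nbhs d2' _.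
move=> x w u u' w' _ /= ww0 _; rewrite !lt_min le_min => /andP[u'd _] _ /andP[_ w'w] _ _.
(* [w'] sits over another base point than [w]; openness of [pi] gives over it a point near [x0] that
   is heavy for [l']. *)
have [_ _ [x' [Ux' hx'] px']] := d2P _ u'd.
have w'd : `|w' - w0| < d by have := ler_distD w w' w0; lra.
have [v [y [vw Ty [f1 f2 f3]]]] := UP x' w' Ux' w'd.
exists x'; split; first exact: px'.
split; first exact: hx'.
move: f1 f2 f3; rewrite /e !lt_min !ltr_norml.
move=> /and3P[/andP[_ a1] _ _] /and3P[/andP[_ b1] /andP[_ b2] _].
move=> /and3P[_ _ /andP[_ c3]].
have gv : ev g' (v : tangent x') v < 0 by lra.
have gvy : ev g' (v : tangent x') y < 0 by lra.
have cv : causal_vectors ver g' x' v.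
  by split; [move=> /(kernel_ev0 hg') h; move: gv; rewrite h ltxx|exact: ltW].
exists v; split.
- by split => //; exact: (ev_lt0_wedge hg' hT' Ty.1 Ty.2 cv gvy).
- move: a1 b1; rewrite /mixed; move=> a1 b1.
  rewrite -(ltr_pM2l l1') in a1; rewrite -(ltr_pM2l l'0) in b1; lra.
- apply: (etrans vw).
  exact: (congr1 (fun p => vect (pi x0) p w' : 'rV[R]_m) px').
Qed.

Lemma sphere_compact k : compact [set w : 'rV[R]_k | `|w| = 1].
Proof.
apply: bounded_closed_compact.
  exists 1; split; first exact: num_real.
  by move=> c c1 w /= ->; exact: ltW.
apply: (@closed_comp _ _ (fun w : 'rV[R]_k => `|w|) [set 1]).
  by move=> w _; exact: norm_continuous.
exact: closed_eq.
Qed.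

(** Scaling reduces to unit vectors, and over a neighbourhood of [b] the heavy points lie in a
    compact set; the local statements then become uniform. *)
Lemma family_cone_nest b l l' : 0 < l -> l < l' -> l' < 1 ->
  exists d e, [/\ 0 < d, 0 < e & forall u u' w w', `|u - phi b b| < d ->
    `|u' - phi b b| < d -> family_cone l (vect b (phiV b u) w) ->
    `|w' - w| <= e * `|w| -> family_cone l' (vect b (phiV b u') w')].
Proof.
move=> l0 ll' l'1; have bb := chart_at_dom b.
have [x1 px1] := surpi b.
have l1 : 0 < 1 - l by lra.
(* Fibers near that of [x1] contain a point of weight above [D x1 / 2], so their heavy points have
   weight above this constant. *)
have k0 : 0 < (1 - l) * (D x1 / 2) by rewrite mulr_gt0 // divr_gt0.
have [K cK KP] := Dproper k0.
have D2 : 0 < D x1 / 2 by rewrite divr_gt0.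
have nb := submersion_open hpi (@weight_near _ _ _ _ cD x1 _ D2).
rewrite px1 in nb; have [d1 d10 d1P] := chart_ball bb nb.
pose P (d : R) (q : M * 'rV[R]_m) := forall u u' w', `|u - phi b b| < d ->
  `|u' - phi b b| < d -> pi q.1 = phiV b u -> `|w' - q.2| <= d -> heavy pi D l q.1 ->
  (exists v : 'rV[R]_n, [/\ timelike g' T' (v : tangent q.1), mixed l q.1 v < 0 &
     dpi q.1 v = vect b (phiV b u) q.2]) ->
  family_cone l' (vect b (phiV b u') w').
have [d d0 dP] : exists2 d, 0 < d & forall q, (K `*` [set w : 'rV[R]_m | `|w| = 1]) q -> P d q.
  apply: compact_uniform.
  - by apply: compact_setX => //; exact: sphere_compact.
  - move=> d d' q dd' Pd u u' w' ud u'd pxu w'w; apply: Pd pxu _.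
    + exact: lt_le_trans ud dd'.
    + exact: lt_le_trans u'd dd'.
    + exact: le_trans w'w dd'.
  move=> [x0 w0] [/= _ nw0].
  have [d d0 [U [V [Ux Vw UV]]]] := @family_cone_local b l l' x0 w0 l0 ll' l'1 nw0.
  exists d => //; exists (U, V) => //= -[x w] [/= Ux' Vw'] u u' w' ud u'd pxu w'w hx H.
  exact: (UV x w u u' w').
exists (Num.min d d1), d; split => //; first by rewrite lt_min d0.
move=> u u' w w'; rewrite !lt_min => /andP[ud ud1] /andP[u'd u'd1] Qw ww'.
have [x [px [hx [v [Tv mv vw]]]]] := Qw.
have [zu eu Hu] := d1P _ ud1.
have [zu' _ _] := d1P _ u'd1.
have [_ bl] := trans_sdiff zu (chart_at_dom (phiV b u)).
have [_ bl'] := trans_sdiff zu' (chart_at_dom (phiV b u')).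
have w0 : w != 0.
  apply/eqP => w0; have := family_cone_neq0 Qw.
  by rewrite w0 /vect (blin0 bl) eqxx.
have nw : 0 < `|w| by rewrite normr_gt0.
have ni : 0 < `|w|^-1 by rewrite invr_gt0.
have Kx : K x.
  apply: KP; have [y Dy py] := Hu.
  have := hx y; rewrite px py => /(_ erefl); move: Dy => /=.
  rewrite ltr_norml => /andP[h1 _] h2; apply: le_trans (ltW h2).
  rewrite ler_pM2l //; lra.
have sph : (K `*` [set w : 'rV[R]_m | `|w| = 1]) (x, `|w|^-1 *: w).
  by split => //=; rewrite normrZ gtr0_norm // mulVf // gt_eqF.
have Qw' : family_cone l' (vect b (phiV b u') (`|w|^-1 *: w')).
  apply: (dP _ sph u u' (`|w|^-1 *: w') ud u'd px _ hx) => /=.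
    rewrite -scalerBr normrZ gtr0_norm // mulrC ler_pdivrMr //.
  exists (`|w|^-1 *: v); split; first exact: timelike_scale.
    by rewrite mixed_scale pmulr_rlt0 // exprn_gt0.
  rewrite /dpi (blinZ _ _ (differential_blin hpi x)) -/(dpi x v) vw.
  by rewrite /vect (blinZ _ _ bl).
have := family_cone_scale nw Qw'; rewrite /vect (blinZ _ _ bl') scalerA mulfV ?gt_eqF//.
by rewrite scale1r.
Qed.

End family.

(** * Projecting causal curves to the base *)

Section projected_curves.
Context {R : realType} {n m : nat} {M : manifold R n} {B : manifold R m}.
Local Notation dom x := (cdom (chart_at x)).
Local Notation phi x := (cmap (chart_at x)).

Lemma velocity_sdiff (J : set R) (s : R -> M) (t : R) : open J -> J t ->
  smooth_curve_on J s ->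
  sdiff (phi (s t) \o s : R^o -> 'rV[R]_n) t (fun r : R^o => r *: (velocity s t : 'rV[R]_n)).
Proof.
move=> oJ Jt [cs sm]; have tt := chart_at_dom (s t).
pose U : set R^o := J `&` [set u | dom (s t) (s u)].
have oU : open U.
  rewrite openE => u [Ju du].
  apply: filterI; first exact: open_nbhs_nbhs.
  apply: (cs u Ju); apply: open_nbhs_nbhs; split => //; exact: cdom_open.
have Ut : U t by [].
have C1 : Ck_on 1 U (phi (s t) \o s : R^o -> 'rV[R]_n) := sm (s t) 1.
have df := C1.1 _ Ut.
have dE (r : R^o) : 'd (phi (s t) \o s : R^o -> 'rV[R]_n) t r = r *: (velocity s t : 'rV[R]_n).
  by rewrite /velocity (deriveE _ df) -linearZ /= [_ *: _]mulr1.
have sd := C1_sdiff_R oU Ut C1.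
move=> e e0; have [d d0 dP] := sd e e0; exists d; first exact: d0.
by move=> y y' yd y'd; have := dP y y' yd y'd; rewrite dE.
Qed.

Variable pi : M -> B.
Hypothesis hpi : submersion pi.

Lemma submersion_curve_sdiff (s : R -> M) (t : R) (v : 'rV[R]_n) (w : 'rV[R]_m) :
  {for t, continuous s} ->
  sdiff (phi (s t) \o s : R^o -> 'rV[R]_n) t (fun r : R^o => r *: v) ->
  w = differential pi (v : tangent (s t)) ->
  sdiff (phi (pi (s t)) \o (pi \o s) : R^o -> 'rV[R]_m) t (fun r : R^o => r *: w).
Proof.
move=> cs ss wE; have tt := chart_at_dom (s t); have bb := chart_at_dom (pi (s t)).
have [d d0 dP] := curve_near cs (open_nbhs_nbhs (conj (@cdom_open _ _ _ _) tt)).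
have [sp bp] := local_sdiff hpi tt bb.
have sc := sdiff_comp (blin_scale v) bp ss sp.
have E : (local_diff pi (s t) (pi (s t)) (s t) \o (fun r : R^o => r *: v)) =
   (fun r : R^o => r *: w).
  apply/funext => r /=; rewrite (blinZ _ _ bp); congr (_ *: _); exact: esym wE.
rewrite E in sc; apply: (sdiff_eq d0 _ sc) => y /dP zy.
by rewrite /local_map /= (cmapK zy).
Qed.

Variables (T : tangent_subsets M) (Q : tangent_subsets B).
Hypothesis TQ : forall x (v : 'rV[R]_n) (w : 'rV[R]_m), @T x v ->
  w = differential pi (v : tangent x) ->
  exists d e, cone_box Q (pi x) (phi (pi x) (pi x)) w d e.

Lemma arc_reach gam a b s t : directed_arc T gam a b -> a <= s -> s < t -> t <= b ->
  reach Q (pi (gam s)) (pi (gam t)).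
Proof.
move=> [c [e [e0 smc gc Tc]]] as_ st tb.
have sab : s \in `[a, b] by rewrite in_itv /= as_ (ltW (lt_le_trans st tb)).
have tab : t \in `[a, b] by rewrite in_itv /= (ltW (le_lt_trans as_ st)).
rewrite (gc s sab) (gc t tab).
apply: (reach_of_curve (gam := pi \o c) st) => u su ut.
have uab : u \in `[a, b] by rewrite in_itv /= (le_trans as_ su) (le_trans ut tb).
have Ju : `]a - e, b + e[%classic u.
  move: uab; rewrite /= !in_itv /= => /andP[h1 h2]; apply/andP; split; lra.
have cu := smc.1 u Ju.
have Tu := Tc u uab.
have oJ : open `]a - e, b + e[%classic by exact: interval_open.
have vs := velocity_sdiff oJ Ju smc.
split.
  by move=> A /(submersion_continuous hpi); exact: cu.
have [w wE] : exists w : 'rV[R]_m, w = differential pi (velocity c u) by eexists.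
have [d [e1 box]] := TQ Tu wE.
exists w, d, e1; split; first exact: box.
exact: submersion_curve_sdiff cu vs wE.
Qed.

Lemma causal_curve_reach gam a b s t : future_directed_causal_curve T a b gam ->
  a <= s -> s < t -> t <= b -> reach Q (pi (gam s)) (pi (gam t)).
Proof.
move=> [ab [k [u [u0 uk piece]]]] as_ st tb.
suff H i : (i <= k)%N -> forall s t, u 0%N <= s -> s < t -> t <= u i ->
    reach Q (pi (gam s)) (pi (gam t)).
  by apply: (H k) => //; rewrite ?u0 ?uk.
elim: i => [|i IH] ik {as_ st tb}s {}t us st tu; first by lra.
have [ui arc] := piece i ik.
have [ti|it] := leP t (u i); first exact: IH (ltnW ik) s t us st ti.
have [is_|si] := leP (u i) s; first exact: arc_reach arc is_ st tu.
apply: (@t_trans _ _ _ (pi (gam (u i)))).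
  exact: IH (ltnW ik) s (u i) us si (lexx _).
exact: arc_reach arc (lexx _) it tu.
Qed.

End projected_curves.

(** * Metric and time orientation pulled back from the base *)

Section simple_foliations.
Context {R : realType} {n m : nat} {M : manifold R n} {B : manifold R m}.
Variables (pi : M -> B) (ver : tangent_subsets M) (g : tensor2 M) (h : tensor2 B).
Hypothesis hpi : submersion pi.
Hypothesis hg : lorentzian_mod ver g.
Hypothesis hh : lorentzian_mod (zero_tangents B) h.
Hypothesis gE : forall (x : M) (v w : tangent x),
  ev g v w = ev h (differential pi v) (differential pi w).

(** Both sides describe the kernel of the pulled-back form: [h] is nondegenerate and the
    differential of [pi] is onto. *)
Lemma vertical_differential x (k : 'rV[R]_n) :
  @ver x k <-> differential pi (k : tangent x) = 0 :> 'rV[R]_m.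
Proof.
split=> [vk|k0].
  apply/(lor_kernel hh) => w.
  have [v <-] := hpi.2 x w.
  by rewrite -gE; exact: (kernel_ev0 hg _ vk).
apply/(lor_kernel hg) => w; rewrite gE.
have [a aE] : exists a : 'rV[R]_m, a = differential pi (k : tangent x) by eexists.
have a0 : @zero_tangents R m B (pi x) a by rewrite /zero_tangents aE.
by have := kernel_ev0 hh (differential pi w) a0; rewrite aE.
Qed.

Variables (T : tangent_subsets M) (TB : tangent_subsets B).
Hypothesis hT : time_orientation ver g T.
Hypothesis TTB : forall (x : M) (v : tangent x), causal_vectors ver g x v ->
  (@T x v <-> @TB (pi x) (differential pi v)).

(** Needed because the cones of [Q l] are collected at heavy points, which need not be those a given
    curve passes through. Causality for [g] and the choice of wedge are read off in [B], so they do
    not depend on the point of the fiber. *)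
Lemma future_lift x y (v : 'rV[R]_n) (w : 'rV[R]_m) : pi y = pi x -> @T x v ->
  w = differential pi (v : tangent x) ->
  exists2 v' : 'rV[R]_n, @T y v' & differential pi (v' : tangent y) = w.
Proof.
move=> yx Tv wE; have cv := wedge_causal hT Tv.
have Tw : @TB (pi x) (w : tangent (pi x)) by rewrite wE; apply/(TTB cv).
have hw : ev h (w : tangent (pi x)) w <= 0 by rewrite wE -gE; exact: cv.2.
have w0 : w <> 0 by rewrite wE => /vertical_differential; exact: cv.1.
clear v Tv wE cv; rewrite -yx in Tw hw.
have [v' v'w] := hpi.2 y w; exists v'; last exact: v'w.
apply/TTB; last by rewrite v'w.
split; first by move=> /vertical_differential; rewrite v'w.
by rewrite gE v'w.
Qed.

End simple_foliations.

Theorem proposition8p8 (R : realType) (n q : nat) (hn : (3 <= n)%N)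
    (hq : (2 <= q)%N) (M : manifold R n) (hM : connected [set: M])
    (F : foliation M q) (g : tensor2 M) (T : tangent_subsets M)
    (hg : transverse_lorentzian F g)
    (hT : transverse_time_orientation F g T)
    (hsimple : simple_foliation F g T)
    (hstable : transversely_stably_causal F g T) :
  exists f : M -> R, transverse_time_function T f.
Proof.
(* The definition of a manifold admits the empty space, for which every function qualifies. *)
have [M0|M0] := pselect (exists x : M, True); last first.
  exists (fun=> 0); split; first by move=> x; case: M0; exists x.
  by move=> a b gam; case: M0; exists (gam a).
have [x0 _] := M0.
have [m [B [h [TB [pi [[_ hh _] [hpi surpi leafE] gE TTB fib]]]]]] := hsimple.
have [g' [T' [hg1' wide hT' TT' cau]]] := hstable.
have hver := tl_lorentzian hg; have hver' := tl_lorentzian hg1'.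
have kerpi := vertical_differential hpi hver hh gE.
have T_timelike x (v : 'rV[R]_n) : @T x v -> timelike g' T' (v : tangent x).
  move=> Tv; have [nv gv] := wedge_causal hT Tv.
  by split; [exact: TT'|exact: wide].
have Onon x : exists v : 'rV[R]_n, timelike g' T' (v : tangent x).
  by have [v Tv] := wedge_nonempty hT x; exists v; exact: T_timelike.
have Overt x (v k : 'rV[R]_n) : differential pi (k : tangent x) = 0 ->
    timelike g' T' (v : tangent x) -> timelike g' T' (v + k : tangent x).
  by move=> /kerpi vk; exact: timelike_translate hver' _ hT' _ _ _ vk.
have hm : exists w : 'rV[R]_m, w <> 0.
  have [v Tv] := Onon x0; exists (differential pi (v : tangent x0)).
  by apply/eqP; exact: (timelike_dpi_neq0 hver' kerpi Tv).
have Ocausal x y : connected_component (pi @^-1` [set pi x]) x y ->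
    ~ reach (timelike g' T') x y.
  rewrite -leafE => xy rxy.
  have [b [gam [cgam gx gy]]] := reach_causal_curve (fun p v => @proj1 _ _) rxy.
  apply: (cau x); exists 0, b, gam; split; [exact: cgam| |].
    by rewrite gx; exact: Relation_Operators.rst_refl.
  by rewrite gy.
have [D [cD D0 Dproper]] := proper_weight M.
pose Q := family_cone pi g g' T' D.
have Qnest := family_cone_nest hpi hver hver' hT' wide kerpi Onon cD D0 Dproper surpi.
have Q0 l b (w : 'rV[R]_m) : @Q l b w -> w != 0.
  exact: (family_cone_neq0 hver' kerpi).
have mixed_lt0 l x (v : 'rV[R]_n) : 0 < l < 1 -> @T x v -> mixed g g' l x v < 0.
  move=> /andP[l0 l1] Tv; have [_ gv] := wedge_causal hT Tv.
  have [_ g'v] := T_timelike x v Tv.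
  rewrite /mixed ltr_wnDl //; first by rewrite mulr_ge0_le0 // subr_ge0 ltW.
  by rewrite pmulr_rlt0.
have Qnon l b : 0 < l < 1 -> exists w : 'rV[R]_m, @Q l b w.
  move=> l01; have [y yb] := surpi b.
  have [x xy xh] := heavy_exists hpi cD D0 Dproper y.
  have [v Tv] := wedge_nonempty hT x.
  exists (differential pi (v : tangent x)), x; split; first by rewrite xy.
  split; first exact: xh.
  exists v; split; [exact: T_timelike|exact: mixed_lt0|by []].
have Qirr l b : 0 < l < 1 -> ~ reach (Q l) b b.
  move=> _ rb; have Obox z (V : 'rV[R]_n) : timelike g' T' (V : tangent z) ->
      exists d e, cone_box (timelike g' T') z (cmap (chart_at z) z) V d e.
    by move=> TV; exact: (timelike_cone_box hver' hT' TV).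
  apply: (base_reach_irr hpi Obox Overt Onon hm fib Ocausal (c := b)).
  apply: (reach_base_reach hpi Obox Overt Onon hm fib _ rb).
  by move=> c w [x [xc [_ [v [Tv _ vw]]]]]; exists x, v; split.
have [f [cf fQ]] := base_time_function Qnest Q0 Qnon Qirr.
exists (f \o pi); split.
  by move=> x; apply: continuous_comp; [exact: (submersion_continuous hpi)|exact: cf].
move=> a b gam cgam s t as_ st tb; apply: fQ => l l01.
apply: (causal_curve_reach hpi _ cgam as_ st tb) => x v w Tv wE.
(* Nesting yields a box in [Q l] around vectors of a smaller field only, so the velocity is placed
   in [Q (l / 2)]. *)
have l2 : 0 < l / 2 < 1 by lra.
apply: (cone_box_of_nested Qnest Q0 (l := l / 2)); [lra|lra|lra|].
(* The velocity at [x] is transferred to a heavy point [y] of the same fiber. *)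
have [y yx yh] := heavy_exists hpi cD D0 Dproper x.
have [v' Tv' v'w] := future_lift hpi hver hh gE hT TTB yx Tv wE.
exists y; split; first exact: yx.
split; first exact: yh.
by exists v'; split; [exact: T_timelike|exact: mixed_lt0|exact: v'w].
Qed.
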